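(* Let $\varphi\in\mathfrak F^r$ be a regular phase function and let $a\in \mathrm{SG}^{0,0}_{r,\rho}(\mathbf R^{2d})$ with $r,\rho\ge0$. Then the type I $\mathrm{SG}$ Fourier integral operator $A=\operatorname{Op}_\varphi(a)$ belongs to $\mathcal L(L^2(\mathbf R^d))$, i.e. it extends from $\mathscr S(\mathbf R^d)$ to a bounded linear operator on $L^2(\mathbf R^d)$.
   Context: Notation: $\langle x\rangle=(1+|x|^2)^{1/2}$; $A\lesssim B$ means $A\le cB$ for a constant $c>0$; $A\asymp B$ means $A\lesssim B$ and $B\lesssim A$; $\widehat f(\xi)=(2\pi)^{-d/2}\int f(x)e^{-i\langle x,\xi\rangle}dx$. $\mathrm{SG}^{m,\mu}_{r,\rho}(\mathbf R^{2d})$ is the set of $a\in C^\infty(\mathbf R^{2d})$ with $|\partial_x^\alpha \partial_\xi^\beta a(x,\xi)|\lesssim\langle x\rangle^{m-r|\alpha|}\langle\xi\rangle^{\mu-\rho|\beta|}$ for all multi-indices $\alpha,\beta$. $\mathfrak F^r$ (regular phase functions) is the set of real-valued $\varphi\in \mathrm{SG}^{1,1}_{1,1}(\mathbf R^{2d})$ such that $\langle\varphi'_\xi(x,\xi)\rangle\asymp\langle x\rangle$ and $\langle\varphi'_x(x,\xi)\rangle\asymp\langle\xi\rangle$ uniformly on $\mathbf R^{2d}$, and $|\det\varphi''_{x\xi}(x,\xi)|\ge c$ for some $c>0$ and all $x,\xi\in\mathbf R^d$. For $f\in\mathscr S(\mathbf R^d)$, $\operatorname{Op}_\varphi(a)f(x)=(2\pi)^{-d/2}\int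 e^{i\varphi(x,\xi)}a(x,\xi)\widehat f(\xi)\,d\xi$. *)

(* Defs.v *)
From HB Require Import structures.
From mathcomp Require Import all_boot all_order all_algebra.
From mathcomp Require Import all_classical all_reals all_analysis.
From mathcomp Require Export complex.

Set Implicit Arguments.
Unset Strict Implicit.
Unset Printing Implicit Defensive.

Import Order.TTheory GRing.Theory Num.Theory.
Import numFieldNormedType.Exports.

Local Open Scope classical_set_scope.
Local Open Scope ring_scope.
Local Open Scope complex_scope.

(* R^n is ['rV[R]_n] (whose library norm is the sup norm, so Euclidean norms are
   written out below); R^(2d) is ['rV[R]_(d + d)], with points [row_mx x xi]. *)

Section measurable_rV.
Context {d : measure_display} {T : sigmaRingType d} (n : nat).

Let coor (i : 'I_n) (v : 'rV[T]_n) : T := v ord0 i.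

Let rV_set0 : g_sigma_preimage coor set0.
Proof. exact: sigma_algebra0. Qed.

Let rV_setC A : g_sigma_preimage coor A -> g_sigma_preimage coor (~` A).
Proof. exact: sigma_algebraC. Qed.

Let rV_bigcup (F : (set _)^nat) : (forall i, g_sigma_preimage coor (F i)) ->
  g_sigma_preimage coor (\bigcup_i (F i)).
Proof. exact: sigma_algebra_bigcup. Qed.

(* The sigma-algebra generated by the coordinates, as the library has it on
   [n.-tuple T]; for [T] the real line it is the Borel sigma-algebra. *)
HB.instance Definition _ := @isMeasurable.Build (measure_tuple_display d)
  'rV[T]_n (g_sigma_preimage coor) rV_set0 rV_setC rV_bigcup.

End measurable_rV.

Lemma measurable_coor_rV (d : measure_display) (T : sigmaRingType d) (n : nat)
    (i : 'I_n) :
  measurable_fun [set: 'rV[T]_n] (fun v : 'rV[T]_n => v ord0 i).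
Proof.
move=> _ Y mY; rewrite setTI; apply: sub_sigma_algebra => /=.
rewrite -bigcup_seq/=; exists i => /=; first by rewrite mem_index_enum.
by exists Y => //; rewrite setTI.
Qed.

Lemma measurable_fun_rV (d1 d2 : measure_display) (T1 : measurableType d1)
    (T2 : measurableType d2) (n : nat) (f : T1 -> 'rV[T2]_n) :
  (forall i, measurable_fun [set: T1] (fun t => f t ord0 i)) ->
  measurable_fun [set: T1] f.
Proof.
move=> mf.
suff : g_sigma_preimage (fun i => (fun v : 'rV[T2]_n => v ord0 i) \o f)
    `<=` measurable.
  rewrite g_sigma_preimage_comp => prefS _ A mA.
  by apply: prefS; exists A.
apply: smallest_sub; first exact: sigma_algebra_measurable.
case: n => [|n] in f mf *; first by rewrite big_ord0.
rewrite -bigcup_mkord_ord; apply: bigcup_sub => i Ii.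
by move=> A [B mB <-]; exact: mf.
Qed.

Definition cons_rV (R : realType) (n : nat) (p : 'rV[R]_n * R) : 'rV[R]_n.+1 :=
  row_mx (const_mx p.2 : 'rV[R]_1) p.1.

Lemma measurable_cons_rV (R : realType) (n : nat) :
  measurable_fun [set: 'rV[R]_n * R] (@cons_rV R n).
Proof.
apply: measurable_fun_rV => i.
case: (@split_ordP 1 n i) => j ->.
  apply: (eq_measurable_fun (@snd 'rV[R]_n R)); last exact: measurable_snd.
  by move=> t _; rewrite (@row_mxEl _ 1 1 n) mxE.
apply: (eq_measurable_fun ((fun v : 'rV[R]_n => v ord0 j) \o @fst 'rV[R]_n R)).
  by move=> t _; rewrite (@row_mxEr _ 1 1 n).
exact: measurableT_comp (measurable_coor_rV j) measurable_fst.
Qed.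

Section lebesgue_cons.
Context {R : realType} (n : nat) (mu : {measure set 'rV[R]_n -> \bar R}).

Definition lebesgue_cons : set 'rV[R]_n.+1 -> \bar R :=
  pushforward (mu \x (@lebesgue_measure R))%E (@cons_rV R n).

Let mcons := @measurable_cons_rV R n.

Let lebesgue_cons0 : lebesgue_cons set0 = 0%E.
Proof. by rewrite /lebesgue_cons /pushforward preimage_set0 measure0. Qed.

Let lebesgue_cons_ge0 A : (0 <= lebesgue_cons A)%E.
Proof. exact: measure_ge0. Qed.

Let lebesgue_cons_sigma_additive : semi_sigma_additive lebesgue_cons.
Proof.
by rewrite /lebesgue_cons; apply: measure_semi_sigma_additive; exact: mcons.
Qed.

HB.instance Definition _ := isMeasure.Build _ _ _ lebesgue_cons
  lebesgue_cons0 lebesgue_cons_ge0 lebesgue_cons_sigma_additive.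

End lebesgue_cons.

Fixpoint lebesgue_rV (R : realType) (n : nat) :
    {measure set 'rV[R]_n -> \bar R} :=
  match n with
  | 0 => dirac (0 : 'rV[R]_0)
  | m.+1 => lebesgue_cons (lebesgue_rV R m)
  end.

Lemma measurable_box_rV (R : realType) (n : nat) (a b : 'rV[R]_n) :
  measurable [set v : 'rV[R]_n | forall i, v ord0 i \in `[a ord0 i, b ord0 i]].
Proof.
rewrite (_ : mkset _ = \bigcap_(i in [set: 'I_n])
    ((fun v : 'rV[R]_n => v ord0 i) @^-1` [set` `[a ord0 i, b ord0 i]])).
  apply: fin_bigcap_measurable => // i _; rewrite -[X in measurable X]setTI.
  by apply: measurable_coor_rV => //; exact: measurable_itv.
by apply/seteqP; split => v /= h i; [move=> _; exact: h | exact: (h i I)].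
Qed.

Lemma lebesgue_rV_box (R : realType) (n : nat) (a b : 'rV[R]_n) :
  (forall i, a ord0 i <= b ord0 i) ->
  lebesgue_rV R n [set v | forall i, v ord0 i \in `[a ord0 i, b ord0 i]] =
  (\prod_(i < n) (b ord0 i - a ord0 i))%:E.
Proof.
elim: n => [|n IHn] in a b *.
  by move=> _; rewrite big_ord0 /= diracE mem_set// => -[].
move=> ab; pose tl (v : 'rV[R]_n.+1) : 'rV[R]_n := \row_i v ord0 (lift ord0 i).
have tlE v i : tl v ord0 i = v ord0 (lift ord0 i) by rewrite mxE.
have cons0 (p : 'rV[R]_n * R) : cons_rV p ord0 ord0 = p.2 :> R.
  transitivity ((const_mx p.2 : 'rV[R]_1) ord0 ord0); last by rewrite mxE.
  have <- := @row_mxEl R 1 1 n (const_mx p.2) p.1 ord0 ord0.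
  by congr (cons_rV p _ _); exact/val_inj.
have consS (p : 'rV[R]_n * R) i : cons_rV p ord0 (lift ord0 i) = p.1 ord0 i :> R.
  have <- := @row_mxEr R 1 1 n (const_mx p.2) p.1 ord0 i.
  by congr (cons_rV p _ _); exact/val_inj.
rewrite /= /lebesgue_cons /pushforward.
rewrite (_ : _ @^-1` _ =
    [set v : 'rV[R]_n | forall i, v ord0 i \in `[tl a ord0 i, tl b ord0 i]]
    `*` `[a ord0 ord0, b ord0 ord0]%classic); last first.
  apply/seteqP; split => p /=.
  - move=> h; split => [i|]; first by rewrite !tlE -consS; exact: h.
    by have := h ord0; rewrite cons0.
  - move=> [h1 h2] i; case: (unliftP ord0 i) => [j ->|->].
      by rewrite consS; have := h1 j; rewrite !tlE.
    by rewrite cons0.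
rewrite product_measure1E//; last exact: measurable_box_rV.
rewrite IHn => [|i]; last by rewrite !tlE.
have := lebesgue_measure_itv `[a ord0 ord0, b ord0 ord0].
rewrite /= lte_fin => ->.
rewrite big_ord_recl/= mulrC; under eq_bigr do rewrite !tlE.
have := ab ord0; rewrite le_eqVlt => /predU1P[->|h]; last by rewrite h EFinM.
by rewrite ltxx subrr mulr0 mule0.
Qed.

Section multi_index_calculus.
Context {R : realType}.
Implicit Types n : nat.

Definition multi_index n := 'I_n -> nat.

Definition order_mi n (alpha : multi_index n) : nat :=
  (\sum_(i < n) alpha i)%N.

Definition monomial n (alpha : multi_index n) (x : 'rV[R]_n) : R :=
  \prod_(i < n) x ord0 i ^+ alpha i.

Definition partial n (i : 'I_n) (f : 'rV[R]_n -> R) : 'rV[R]_n -> R :=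
  fun x => 'D_(delta_mx ord0 i) f x.

Definition partials n (alpha : multi_index n) (f : 'rV[R]_n -> R) :
    'rV[R]_n -> R :=
  foldr (fun i g => iter (alpha i) (partial i) g) f (enum 'I_n).

Fixpoint C_k n (k : nat) (f : 'rV[R]_n -> R) : Prop :=
  match k with
  | 0 => continuous f
  | k'.+1 => continuous f /\
      forall i : 'I_n, (forall x, derivable f x (delta_mx ord0 i)) /\
                       C_k k' (partial i f)
  end.

Definition C_infty n (f : 'rV[R]_n -> R) : Prop := forall k, C_k k f.

End multi_index_calculus.

(* [R[i]] carries no normed-module structure over [R], so complex-valued
   functions of a real variable are differentiated and integrated through their
   real and imaginary parts. *)
Section complex_valued.
Context {R : realType}.
Implicit Types n : nat.

Definition Cmod (z : R[i]) : R := Normc.normc z.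

Definition expi (t : R) : R[i] := cos t +i* sin t.

Definition partialsC n (alpha : multi_index n) (f : 'rV[R]_n -> R[i]) :
    'rV[R]_n -> R[i] :=
  fun x => partials alpha (fun y => complex.Re (f y)) x
        +i* partials alpha (fun y => complex.Im (f y)) x.

Definition C_inftyC n (f : 'rV[R]_n -> R[i]) : Prop :=
  C_infty (fun x => complex.Re (f x)) /\ C_infty (fun x => complex.Im (f x)).

Definition integralC n (f : 'rV[R]_n -> R[i]) : R[i] :=
  (\int[lebesgue_rV R n]_x complex.Re (f x))
  +i* (\int[lebesgue_rV R n]_x complex.Im (f x)).

Definition schwartz n (f : 'rV[R]_n -> R[i]) : Prop :=
  C_inftyC f /\
  forall alpha beta : multi_index n,
    exists c : R, forall x, Cmod ((monomial alpha x)%:C * partialsC beta f x) <= c.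

Definition dot n (x y : 'rV[R]_n) : R := \sum_(i < n) x ord0 i * y ord0 i.

Definition bracket n (x : 'rV[R]_n) : R := Num.sqrt (1 + dot x x).

Definition fourier n (f : 'rV[R]_n -> R[i]) : 'rV[R]_n -> R[i] :=
  fun xi => ((2 * pi) `^ (- (n%:R / 2)))%:C *
            integralC (fun x => f x * expi (- dot x xi)).

End complex_valued.

Section lesssim.
Context {T : Type} {R : realType}.

Definition lesssim (A B : T -> R) : Prop :=
  exists2 c : R, 0 < c & forall t, A t <= c * B t.

Definition asymp (A B : T -> R) : Prop := lesssim A B /\ lesssim B A.

End lesssim.

Section fourier_integral_operators.
Context {R : realType} {d : nat}.

Definition join_mi (alpha beta : multi_index d) : multi_index (d + d) :=
  fun k => match fintype.split k with inl i => alpha i | inr j => beta j end.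

Definition SG (m mu r rho : R) (a : 'rV[R]_(d + d) -> R[i]) : Prop :=
  C_inftyC a /\
  forall alpha beta : multi_index d,
    lesssim
      (fun p : 'rV[R]_d * 'rV[R]_d =>
         Cmod (partialsC (join_mi alpha beta) a (row_mx p.1 p.2)))
      (fun p => bracket p.1 `^ (m - r * (order_mi alpha)%:R)
              * bracket p.2 `^ (mu - rho * (order_mi beta)%:R)).

Definition grad_x (phi : 'rV[R]_(d + d) -> R) (x xi : 'rV[R]_d) : 'rV[R]_d :=
  \row_i partial (lshift d i) phi (row_mx x xi).

Definition grad_xi (phi : 'rV[R]_(d + d) -> R) (x xi : 'rV[R]_d) : 'rV[R]_d :=
  \row_i partial (rshift d i) phi (row_mx x xi).

Definition hess_x_xi (phi : 'rV[R]_(d + d) -> R) (x xi : 'rV[R]_d) : 'M[R]_d :=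
  \matrix_(i, j)
    partial (lshift d i) (partial (rshift d j) phi) (row_mx x xi).

Definition regular_phase (phi : 'rV[R]_(d + d) -> R) : Prop :=
  [/\ SG 1 1 1 1 (fun z => (phi z)%:C),
      asymp (fun p => bracket (grad_xi phi p.1 p.2)) (fun p => bracket p.1),
      asymp (fun p => bracket (grad_x phi p.1 p.2)) (fun p => bracket p.2) &
      exists2 c : R, 0 < c & forall x xi, c <= `|\det (hess_x_xi phi x xi)|].

Definition Op (phi : 'rV[R]_(d + d) -> R) (a : 'rV[R]_(d + d) -> R[i])
    (f : 'rV[R]_d -> R[i]) : 'rV[R]_d -> R[i] :=
  fun x => ((2 * pi) `^ (- (d%:R / 2)))%:C *
    integralC (fun xi =>
      expi (phi (row_mx x xi)) * a (row_mx x xi) * fourier f xi).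

End fourier_integral_operators.

Section L2.
Context {R : realType} {d : nat}.
Local Notation mu := (lebesgue_rV R d).

Definition L2norm (f : 'rV[R]_d -> R[i]) : \bar R :=
  'N[mu]_2%:E[(fun x => (Cmod (f x))%:E)]%E.

Definition inL2 (f : 'rV[R]_d -> R[i]) : Prop :=
  [/\ measurable_fun [set: 'rV[R]_d] (fun x => complex.Re (f x)),
      measurable_fun [set: 'rV[R]_d] (fun x => complex.Im (f x)) &
      (L2norm f < +oo)%E].

(* The elements of L^2 are the classes modulo almost everywhere equality of the
   functions in [inL2]; an operator on L^2 is given by its action on
   representatives. *)
Definition bounded_linear_L2 (T : ('rV[R]_d -> R[i]) -> 'rV[R]_d -> R[i]) :
    Prop :=
  [/\ forall f, inL2 f -> inL2 (T f),
      forall f g, inL2 f -> inL2 g -> f = g %[ae mu] -> T f = T g %[ae mu],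
      forall (c : R[i]) f g, inL2 f -> inL2 g ->
        T (fun x => c * f x + g x) = (fun x => c * T f x + T g x) %[ae mu] &
      exists2 C : R, 0 <= C &
        forall f, inL2 f -> (L2norm (T f) <= C%:E * L2norm f)%E].

Definition extends_to_bounded_L2 (A : ('rV[R]_d -> R[i]) -> 'rV[R]_d -> R[i]) :
    Prop :=
  exists2 T, bounded_linear_L2 T &
    forall f, schwartz f -> T f = A f %[ae mu].

End L2.

(* Main.v *)
From HB Require Import structures.
Require Import Defs.
From mathcomp Require Import all_boot all_order all_algebra.
From mathcomp Require Import all_classical all_reals all_analysis complex.
From mathcomp Require Import measurable_realfun perm ring lra.

(* Only real operators [T g x = \int cos (phi x z + tau) a x z g z dz] are
   estimated; the Fourier transform is itself of this kind, with phase [- x . z]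
   and amplitude 1, so that the theorem follows by composing two of them.
   Neither Plancherel's theorem nor the density of Schwartz functions is needed.

   The bounds on the mixed derivatives of phi and the lower bound on its mixed
   Hessian make [x |-> grad_xi phi x z] globally expanding (Hadamard), so that on
   a small cube the functions [cos (phi x_l z + tau_l)], for x_l in a lattice, are
   almost orthogonal by nonstationary phase; Schur's test turns this into a
   sampling inequality. On a product of cells the kernel is a product of a
   function of x, a function of z and a remainder with bounded derivatives; the
   remainder is evaluated on a fine grid and summed by parts (as in the
   Hardy-Krause inequality), which reduces the bilinear form to the sampling
   inequality in x and in z, uniformly in the mesh. Letting the mesh tend to 0
   gives [\int (T g)^2 <= C \int g^2] for g integrable and square integrable.

   The extension to L^2 is the limit of T along truncations to growing cubes. It
   agrees with T on Fourier transforms of Schwartz functions, because these decay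
   rapidly by integration by parts. *)

Set Implicit Arguments.
Unset Strict Implicit.
Unset Printing Implicit Defensive.

Import Order.TTheory GRing.Theory Num.Theory.
Import numFieldNormedType.Exports.

Local Open Scope classical_set_scope.
Local Open Scope ring_scope.

(** Only the mixed derivatives of the phase are under control, so phi itself may never be
    discretized. For coarse cubes with corners x_l and z_k the split is phi(x, z) = phi(x, z_k) +
    phi(x_l, z) + remainder, and only the remainder is replaced by grid values. Integrated against a
    function of x, the first term gives, for each l, samples at the points z_k; integrated against a
    function of z, the second gives, for each k, samples at the points x_l. Both families are
    therefore square summable over all pairs (l, k), and 2|st| <= s^2 + t^2 sums their products,
    distant cubes included.

    The side h of the coarse cubes stays fixed: it must be small for a lower bound on the phase
    gradient to persist on a cube, and the constants depend on it. Only the number of cells grows.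
    Summation by parts takes at most one derivative per coordinate, whatever the mesh, so its
    constant does not see the mesh.

    Every kernel is a cosine with a free shift tau because sines and derivatives are shifts by pi /
    2: each induction stays within one family, and complex operators are assembled from real ones at
    the end. *)

(** * Partial derivatives as derivatives along slices *)

Section coordinate_slices.
Context {R : realType} {n : nat}.
Implicit Types (z w : 'rV[R]_n) (f g : 'rV[R]_n -> R) (i j : 'I_n) (t : R).

(** Freezing all coordinates but one reduces partial derivatives to real functions of one variable,
    where the mean value theorem and the chain rule are available. *)
Definition upd z i t : 'rV[R]_n := \row_j (if j == i then t else z ord0 j).

Lemma updE z i t j : upd z i t ord0 j = if j == i then t else z ord0 j.
Proof. by rewrite mxE. Qed.

Lemma upd_id z i : upd z i (z ord0 i) = z.
Proof. by apply/rowP => j; rewrite mxE; case: eqP => // ->. Qed.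

Lemma upd_shift z i t h :
  upd z i (h + t) = h *: delta_mx ord0 i + upd z i t.
Proof.
by apply/rowP => j; rewrite !mxE eqxx /=; case: eqP => _;
  rewrite ?mulr1 ?mulr0 ?add0r.
Qed.

(** The two difference quotients are the same function of [h], so derivability and value transfer
    together. *)
Let slice_quotient f z i t :
  (fun h : R => h^-1 *: (((fun s => f (upd z i s)) \o shift t) (h *: (1 : R))
      - f (upd z i t))) =
  (fun h => h^-1 *: ((f \o shift (upd z i t)) (h *: delta_mx ord0 i)
      - f (upd z i t))).
Proof. by apply/funext => h /=; rewrite -upd_shift (_ : h *: 1 = h) //; exact: mulr1. Qed.

Lemma is_derive_slice f z i t :
  derivable f (upd z i t) (delta_mx ord0 i) ->
  is_derive t (1 : R) (fun s => f (upd z i s)) (partial i f (upd z i t)).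
Proof.
move=> df; apply: DeriveDef; first by rewrite /derivable slice_quotient.
by rewrite /partial /derive slice_quotient.
Qed.

Lemma slice_is_derive f z i (df : R) :
  is_derive (z ord0 i) (1 : R) (fun s => f (upd z i s)) df ->
  derivable f z (delta_mx ord0 i) /\ partial i f z = df.
Proof.
case=> dd dv; have := slice_quotient f z i (z ord0 i).
rewrite upd_id => e; split; first by rewrite /derivable -e -[X in f X](upd_id z i).
by rewrite /partial /derive -e -{}dv /derive upd_id.
Qed.

Lemma slice_MVT f z i s t :
  (forall w, derivable f w (delta_mx ord0 i)) ->
  exists2 c, Num.min s t <= c <= Num.max s t &
    f (upd z i t) - f (upd z i s) = partial i f (upd z i c) * (t - s).
Proof.
move=> df.
have drv x : is_derive x (1 : R) (fun s => f (upd z i s)) (partial i f (upd z i x)).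
  exact: is_derive_slice.
have cont (A : set R) : {within A, continuous (fun s => f (upd z i s))}.
  apply: continuous_subspaceT => x; apply: differentiable_continuous.
  exact/derivable1_diffP/(@ex_derive _ _ _ _ _ _ _ (drv x)).
have [st|ts] := leP s t.
  have [c /[!in_itv]/= cst e] := MVT_segment st (fun x _ => drv x) (cont _).
  by exists c.
have [c /[!in_itv]/= cst e] := MVT_segment (ltW ts) (fun x _ => drv x) (cont _).
exists c => //; apply: oppr_inj; rewrite opprB e.
by rewrite -mulrN opprB.
Qed.

(** The mask freezes a single coordinate in [upd_frz], and all of x or all of xi in [twist]. *)
Definition frz (m : pred 'I_n) (c z : 'rV[R]_n) : 'rV[R]_n :=
  \row_j (if m j then c ord0 j else z ord0 j).

Lemma frzE m c z j : frz m c z ord0 j = if m j then c ord0 j else z ord0 j.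
Proof. by rewrite mxE. Qed.

Lemma upd_frz z i t : upd z i t = frz (pred1 i) (const_mx t) z.
Proof. by apply/rowP => j; rewrite !mxE. Qed.

Lemma partial_frz f m c i z : ~~ m i ->
  derivable f (frz m c z) (delta_mx ord0 i) ->
  derivable (fun w => f (frz m c w)) z (delta_mx ord0 i) /\
  partial i (fun w => f (frz m c w)) z = partial i f (frz m c z).
Proof.
move=> mi df; apply: slice_is_derive.
have e s : frz m c (upd z i s) = upd (frz m c z) i s.
  apply/rowP => j; rewrite !mxE; case: (eqVneq j i) => [->|//].
  by rewrite (negbTE mi).
have -> : (fun s => f (frz m c (upd z i s))) = (fun s => f (upd (frz m c z) i s)).
  by apply/funext => s; rewrite e.
have e0 : upd (frz m c z) i (z ord0 i) = frz m c z by rewrite -e upd_id.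
by rewrite -{2}e0; apply: is_derive_slice; rewrite e0.
Qed.

Lemma partial_frz0 f (m : pred 'I_n) c i z : m i ->
  derivable (fun w => f (frz m c w)) z (delta_mx ord0 i) /\
  partial i (fun w => f (frz m c w)) z = 0.
Proof.
move=> mi; apply: slice_is_derive.
have -> : (fun s => f (frz m c (upd z i s))) = (fun=> f (frz m c z)).
  apply/funext => s; congr f; apply/rowP => j; rewrite !mxE.
  by case: ifPn => // mj; case: eqVneq => // ji; rewrite ji mi in mj.
exact: is_derive_cst.
Qed.

End coordinate_slices.

(** * Calculus of smooth functions *)

Section C_infty_calculus.
Context {R : realType} {n : nat}.
Implicit Types (f g : 'rV[R]_n -> R) (i j : 'I_n) (k : nat) (z : 'rV[R]_n).

Lemma C_kW k f : C_k k.+1 f -> C_k k f.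
Proof.
elim: k f => [|k IH] f /=; first by case.
by move=> [cf Cf]; split => // i; have [df Ck] := Cf i; split => //; exact: IH.
Qed.

Lemma C_inftyP f : C_infty f <-> continuous f /\
  forall i, (forall x, derivable f x (delta_mx ord0 i)) /\ C_infty (partial i f).
Proof.
split=> [Cf|[cf Cf] [|k]] //=.
  split; first exact: (Cf 0%N).
  by move=> i; split=> [|k]; have [_ /(_ i)[]] := Cf 1%N => //; have [_ /(_ i)[]] := Cf k.+1.
by split => // i; have [df Ci] := Cf i; split.
Qed.

Lemma C_infty_cont f : C_infty f -> continuous f.
Proof. by case/C_inftyP. Qed.

Lemma C_infty_derivable f i z : C_infty f -> derivable f z (delta_mx ord0 i).
Proof. by case/C_inftyP => _ /(_ i)[]. Qed.

Arguments C_infty_derivable {f} i z _.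

Lemma C_infty_partial f i : C_infty f -> C_infty (partial i f).
Proof. by case/C_inftyP => _ /(_ i)[]. Qed.

Lemma partial_cst i (c : R) : partial i (fun _ : 'rV[R]_n => c) = (fun=> 0).
Proof. by apply/funext => z; rewrite /partial derive_cst. Qed.

Lemma C_infty_cst (c : R) : C_infty (fun _ : 'rV[R]_n => c).
Proof.
move=> k; elim: k c => [|k IH] c /=; first by move=> x; apply: cst_continuous.
split; first by move=> x; apply: cst_continuous.
by move=> i; rewrite partial_cst; split.
Qed.

Lemma partialD i f g : (forall z, derivable f z (delta_mx ord0 i)) ->
  (forall z, derivable g z (delta_mx ord0 i)) ->
  partial i (fun z => f z + g z) = (fun z => partial i f z + partial i g z).
Proof. by move=> df dg; apply/funext => z; rewrite /partial -deriveD. Qed.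

Lemma partialM i f g : (forall z, derivable f z (delta_mx ord0 i)) ->
  (forall z, derivable g z (delta_mx ord0 i)) ->
  partial i (fun z => f z * g z) =
  (fun z => partial i f z * g z + f z * partial i g z).
Proof.
move=> df dg; apply/funext => z; rewrite /partial.
have -> : (fun z => f z * g z) = f * g by [].
by rewrite (deriveM (df z) (dg z)) addrC /GRing.scale /= [g z * _]mulrC.
Qed.

Lemma C_kD k f g : C_k k f -> C_k k g -> C_k k (fun z => f z + g z).
Proof.
elim: k f g => [|k IH] f g /=; first by move=> cf cg x; exact: cvgD (cf x) (cg x).
move=> [cf Cf] [cg Cg]; split; first by move=> x; exact: cvgD (cf x) (cg x).
move=> i; have [df Ci] := Cf i; have [dg Di] := Cg i.
split; first by move=> x; exact: derivableD.
by rewrite (partialD df dg); exact: IH.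
Qed.

Lemma C_kM k f g : C_k k f -> C_k k g -> C_k k (fun z => f z * g z).
Proof.
elim: k f g => [|k IH] f g; first by move=> cf cg x; exact: cvgM (cf x) (cg x).
move=> Cf0 Cg0; have [cf Cf] := Cf0; have [cg Cg] := Cg0; split.
  by move=> x; exact: cvgM (cf x) (cg x).
move=> i; have [df Ci] := Cf i; have [dg Di] := Cg i.
split; first by move=> x; exact: derivableM.
by rewrite (partialM df dg); apply: C_kD; apply: IH => //; exact: C_kW.
Qed.

Lemma C_inftyD f g : C_infty f -> C_infty g -> C_infty (fun z => f z + g z).
Proof. by move=> Cf Cg k; exact: C_kD. Qed.

Lemma C_inftyM f g : C_infty f -> C_infty g -> C_infty (fun z => f z * g z).
Proof. by move=> Cf Cg k; exact: C_kM. Qed.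

Lemma C_inftyZ (c : R) f : C_infty f -> C_infty (fun z => c * f z).
Proof. by move=> Cf; apply: C_inftyM => //; exact: C_infty_cst. Qed.

Lemma partialZ i (c : R) f : (forall z, derivable f z (delta_mx ord0 i)) ->
  partial i (fun z => c * f z) = (fun z => c * partial i f z).
Proof.
move=> df; have dc z := derivable_cst c (delta_mx ord0 i) z.
rewrite (partialM dc df).
by rewrite partial_cst; apply/funext => z; rewrite mul0r add0r.
Qed.

Let cos_slice f i (th : R) : (forall z, derivable f z (delta_mx ord0 i)) ->
  forall z, derivable (fun z => cos (f z + th)) z (delta_mx ord0 i) /\
   partial i (fun z => cos (f z + th)) z = cos (f z + (th + pi / 2)) * partial i f z.
Proof.
move=> df z.
have := @is_derive_slice _ _ f z i (z ord0 i) (df _) => h.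
apply: (@slice_is_derive R n (fun z => cos (f z + th))) => /=.
have -> : cos (f z + (th + pi / 2)) * partial i f z =
  (- sin (f (upd z i (z ord0 i)) + th)) * (partial i f (upd z i (z ord0 i)) + 0).
  by rewrite addr0 upd_id addrA cosDpihalf.
have h2 := is_deriveD h (is_derive_cst th (z ord0 i) (1 : R)).
exact: (@is_derive1_comp _ cos (fun s => f (upd z i s) + th)).
Qed.

(** A shifted cosine in place of a sine keeps the family closed under differentiation; inductions on
    the order must then leave [th] free. *)
Lemma partial_cos f i (th : R) : (forall z, derivable f z (delta_mx ord0 i)) ->
  partial i (fun z => cos (f z + th)) =
  (fun z => cos (f z + (th + pi / 2)) * partial i f z).
Proof. by move=> df; apply/funext => z; have [] := cos_slice th df z. Qed.

Lemma C_infty_cos f (th : R) : C_infty f -> C_infty (fun z => cos (f z + th)).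
Proof.
move=> Cf k; have cf := C_infty_cont Cf; elim: k th => [|k IH] th.
  move=> x; apply: (@continuous_comp _ _ _ (fun z => f z + th)).
    by apply: continuousD; [apply: cf|apply: cst_continuous].
  exact: continuous_cos.
have df i z : derivable f z (delta_mx ord0 i) by exact: C_infty_derivable.
split.
  move=> x; apply: (@continuous_comp _ _ _ (fun z => f z + th)).
    by apply: continuousD; [apply: cf|apply: cst_continuous].
  exact: continuous_cos.
move=> i; split; first by move=> z; have [] := cos_slice th (df i) z.
by rewrite (partial_cos th (df i)); apply: C_kM; [exact: IH|exact: C_infty_partial].
Qed.

Lemma C_infty_sum (I : Type) (r : seq I) (F : I -> 'rV[R]_n -> R) :
  (forall a, C_infty (F a)) -> C_infty (fun z => \sum_(a <- r) F a z).
Proof.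
move=> CF; elim: r => [|i r IH].
  have -> : (fun z => \sum_(a <- [::]) F a z) = (fun=> 0).
    by apply/funext => z; rewrite big_nil.
  exact: C_infty_cst.
have -> : (fun z => \sum_(a <- i :: r) F a z) = (fun z => F i z + \sum_(a <- r) F a z).
  by apply/funext => z; rewrite big_cons.
exact: C_inftyD.
Qed.

(* Both second-order difference quotients tend to the mixed partial derivatives
   and they are the same quotient. *)
Lemma partialC i j f : C_infty f ->
  partial i (partial j f) = partial j (partial i f).
Proof.
have fin (p q r s : R) : p - q - (r - s) = p - r - (q - s) by ring.
have [->//|nij] := eqVneq i j.
have fin2 (p q h : R) : 0 < h -> p * h * h = q * h * h -> p = q.
  move=> h0; rewrite -2!mulrA; apply: mulIf; rewrite mulf_neq0 // gt_eqF //.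
move=> Cf; apply/funext => z.
have Ci := C_infty_partial i Cf; have Cj := C_infty_partial j Cf.
have dd g (k : 'I_n) : C_infty g -> forall w, derivable g w (delta_mx ord0 k).
  by move=> Cg w; exact: C_infty_derivable.
have updC w s t : upd (upd w i s) j t = upd (upd w j t) i s.
  apply/rowP => k; rewrite !mxE; case: (eqVneq k j) => // ->.
  by rewrite eq_sym (negbTE nij).
pose corner h := f (upd (upd z i (z ord0 i + h)) j (z ord0 j + h))
   - f (upd (upd z i (z ord0 i + h)) j (z ord0 j))
   - (f (upd (upd z i (z ord0 i)) j (z ord0 j + h))
   - f (upd (upd z i (z ord0 i)) j (z ord0 j))).
have near_ball g (e : R) : C_infty g -> 0 < e -> exists2 r, 0 < r &
    forall s t, `|s - z ord0 i| < r -> `|t - z ord0 j| < r ->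
      `|g z - g (upd (upd z i s) j t)| < e.
  move=> /C_infty_cont cg e0; have /cvgrPdist_lt/(_ _ e0) := cg z.
  move=> /nbhs_ballP[r /= r0 hr]; exists r => // s t hs ht; apply: hr => /=.
  split=> // a b; rewrite ord1 !mxE /ball /=; case: eqP => [->|_].
    by rewrite distrC.
  by case: eqP => [->|_]; rewrite ?subrr ?normr0 // distrC.
(* The mean value theorem twice: along [a] for the difference [F] of two slices, then along [b] for
   [partial a g]. *)
have step g (a b : 'I_n) (w : 'rV[R]_n) (h : R) : a != b -> C_infty g -> 0 < h ->
    exists c d, [/\ `|c - w ord0 a| <= h, `|d - w ord0 b| <= h &
    g (upd (upd w a (w ord0 a + h)) b (w ord0 b + h))
   - g (upd (upd w a (w ord0 a + h)) b (w ord0 b))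
   - (g (upd (upd w a (w ord0 a)) b (w ord0 b + h))
   - g (upd (upd w a (w ord0 a)) b (w ord0 b))) =
   partial b (partial a g) (upd (upd w a c) b d) * h * h].
  move=> ab Cg h0.
  have dF t v : derivable (fun v => g (upd v b t)) v (delta_mx ord0 a) /\
      partial a (fun v => g (upd v b t)) v = partial a g (upd v b t).
    have -> : (fun v => g (upd v b t)) = (fun v => g (frz (pred1 b) (const_mx t) v)).
      by apply/funext => v'; rewrite upd_frz.
    by rewrite upd_frz; apply: partial_frz; [exact: ab|exact: dd].
  pose F v := g (upd v b (w ord0 b + h)) - g (upd v b (w ord0 b)).
  have dFF v : derivable F v (delta_mx ord0 a).
    by apply: derivableB; [exact: (dF _ _).1|exact: (dF _ _).1].
  have min_max (p : R) : Num.min p (p + h) = p /\ Num.max p (p + h) = p + h.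
    by split; [apply/min_idPl|apply/max_idPr]; rewrite lerDl ltW.
  have dist_le (p q : R) : p <= q <= p + h -> `|q - p| <= h.
    by move=> /andP[pq qp]; rewrite ger0_norm ?subr_ge0 // lerBlDl.
  have [c cs e] := slice_MVT w (w ord0 a) (w ord0 a + h) dFF.
  have [d ds e2] := slice_MVT (upd w a c) (w ord0 b) (w ord0 b + h)
    (dd _ b (C_infty_partial a Cg)).
  move: cs ds; have [-> ->] := min_max (w ord0 a); have [-> ->] := min_max (w ord0 b).
  move=> cs ds; exists c, d; split; [exact: dist_le|exact: dist_le|].
  have pF : partial a F (upd w a c) = partial a g (upd (upd w a c) b (w ord0 b + h))
      - partial a g (upd (upd w a c) b (w ord0 b)).
    rewrite -(dF _ _).2 -(dF (w ord0 b) _).2 /partial -deriveB //; exact: (dF _ _).1.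
  have hh (p : R) : p + h - p = h by rewrite addrC addKr.
  by move: e; rewrite pF e2 /F !hh.
apply/eqP; rewrite -subr_eq0; apply/negPn/negP => nz.
(* The mixed derivatives agree at the two mean value points of one second difference, so they cannot
   both be closer than half the gap to their values at [z]. *)
set D := _ - _ in nz; have e0 : 0 < `|D| / 2 by rewrite divr_gt0 // normr_gt0.
have [r1 r10 h1] := near_ball _ _ (C_infty_partial i Cj) e0.
have [r2 r20 h2] := near_ball _ _ (C_infty_partial j Ci) e0.
have [h [h0 hr1 hr2]] : exists h, [/\ 0 < h, h < r1 & h < r2].
  exists (Num.min r1 r2 / 2).
  have m0 : 0 < Num.min r1 r2 by rewrite lt_min r10.
  have hm : Num.min r1 r2 / 2 < Num.min r1 r2.
    by rewrite ltr_pdivrMr // ltr_pMr // ltr1n.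
  split; first by rewrite divr_gt0.
    by apply: lt_le_trans hm _; rewrite ge_min lexx.
  by apply: lt_le_trans hm _; rewrite ge_min lexx orbT.
have [c [d [hc hd e]]] := step f i j z h nij Cf h0.
have [|d' [c' [hd' hc' e']]] := step f j i z h _ Cf h0; first by rewrite eq_sym.
have E : partial j (partial i f) (upd (upd z i c) j d)
       = partial i (partial j f) (upd (upd z i c') j d').
  rewrite -!updC in e'.
  have e3 := etrans (esym e) (etrans (fin _ _ _ _) e').
  exact: fin2 h0 e3.
have := h1 _ _ (le_lt_trans hc' hr1) (le_lt_trans hd' hr1).
have := h2 _ _ (le_lt_trans hc hr2) (le_lt_trans hd hr2).
rewrite -E => A B; have : `|D| < `|D|; last by rewrite ltxx.
rewrite [X in _ < X](splitr `|D|); apply: le_lt_trans (ltrD B A).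
rewrite [X in _ + X]distrC; apply: le_trans (ler_normD _ _).
by rewrite subrKA.
Qed.

End C_infty_calculus.

Arguments C_infty_derivable {R n f} i z _.

(** * Iterated partial derivatives indexed by words *)

Section iterated_partials.
Context {R : realType} {n : nat}.
Implicit Types (f g : 'rV[R]_n -> R) (i j : 'I_n) (S T : seq 'I_n).

(** A word of directions instead of a multi-index: induction on the list strips one derivative at a
    time. *)
Definition iterp S f : 'rV[R]_n -> R := foldl (fun g i => partial i g) f S.

Lemma iterp_cat S T f : iterp (S ++ T) f = iterp T (iterp S f).
Proof. exact: foldl_cat. Qed.

Lemma C_infty_iterp S f : C_infty f -> C_infty (iterp S f).
Proof. by elim: S f => [//|i S IH] f Cf /=; apply: IH; exact: C_infty_partial. Qed.

Let iterp_front S T i f : C_infty f -> iterp (S ++ i :: T) f = iterp (i :: S ++ T) f.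
Proof.
elim: S f => [//|j S IH] f Cf /=; have Cj := C_infty_partial j Cf.
by rewrite (IH _ Cj) /= (partialC i j Cf).
Qed.

Lemma iterp_perm S T f : C_infty f -> perm_eq S T -> iterp S f = iterp T f.
Proof.
elim: S T f => [|i S IH] T f Cf.
  by case: T => [//|j T] /perm_size.
move=> e; have iT : i \in T by rewrite -(perm_mem e) mem_head.
case/splitPr: iT e => T1 T2 e.
rewrite iterp_front //=; apply: IH; first exact: C_infty_partial.
by move: e; rewrite perm_sym perm_catC /= perm_cons perm_catC perm_sym.
Qed.

Lemma partial_iterp i S f : C_infty f -> partial i (iterp S f) = iterp S (partial i f).
Proof.
move=> Cf; have -> : partial i (iterp S f) = iterp (S ++ [:: i]) f by rewrite iterp_cat.
have -> : iterp S (partial i f) = iterp (i :: S) f by [].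
by apply: iterp_perm => //; rewrite -cat1s perm_catC.
Qed.

(** [partials] is itself [iterp] along some word with the same multiplicities, and permuted words
    give the same derivative. *)
Lemma iterp_partials S f : C_infty f ->
  iterp S f = partials (fun i => count_mem i S) f.
Proof.
move=> Cf; rewrite /partials.
pose al i := count_mem i S.
have h r : exists2 L, foldr (fun i g => iter (al i) (partial i) g) f r = iterp L f
   & forall i, count_mem i L = (\sum_(j <- r) (j == i) * al j)%N.
  elim: r => [|j r [L e cL]]; first by exists [::] => // i; rewrite big_nil.
  exists (L ++ nseq (al j) j) => /=.
    rewrite e iterp_cat; elim: (al j) => [//|k IH].
    by rewrite iterS IH -[k.+1]addn1 nseqD iterp_cat.
  by move=> i; rewrite count_cat cL big_cons addnC count_nseq.
have [L -> cL] := h (enum 'I_n); apply: iterp_perm => //.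
apply/allP => i _ /=; rewrite cL big_enum /= (bigD1 i) //= eqxx mul1n big1 ?addn0 //.
by move=> j /negPf ->.
Qed.

Lemma iterpD S f g : C_infty f -> C_infty g ->
  iterp S (fun z => f z + g z) = (fun z => iterp S f z + iterp S g z).
Proof.
elim: S f g => [//|i S IH] f g Cf Cg /=.
have df z := C_infty_derivable i z Cf; have dg z := C_infty_derivable i z Cg.
by rewrite (partialD df dg); apply: IH; exact: C_infty_partial.
Qed.

Lemma iterpZ S (c : R) f : C_infty f ->
  iterp S (fun z => c * f z) = (fun z => c * iterp S f z).
Proof.
elim: S f => [//|i S IH] f Cf /=.
have df z := C_infty_derivable i z Cf.
by rewrite (partialZ c df); apply: IH; exact: C_infty_partial.
Qed.

Lemma iterp_cst S (c : R) : S != [::] -> iterp S (fun=> c) = (fun=> 0) :> ('rV[R]_n -> R).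
Proof.
case: S => // i S _ /=; rewrite partial_cst.
by elim: S => //= j S IH; rewrite partial_cst.
Qed.

Lemma C_infty_frz f (m : pred 'I_n) c : C_infty f -> C_infty (fun z => f (frz m c z)).
Proof.
move=> Cf k; elim: k f Cf => [|k IH] f Cf.
  have cf := C_infty_cont Cf.
  move=> x; apply: (@continuous_comp _ _ _ (frz m c) f); last exact: cf.
  move=> A /nbhs_ballP[e /= e0 hA]; apply/nbhs_ballP; exists e => //= y [_ h].
  apply: hA; split=> // a b; rewrite !mxE.
  by case: ifP => _; [exact: ballxx|exact: h].
split; first by have := IH f Cf; case: k {IH} => [//|k []].
move=> i; have [mi|mi] := boolP (m i).
  split; first by move=> z; have [] := partial_frz0 f c z mi.
  have -> : partial i (fun w => f (frz m c w)) = (fun=> 0).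
    by apply/funext => z; have [_ ->] := partial_frz0 f c z mi.
  exact: C_infty_cst.
have df z := C_infty_derivable i z Cf.
split; first by move=> z; have [] := partial_frz mi (df (frz m c z)).
have -> : partial i (fun w => f (frz m c w)) = (fun w => partial i f (frz m c w)).
  by apply/funext => z; have [_ ->] := partial_frz mi (df (frz m c z)).
by apply: IH; exact: C_infty_partial.
Qed.

Lemma iterp_frz S f (m : pred 'I_n) c : C_infty f ->
  iterp S (fun z => f (frz m c z)) =
  (fun z => if has m S then 0 else iterp S f (frz m c z)).
Proof.
elim: S f => [//|i S IH] f Cf /=.
have [mi|mi] /= := boolP (m i).
  have -> : partial i (fun w => f (frz m c w)) = (fun=> 0).
    by apply/funext => z; have [_ ->] := partial_frz0 f c z mi.
  by case: S {IH} => // j S; rewrite iterp_cst.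
have df z := C_infty_derivable i z Cf.
have -> : partial i (fun w => f (frz m c w)) = (fun w => partial i f (frz m c w)).
  by apply/funext => z; have [_ ->] := partial_frz mi (df (frz m c z)).
by apply: IH; exact: C_infty_partial.
Qed.

(* Moving from [w] to [z] one coordinate at a time, applying the mean value
   theorem on each edge of this path. *)
Lemma path_MVT f (w z : 'rV[R]_n) : C_infty f ->
  exists2 eta : 'I_n -> 'rV[R]_n,
    forall i j, Num.min (w ord0 j) (z ord0 j) <= eta i ord0 j
                 <= Num.max (w ord0 j) (z ord0 j) &
    f z - f w = \sum_i partial i f (eta i) * (z ord0 i - w ord0 i).
Proof.
move=> Cf.
pose v (k : nat) : 'rV[R]_n := \row_j (if (j < k)%N then z ord0 j else w ord0 j).
have v0 : v 0%N = w by apply/rowP => j; rewrite mxE.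
have vn : v n = z by apply/rowP => j; rewrite mxE ltn_ord.
have step (i : 'I_n) : exists c, Num.min (w ord0 i) (z ord0 i) <= c <= Num.max (w ord0 i) (z ord0 i)
    /\ f (v i.+1) - f (v i) = partial i f (upd (v i) i c) * (z ord0 i - w ord0 i).
  have [c hc e] := slice_MVT (v i) (w ord0 i) (z ord0 i)
     (fun w => C_infty_derivable i w Cf).
  exists c; split => //; rewrite -e; congr (f _ - f _); apply/rowP => j; rewrite !mxE.
    by rewrite ltnS leq_eqVlt; have [->|] := eqVneq j i; rewrite ?eqxx //= -val_eqE /= => /negPf ->.
  by have [->|] := eqVneq j i; rewrite // ltnn.
have /choice[c hc] := step.
exists (fun i => upd (v i) i (c i)).
  move=> i j; rewrite updE; case: eqP => [->|_]; first by have [] := hc i.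
  by rewrite mxE; case: ifP => _; rewrite ge_min le_max lexx ?orbT.
under eq_bigr do rewrite -(hc _).2.
rewrite -{1}vn -{1}v0.
rewrite -(big_mkord xpredT (fun k => f (v k.+1) - f (v k))).
by rewrite telescope_sumr.
Qed.

(** The bound is asked only in directions in which the two points differ; [twist_bound], which moves
    within one group of variables, can offer no more. *)
Lemma lipschitz_path f (B : R) (w z : 'rV[R]_n) : C_infty f ->
  (forall i (v : 'rV[R]_n), (forall j, Num.min (w ord0 j) (z ord0 j) <= v ord0 j
                 <= Num.max (w ord0 j) (z ord0 j)) ->
    w ord0 i != z ord0 i -> `|partial i f v| <= B) ->
  `|f z - f w| <= \sum_i B * `|z ord0 i - w ord0 i|.
Proof.
move=> Cf hB; have [eta he ->] := path_MVT w z Cf.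
apply: le_trans (ler_norm_sum _ _ _) _; apply: ler_sum => i _; rewrite normrM.
have [->|wz] := eqVneq (w ord0 i) (z ord0 i); first by rewrite subrr normr0 !mulr0.
by apply: ler_wpM2r => //; exact: hB.
Qed.

End iterated_partials.

(** * Families of functions with uniformly bounded derivatives *)

Section bounded_families.
Context {R : realType} {n : nat} {I : Type}.
Implicit Types (F G : I -> 'rV[R]_n -> R) (D : I -> 'rV[R]_n -> Prop) (k : nat).

(** One constant for a whole family: the index will be a corner together with a phase shift, and the
    final estimate must not depend on either. *)
Definition bounded_partials D k F := forall S : seq 'I_n, (size S <= k)%N ->
  exists C : R, forall p z, D p z -> `|iterp S (F p) z| <= C.

Lemma bounded_partialsW D k F :
  bounded_partials D k.+1 F -> bounded_partials D k F.
Proof. by move=> h S hS; apply: h; exact: leqW. Qed.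

Lemma bounded_partialsD D k F G : (forall p, C_infty (F p)) ->
  (forall p, C_infty (G p)) -> bounded_partials D k F -> bounded_partials D k G ->
  bounded_partials D k (fun p z => F p z + G p z).
Proof.
move=> CF CG hF hG S hS; have [A hA] := hF S hS; have [B hB] := hG S hS.
exists (A + B) => p z Dz; rewrite iterpD //.
by apply: le_trans (ler_normD _ _) _; apply: lerD; [exact: hA|exact: hB].
Qed.

Lemma bounded_partialsM D k F G : (forall p, C_infty (F p)) ->
  (forall p, C_infty (G p)) -> bounded_partials D k F -> bounded_partials D k G ->
  bounded_partials D k (fun p z => F p z * G p z).
Proof.
elim: k F G => [|k IH] F G CF CG hF hG S.
  case: S => // _; have [A hA] := hF [::] isT; have [B hB] := hG [::] isT.
  exists (A * B) => p z Dz /=; rewrite normrM.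
  by apply: ler_pM => //; [exact: hA|exact: hB].
case: S => [|i S] hS /=; first exact: (IH _ _ CF CG (bounded_partialsW hF) (bounded_partialsW hG) [::] isT).
have hS' : (size S <= k)%N by [].
have dF p z := C_infty_derivable i z (CF p).
have dG p z := C_infty_derivable i z (CG p).
have CF' p := C_infty_partial i (CF p); have CG' p := C_infty_partial i (CG p).
have hF' : bounded_partials D k (fun p => partial i (F p)).
  by move=> T hT; exact: (hF (i :: T)).
have hG' : bounded_partials D k (fun p => partial i (G p)).
  by move=> T hT; exact: (hG (i :: T)).
have [C hC] := bounded_partialsD (fun p => C_inftyM (CF' p) (CG p))
  (fun p => C_inftyM (CF p) (CG' p))
  (IH _ _ CF' CG hF' (bounded_partialsW hG)) (IH _ _ CF CG' (bounded_partialsW hF) hG') hS'.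
by exists C => p z Dz; rewrite (partialM (dF p) (dG p)); exact: hC.
Qed.

(** The phases themselves may be unbounded: they enter undifferentiated only inside a cosine. *)
Lemma bounded_partials_cos D k F (th : I -> R) : (forall p, C_infty (F p)) ->
  (forall i, bounded_partials D k (fun p => partial i (F p))) ->
  bounded_partials D k (fun p z => cos (F p z + th p)).
Proof.
move=> CF; elim: k th => [|k IH] th hF S.
  by case: S => // _; exists 1 => p z _ /=; rewrite ler_norml cos_geN1 cos_le1.
case: S => [|i S] hS /=; first by exists 1 => p z _ /=; rewrite ler_norml cos_geN1 cos_le1.
have hS' : (size S <= k)%N by [].
have dF p z := C_infty_derivable i z (CF p).
have hk j : bounded_partials D k (fun p => partial j (F p)).
  exact: bounded_partialsW.
have [C hC] := bounded_partialsM (fun p => C_infty_cos (th p + pi / 2) (CF p))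
   (fun p => C_infty_partial i (CF p)) (IH (fun p => th p + pi / 2) hk) (hk i) hS'.
by exists C => p z Dz; rewrite (partial_cos (th p) (dF p)); exact: hC.
Qed.

End bounded_families.

(** * What the symbol classes provide *)

Section symbol_bounds.
Context {R : realType} {d : nat}.
Implicit Types (phi : 'rV[R]_(d + d) -> R) (S : seq 'I_(d + d)).

Definition is_x (k : 'I_(d + d)) : bool := (k < d)%N.

(** A symbol of order (1, 1) and its pure x- or xi-derivatives may grow; one derivative in each
    group brings both exponents down to at most 0. *)
Definition mixed S := has is_x S && has (predC is_x) S.

Definition mixed_phase phi := C_infty phi /\
  forall S, mixed S -> exists C : R, forall z, `|iterp S phi z| <= C.

Definition bounded_smooth phi := C_infty phi /\
  forall S, exists C : R, forall z, `|iterp S phi z| <= C.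

Lemma bracket_ge1 (x : 'rV[R]_d) : 1 <= bracket x.
Proof.
rewrite /bracket -[X in X <= _]sqrtr1 ler_wsqrtr // lerDl.
by apply: sumr_ge0 => i _; rewrite -expr2 sqr_ge0.
Qed.

Lemma SG_bounded m mu r rho (a : 'rV[R]_(d + d) -> R[i]) S :
  SG m mu r rho a ->
  m - r * (\sum_(i < d) count_mem (lshift d i) S)%:R <= 0 ->
  mu - rho * (\sum_(i < d) count_mem (rshift d i) S)%:R <= 0 ->
  exists C : R, forall z, `|iterp S (fun y => complex.Re (a y)) z| <= C /\
    `|iterp S (fun y => complex.Im (a y)) z| <= C.
Proof.
move=> [[C1 C2] h] hm hmu.
pose al : multi_index d := fun i => count_mem (lshift d i) S.
pose be : multi_index d := fun i => count_mem (rshift d i) S.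
have ej : join_mi al be = (fun i => count_mem i S).
  by apply/funext => k; rewrite /join_mi; case: split_ordP => j ->.
have [c c0 hc] := h al be.
have pow1 (x : 'rV[R]_d) (e : R) : e <= 0 -> bracket x `^ e <= 1.
  by move=> e0; rewrite -(powRr0 (bracket x)); apply: ler_powR => //; exact: bracket_ge1.
exists c => z.
have := hc (lsubmx z, rsubmx z); rewrite /= hsubmxK ej.
rewrite (iterp_partials _ C1) (iterp_partials _ C2).
move=> H; have {}H : Cmod (partialsC (fun i => count_mem i S) a z) <= c.
  apply: le_trans H _; rewrite ler_piMr // ?(ltW c0) //.
  by rewrite mulr_ile1 ?powR_ge0 // pow1.
have sq (p q : R) : `|p| <= Num.sqrt (p ^+ 2 + q ^+ 2) /\ `|q| <= Num.sqrt (p ^+ 2 + q ^+ 2).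
  by rewrite -!sqrtr_sqr !ler_wsqrtr // ?lerDl ?lerDr sqr_ge0.
by split; apply: le_trans H; [exact: (sq _ _).1|exact: (sq _ _).2].
Qed.

Lemma mixed_phase_SG phi : SG 1 1 1 1 (fun z => (phi z)%:C%C) -> mixed_phase phi.
Proof.
move=> h; have [[Cphi _] _] := h; split=> // S /andP[/hasP[k kS kx] /hasP[l lS lx]].
have one (p : nat) : (0 < p)%N -> (1 : R) - 1 * p%:R <= 0.
  by move=> p0; rewrite mul1r subr_le0 ler1n.
have hk : k = lshift d (Ordinal kx) by apply: val_inj.
have [l' hl] : exists l', l = rshift d l'.
  case: (split_ordP l) lx => j e; last by exists j.
  by rewrite e /is_x /= ltn_ord.
have [||C hC] := SG_bounded (S := S) h.
- apply: one; rewrite (bigD1 (Ordinal kx)) //= -hk.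
  by rewrite ltn_addr // -has_count has_pred1.
- apply: one; rewrite (bigD1 l') //= -hl.
  by rewrite ltn_addr // -has_count has_pred1.
by exists C => z; have [] := hC z.
Qed.

Lemma bounded_smooth_SG r rho (a : 'rV[R]_(d + d) -> R[i]) :
  0 <= r -> 0 <= rho -> SG 0 0 r rho a ->
  bounded_smooth (fun z => complex.Re (a z)) /\
  bounded_smooth (fun z => complex.Im (a z)).
Proof.
move=> r0 rho0 h; have [[C1 C2] _] := h.
by split; (split=> // S; have [||C hC] := SG_bounded (S := S) h;
  rewrite ?sub0r ?oppr_le0 ?mulr_ge0 //; exists C => z; have [] := hC z).
Qed.

End symbol_bounds.

(** * From local to global expansion *)

Section global_injectivity.
Context {R : realType} {V W : normedModType R}.

(* Discrete homotopy lifting: the image of the segment [a, b] is deformed to the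
   segment [G a, G b] in small steps, and a discretized lift is carried along;
   its end points do not move, because local preimages are unique. *)
Lemma local_to_global_expansion (G : V -> W) (L kappa r : R) :
  0 <= L -> 0 < kappa -> 0 < r ->
  (forall p q, `|G p - G q| <= L * `|p - q|) ->
  (forall p q, `|p - q| <= r -> `|p - q| <= kappa * `|G p - G q|) ->
  (forall p y, `|y - G p| <= r / kappa -> exists2 p', `|p' - p| <= r & G p' = y) ->
  forall a b, `|a - b| <= kappa * `|G a - G b|.
Proof.
move=> L0 k0 r0 lipG injG surG a b.
(* A Lipschitz constant of the homotopy [h] below, in [s] as well as in [t]; the summand 1 makes it
   positive. *)
pose Q := L * `|b - a| + `|G b - G a| + 1.
have Q0 : 0 < Q by rewrite /Q ltr_wpDl // addr_ge0 // mulr_ge0.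
have [N [N0 hD hQ]] : exists N : nat, [/\ (0 < N)%N, `|b - a| / N%:R <= r &
    kappa * (Q / N%:R) <= r / 4].
  pose N := (Num.truncn (`|b - a| / r) + Num.truncn (4 * kappa * Q / r)).+1.
  have hN (x : R) (m : nat) : 0 <= x -> (Num.truncn x < m)%N -> x <= m%:R.
    move=> x0 xm; apply: ltW; have /andP[_ h] := truncn_itv x0.
    by apply: lt_le_trans h _; rewrite ler_nat.
  exists N; have N0 : (0 : R) < N%:R by rewrite ltr0n.
  split => //.
    rewrite ler_pdivrMr // -ler_pdivrMl // mulrC; apply: hN.
      by rewrite divr_ge0 // ltW.
    by rewrite /N ltnS leq_addr.
  have h4 : 4 * kappa * Q / r <= N%:R.
    apply: hN; last by rewrite /N ltnS leq_addl.
    by rewrite divr_ge0 ?(ltW r0) // !mulr_ge0 // ltW.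
  by rewrite mulrA ler_pdivrMr //; move: h4; rewrite ler_pdivrMr //; lra.
have NR0 : (0 : R) < N%:R by rewrite ltr0n.
pose ga (s : R) := a + s *: (b - a).
pose h (t s : R) := (1 - t) *: G (ga s) + t *: (G a + s *: (G b - G a)).
pose u (i : nat) : R := i%:R / N%:R.
have u0 : u 0%N = 0 by rewrite /u mul0r.
have uN : u N = 1 by rewrite /u divff // gt_eqF.
have uS i : u i.+1 - u i = N%:R^-1 by rewrite /u -mulrBl -natrB // subSnn mul1r.
have u_itv i : (i <= N)%N -> 0 <= u i <= 1.
  by move=> iN; rewrite divr_ge0 //= ler_pdivrMr // mul1r ler_nat.
have gaN0 : ga 0 = a by rewrite /ga scale0r addr0.
have gaN1 : ga 1 = b by rewrite /ga scale1r addrC subrK.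
have h_s0 t : h t 0 = G a.
  by rewrite /h gaN0 scale0r addr0 -scalerDl subrK scale1r.
have h_s1 t : h t 1 = G b.
  by rewrite /h gaN1 scale1r [G a + _]addrC subrK -scalerDl subrK scale1r.
have Ni0 : (0 : R) <= N%:R^-1 by rewrite invr_ge0 ltW.
have lip_ga s s' : `|G (ga s) - G (ga s')| <= L * (`|s - s'| * `|b - a|).
  apply: le_trans (lipG _ _) _; apply: ler_wpM2l => //.
  by rewrite /ga opprD addrACA subrr add0r -scalerBl normrZ.
have h_move_s t s s' : 0 <= t <= 1 -> `|h t s - h t s'| <= `|s - s'| * Q.
  move=> /andP[t0 t1]; rewrite /h opprD addrACA -!scalerBr.
  have -> : G a + s *: (G b - G a) - (G a + s' *: (G b - G a)) = (s - s') *: (G b - G a).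
    by rewrite opprD addrACA subrr add0r -scalerBl.
  apply: le_trans (ler_normD _ _) _; have t1' : 0 <= 1 - t by rewrite subr_ge0.
  rewrite !normrZ (ger0_norm t0) (ger0_norm t1').
  have -> : `|s - s'| * Q = (L * (`|s - s'| * `|b - a|)) + `|s - s'| * `|G b - G a|
     + `|s - s'| by rewrite /Q; ring.
  rewrite -[X in X <= _]addr0; apply: lerD => //; apply: lerD.
    by apply: le_trans (lip_ga s s'); rewrite ler_piMl // gerBl.
  by rewrite ler_piMl // mulr_ge0.
have h_move_t t t' s : 0 <= s <= 1 -> `|h t s - h t' s| <= `|t - t'| * Q.
  move=> /andP[s0 s1].
  have -> : h t s - h t' s = (t - t') *: (G a - G (ga s) + s *: (G b - G a)).
    rewrite /h; set X := G (ga s); set Y := s *: (G b - G a).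
    rewrite opprD addrACA -!scalerBl (_ : 1 - t - (1 - t') = - (t - t')); last by ring.
    by rewrite scaleNr addrC -scalerBr [G a - X + Y]addrAC.
  rewrite normrZ; apply: ler_wpM2l => //; apply: le_trans (ler_normD _ _) _.
  rewrite normrZ (ger0_norm s0) /Q -addrA; apply: lerD.
    have := lip_ga 0 s; rewrite gaN0 sub0r normrN (ger0_norm s0) => /le_trans; apply.
    by apply: ler_wpM2l => //; rewrite ler_piMl.
  by apply: (@le_trans _ _ `|G b - G a|); [rewrite ler_piMl|rewrite lerDl].
have dN i : `|u i - u i.+1| = N%:R^-1 by rewrite distrC uS ger0_norm.
have close_s t i : 0 <= t <= 1 -> `|h t (u i) - h t (u i.+1)| <= Q / N%:R.
  by move=> t01; rewrite mulrC -(dN i); exact: h_move_s.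
have kQr : kappa * (Q / N%:R) <= r.
  by apply: le_trans hQ _; lra.
have lift j : (j <= N)%N -> exists p : nat -> V, [/\ p 0%N = a, p N = b,
    forall i, (i <= N)%N -> G (p i) = h (u j) (u i) &
    forall i, (i < N)%N -> `|p i - p i.+1| <= kappa * (Q / N%:R)].
  elim: j => [_|j IH jN].
    have h0 s : h 0 s = G (ga s) by rewrite /h subr0 scale1r scale0r addr0.
    exists (fun i => ga (u i)); split.
    - by rewrite u0.
    - by rewrite uN.
    - by move=> i _; rewrite u0 h0.
    move=> i iN; apply: le_trans (injG _ _ _) _.
      rewrite /ga opprD addrACA subrr add0r -scalerBl normrZ dN mulrC.
      by rewrite -/(_ / _).
    apply: ler_wpM2l; first exact: ltW.
    by rewrite -!h0; apply: close_s; rewrite lexx ler01.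
  have [p [p0 pN Gp dp]] := IH (ltnW jN).
  have tj := u_itv _ (ltnW jN); have tj1 := u_itv _ jN.
  have /choice[q hq] : forall i, exists q, (i <= N)%N ->
      G q = h (u j.+1) (u i) /\ `|q - p i| <= kappa * (Q / N%:R).
    move=> i; have [iN|] := leqP i N; last by exists a.
    have hm : `|h (u j.+1) (u i) - G (p i)| <= Q / N%:R.
      rewrite (Gp _ iN) [Q / _]mulrC -(dN j) [`|u j - _|]distrC.
      exact: h_move_t (u_itv _ iN).
    have [|q qr Gq] := surG (p i) (h (u j.+1) (u i)).
      by apply: le_trans hm _; rewrite ler_pdivlMr // mulrC.
    exists q => _; split => //; apply: le_trans (injG _ _ qr) _.
    by rewrite Gq; apply: ler_wpM2l => //; exact: ltW.
  have uniq i c : (i <= N)%N -> p i = c -> h (u j.+1) (u i) = G c -> q i = c.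
    move=> iN pic hc; have [Gq qp] := hq i iN.
    apply/eqP; rewrite -subr_eq0 -normr_le0.
    have := injG (q i) c; rewrite Gq hc subrr normr0 mulr0; apply.
    by rewrite -pic; exact: le_trans qp kQr.
  exists q; split.
  - by apply: uniq; rewrite // u0 h_s0.
  - by apply: uniq; rewrite // uN h_s1.
  - by move=> i iN; have [] := hq i iN.
  move=> i iN; have [Gq qp] := hq i (ltnW iN); have [Gq' qp'] := hq i.+1 iN.
  apply: le_trans (injG _ _ _) _; last first.
    by rewrite Gq Gq'; apply: ler_wpM2l; [exact: ltW|exact: close_s].
  (* Neighbours on the new lift are compared through the old one; three legs of length at most
     [r / 4] stay within the radius of injectivity. *)
  have -> : q i - q i.+1 = (q i - p i) + (p i - p i.+1) + (p i.+1 - q i.+1).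
    by rewrite !addrA !subrK.
  apply: le_trans (ler_normD _ _) _; apply: (@le_trans _ _ (r / 4 + r / 4 + r / 4)).
    apply: lerD; last by rewrite distrC; exact: le_trans qp' hQ.
    apply: le_trans (ler_normD _ _) _; apply: lerD; first exact: le_trans qp hQ.
    exact: le_trans (dp i iN) hQ.
  by lra.
(* At [t = 1] the image is the straight segment, so the small steps of its lift add up to the
   bound. *)
have [p [p0 pN Gp dp]] := lift N (leqnn N).
have -> : a - b = - \sum_(0 <= i < N) (p i.+1 - p i).
  by rewrite telescope_sumr // p0 pN opprB.
rewrite normrN; apply: le_trans (ler_norm_sum _ _ _) _.
have st i : (i < N)%N -> `|p i.+1 - p i| <= kappa * (`|G a - G b| / N%:R).
  move=> iN; rewrite distrC.
  apply: le_trans (injG _ _ (le_trans (dp i iN) kQr)) _.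
  rewrite (Gp _ (ltnW iN)) (Gp _ iN) uN; apply: ler_wpM2l; first exact: ltW.
  rewrite /h subrr !scale0r !add0r !scale1r opprD addrACA subrr add0r -scalerBl.
  by rewrite normrZ dN mulrC distrC.
rewrite big_nat_cond; apply: (@le_trans _ _
    (\sum_(0 <= i < N | (0 <= i < N)%N && true) kappa * (`|G a - G b| / N%:R))).
  by apply: ler_sum => i /andP[/andP[_ iN] _]; exact: st.
by rewrite -big_nat_cond sumr_const_nat subn0 -[_ *+ N]mulr_natr -[kappa * _ * _]mulrA divfK ?gt_eqF.
Qed.

End global_injectivity.

(** Completeness, for the Banach fixed point theorem in [hadamard_expansion]. *)
HB.instance Definition _ (R : realType) (m n : nat) :=
  Uniform_isComplete.Build 'M[R]_(m, n) cauchy_cvg.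

(** * A quantitative Hadamard theorem *)

Section hadamard.
Context {R : realType} {n : nat}.
Implicit Types (v p q : 'rV[R]_n) (g : 'I_n -> 'rV[R]_n -> R).

Lemma coord_le_norm v i : `|v ord0 i| <= `|v|.
Proof.
rewrite /Num.norm /= mx_normrE; exact: (@le_bigmax _ _ _ 0 (fun ij : 'I_1 * 'I_n => `|v ij.1 ij.2|) (ord0, i)).
Qed.

Lemma norm_le_coord v (e : R) : 0 <= e -> (forall i, `|v ord0 i| <= e) -> `|v| <= e.
Proof.
move=> e0 h; rewrite /Num.norm /= mx_normrE; apply/bigmax_leP; split=> // -[a b] _ /=.
by rewrite ord1.
Qed.

Lemma norm_mulmx_le v (M : 'M[R]_n) (K : R) : 0 <= K -> (forall i j, `|M i j| <= K) ->
  `|v *m M| <= n%:R * K * `|v|.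
Proof.
move=> K0 hM; apply: norm_le_coord => [|j]; first by rewrite !mulr_ge0.
rewrite mxE; apply: le_trans (ler_norm_sum _ _ _) _.
apply: (@le_trans _ _ (\sum_(i < n) K * `|v|)).
  by apply: ler_sum => i _; rewrite normrM mulrC ler_pM // coord_le_norm.
by rewrite sumr_const card_ord -mulrA [n%:R * _]mulr_natl.
Qed.

Lemma det_le m (A : 'M[R]_m) (K : R) : (forall i j, `|A i j| <= K) ->
  `|\det A| <= m`!%:R * K ^+ m.
Proof.
move=> hA; apply: le_trans (ler_norm_sum _ _ _) _.
apply: (@le_trans _ _ (\sum_(s : {perm 'I_m}) K ^+ m)).
  apply: ler_sum => s _; rewrite normrM normrX normrN1 expr1n mul1r normr_prod.
  rewrite -[X in K ^+ X]card_ord -prodr_const.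
  by apply: ler_prod => i _; rewrite normr_ge0 hA.
by rewrite sumr_const card_Sn [m`!%:R * _]mulr_natl.
Qed.

(** Cramer's rule: a cofactor is, up to sign, a determinant of size [n.-1]. *)
Lemma invmx_le (A : 'M[R]_n) (K c : R) : 0 < c -> (forall i j, `|A i j| <= K) ->
  c <= `|\det A| -> A \in unitmx /\
  forall i j, `|invmx A i j| <= c^-1 * ((n.-1)`!%:R * K ^+ n.-1).
Proof.
move=> c0 hA hc; have d0 : 0 < `|\det A| by exact: lt_le_trans hc.
have uA : A \in unitmx by rewrite unitmxE unitfE -normr_gt0.
split=> // i j; rewrite /invmx uA !mxE /cofactor normrM normrV ?unitfE -?normr_gt0 //.
apply: ler_pM; rewrite ?invr_ge0 ?normr_ge0 //; first by rewrite lef_pV2.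
rewrite normrM normrX normrN1 expr1n mul1r; apply: det_le => a b; rewrite !mxE.
exact: hA.
Qed.

(** The transpose of the usual Jacobian matrix, since row vectors multiply from the left. *)
Definition jac g p : 'M[R]_n := \matrix_(i, j) partial i (g j) p.

Definition rvec g p : 'rV[R]_n := \row_j g j p.

(** Each entry of [M] is a derivative at its own intermediate point, the mean value theorem being
    applied per component and per coordinate; second derivatives keep all of them close to the
    Jacobian at [p0]. *)
Lemma jac_mean_value g p0 (r B2 : R) p q : (forall j, C_infty (g j)) ->
  (forall i j k z, `|partial k (partial i (g j)) z| <= B2) ->
  0 <= B2 -> 0 <= r ->
  `|p - p0| <= r -> `|q - p0| <= r ->
  exists2 M : 'M[R]_n, rvec g p - rvec g q = (p - q) *m M &
    forall i j, `|M i j - jac g p0 i j| <= n%:R * (B2 * r).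
Proof.
move=> Cg h2 B20 r0 hp hq.
have /choice[eta heta] : forall j, exists eta : 'I_n -> 'rV[R]_n,
    (forall i k, Num.min (q ord0 k) (p ord0 k) <= eta i ord0 k
                 <= Num.max (q ord0 k) (p ord0 k)) /\
    g j p - g j q = \sum_i partial i (g j) (eta i) * (p ord0 i - q ord0 i).
  by move=> j; have [e h1 h3] := path_MVT q p (Cg j); exists e.
exists (\matrix_(i, j) partial i (g j) (eta j i)).
  apply/rowP => j; rewrite !mxE (heta j).2.
  by apply: eq_bigr => i _; rewrite !mxE mulrC.
move=> i j; rewrite !mxE.
have hb := (heta j).1.
have he k : `|eta j i ord0 k - p0 ord0 k| <= r.
  have := hb i k.
  have := le_trans (coord_le_norm (p - p0) k) hp.
  have := le_trans (coord_le_norm (q - p0) k) hq.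
  rewrite !mxE !ler_norml ge_min le_max => /andP[q1 q2] /andP[p1 p2] /andP[].
  by move=> /orP[] e1 /orP[] e2; apply/andP; split; lra.
apply: le_trans (lipschitz_path (B := B2) (C_infty_partial i (Cg j)) _) _.
  by move=> k v _ _; exact: h2.
apply: (@le_trans _ _ (\sum_(k < n) B2 * r)).
  by apply: ler_sum => k _; exact: ler_wpM2l.
by rewrite sumr_const card_ord mulr_natl.
Qed.

(** An inverse function theorem whose radius and constants depend only on the bounds and not on the
    point, which is what [local_to_global_expansion] asks for. *)
Lemma hadamard_expansion (B B2 c : R) : 0 <= B -> 0 <= B2 -> 0 < c ->
  exists2 kappa : R, 0 < kappa & forall g, (forall j, C_infty (g j)) ->
    (forall i j z, `|partial i (g j) z| <= B) ->
    (forall i j k z, `|partial k (partial i (g j)) z| <= B2) ->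
    (forall z, c <= `|\det (jac g z)|) ->
    forall a b, `|a - b| <= kappa * `|rvec g a - rvec g b|.
Proof.
move=> B0 B20 c0.
pose K := c^-1 * ((n.-1)`!%:R * B ^+ n.-1).
have K0 : 0 <= K by apply: mulr_ge0; [rewrite invr_ge0 ltW|rewrite mulr_ge0 // exprn_ge0].
pose X := n%:R * K * (n%:R * (n%:R * B2)).
have nK0 : 0 <= n%:R * K := mulr_ge0 (ler0n R n) K0.
have X0 : 0 <= X.
  exact: (mulr_ge0 nK0 (mulr_ge0 (ler0n _ _) (mulr_ge0 (ler0n _ _) B20))).
(* On every ball of this radius the map [F] below is a contraction of ratio 1/2. *)
pose r := (2 * X + 1)^-1.
have r0 : 0 < r by rewrite invr_gt0 ltr_wpDl // mulr_ge0.
have rX : X * r <= 2^-1.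
  have fin (x : R) : 0 <= x -> x * (2 * x + 1)^-1 <= 2^-1.
    by move=> x0; rewrite ler_pdivrMr; [lra|rewrite ltr_wpDl // mulr_ge0].
  exact: fin.
(* The contraction absorbs half of [p - q], whence the factor 2; the summand 1 gives positivity. *)
pose kappa := 2 * (n%:R * K) + 1.
have k0 : 0 < kappa by apply: ltr_wpDl => //; exact: mulr_ge0.
exists kappa => // g Cg hB hB2 hdet.
have uJ p : jac g p \in unitmx /\ forall i j, `|invmx (jac g p) i j| <= K.
  by apply: (invmx_le c0 _ (hdet p)) => i j; rewrite mxE; exact: hB.
have contr p0 p q : `|p - p0| <= r -> `|q - p0| <= r ->
    `|(p - q) - (rvec g p - rvec g q) *m invmx (jac g p0)| <= 2^-1 * `|p - q|.
  move=> hp hq; have [uA hV] := uJ p0.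
  have [M -> hM] := jac_mean_value Cg hB2 B20 (ltW r0) hp hq.
  have -> : (p - q) - (p - q) *m M *m invmx (jac g p0) =
      (p - q) *m (jac g p0 - M) *m invmx (jac g p0).
    move: (p - q) => w; have e1 : w *m jac g p0 *m invmx (jac g p0) = w.
      by rewrite -mulmxA mulmxV // mulmx1.
    by rewrite mulmxBr mulmxBl e1.
  apply: le_trans (norm_mulmx_le _ K0 hV) _.
  have hM' i j : `|(jac g p0 - M) i j| <= n%:R * (B2 * r).
    by rewrite !mxE distrC; have := hM i j; rewrite !mxE.
  have Br0 : 0 <= n%:R * (B2 * r) by rewrite !mulr_ge0 // ltW.
  apply: (@le_trans _ _ (n%:R * K * (n%:R * (n%:R * (B2 * r)) * `|p - q|))).
    by apply: ler_wpM2l; [rewrite mulr_ge0|exact: norm_mulmx_le].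
  rewrite (_ : _ * (_ * `|_|) = (X * r) * `|p - q|); first exact: ler_wpM2r.
  by rewrite /X !mulrA.
have inj p0 p q : `|p - p0| <= r -> `|q - p0| <= r ->
    `|p - q| <= kappa * `|rvec g p - rvec g q|.
  move=> hp hq; have [uA hV] := uJ p0; have hc := contr _ _ _ hp hq.
  have hn := norm_mulmx_le (rvec g p - rvec g q) K0 hV.
  have ht : `|p - q| <= `|(p - q) - (rvec g p - rvec g q) *m invmx (jac g p0)| +
      `|(rvec g p - rvec g q) *m invmx (jac g p0)|.
    by apply: le_trans (ler_normD _ _); rewrite subrK.
  have fin (a b t s e : R) : t <= a + b -> a <= 2^-1 * t -> b <= s * e -> 0 <= e ->
      t <= (2 * s + 1) * e by nra.
  exact: fin ht hc hn _.
have lip p q : `|rvec g p - rvec g q| <= n%:R * B * `|p - q|.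
  apply: norm_le_coord => [|j]; first by rewrite !mulr_ge0.
  rewrite !mxE; apply: le_trans (lipschitz_path (B := B) (Cg j) _) _.
    by move=> k v _ _; exact: hB.
  apply: (@le_trans _ _ (\sum_(k < n) B * `|p - q|)).
    by apply: ler_sum => k _; apply: ler_wpM2l => //; have := coord_le_norm (p - q) k; rewrite !mxE.
  by rewrite sumr_const card_ord -mulrA [n%:R * _]mulr_natl.
apply: (local_to_global_expansion (L := n%:R * B) (r := r)) => //.
- by rewrite mulr_ge0.
- by move=> p q hpq; apply: (inj q) => //; rewrite subrr normr0 ltW.
move=> p0 y hy; have [uA hV] := uJ p0.
pose U := closed_ball p0 r.
have UE v : U v <-> `|v - p0| <= r.
  by rewrite /U closed_ballE // /closed_ball_ /= distrC.
(* Newton's iteration with the Jacobian frozen at [p0]; a fixed point solves [rvec g p = y]. *)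
pose F p := p - (rvec g p - y) *m invmx (jac g p0).
have Fd p q : F p - F q = (p - q) - (rvec g p - rvec g q) *m invmx (jac g p0).
  rewrite /F opprD opprK addrACA; congr (_ + _).
  by rewrite addrC -mulmxBl -mulNmx; congr (_ *m _); rewrite opprB addrA subrK opprB.
have Fp0 : `|F p0 - p0| <= r / 2.
  rewrite /F addrAC subrr sub0r normrN; apply: le_trans (norm_mulmx_le _ K0 hV) _.
  rewrite distrC; have h1 : n%:R * K * `|y - rvec g p0| <= n%:R * K * (r / kappa).
    by apply: ler_wpM2l => //; rewrite mulr_ge0.
  apply: le_trans h1 _; rewrite mulrCA; apply: ler_wpM2l; first exact: ltW.
  by rewrite ler_pdivrMr // /kappa; lra.
have r0p : `|p0 - p0| <= r by rewrite subrr normr0 ltW.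
have FU : set_fun U U F.
  move=> p /UE hp; apply/UE.
  have -> : F p - p0 = (F p - F p0) + (F p0 - p0) by rewrite addrA subrK.
  apply: le_trans (ler_normD _ _) _; have := contr p0 p p0 hp r0p; rewrite -Fd.
  by move: Fp0 hp; lra.
pose Ff : {fun U >-> U} := mkfun_fun FU.
have cF : is_contraction Ff.
  exists (2^-1)%:nng; split; first by rewrite /= invf_lt1 // ltr1n.
  by move=> [p q] [/UE hp /UE hq] /=; rewrite Fd; exact: contr hp hq.
have [||p /UE hp pF] := @banach_fixed_point R 'rV[R]_n U Ff cF.
- exact: closed_ball_closed.
- by exists p0; apply/UE.
exists p => //; apply/eqP; rewrite -subr_eq0.
have : (rvec g p - y) *m invmx (jac g p0) = 0.
  by apply/eqP; rewrite -oppr_eq0 -(addKr p (- _)) -[X in _ + X]pF addrC subrr.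
by move/(congr1 (mulmx^~ (jac g p0))); rewrite -mulmxA mulVmx // mulmx1 mul0mx => ->.
Qed.

End hadamard.

(** * Lebesgue measure on row vectors *)

Section lebesgue_rV_theory.
Context {R : realType}.
Local Notation leb := (@lebesgue_measure R).

Definition cube (n : nat) (a : 'rV[R]_n) (s : R) : set 'rV[R]_n :=
  [set v | forall i, v ord0 i \in `[a ord0 i, a ord0 i + s]].

Lemma measurable_cube n (a : 'rV[R]_n) s : measurable (cube a s).
Proof.
have -> : cube a s = [set v | forall i, v ord0 i \in
    `[a ord0 i, (a + const_mx s) ord0 i]].
  by apply/seteqP; split=> v h i; have := h i; rewrite !mxE.
exact: measurable_box_rV.
Qed.

Lemma lebesgue_cube n (a : 'rV[R]_n) s : 0 <= s ->
  lebesgue_rV R n (cube a s) = (s ^+ n)%:E.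
Proof.
move=> s0.
have -> : cube a s = [set v | forall i, v ord0 i \in
    `[a ord0 i, (a + const_mx s) ord0 i]].
  by apply/seteqP; split=> v h i; have := h i; rewrite !mxE.
rewrite lebesgue_rV_box; last by move=> i; rewrite !mxE lerDl.
congr EFin; rewrite -[X in _ ^+ X]card_ord -prodr_const.
by apply: eq_bigr => i _; rewrite !mxE addrAC subrr add0r.
Qed.

(* A copy of [lebesgue_rV] that carries a sigma-finite instance, for Tonelli. *)
Definition lebS (n : nat) : set 'rV[R]_n -> \bar R := lebesgue_rV R n.

Arguments lebS : clear implicits.

Let lebS0 n : lebS n set0 = 0%E. Proof. exact: measure0. Qed.
Let lebS_ge0 n A : (0 <= lebS n A)%E. Proof. exact: measure_ge0. Qed.
Let lebS_sigma n : semi_sigma_additive (lebS n).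
Proof. exact: measure_semi_sigma_additive. Qed.
HB.instance Definition _ n := isMeasure.Build _ _ _ (lebS n)
  (@lebS0 n) (@lebS_ge0 n) (@lebS_sigma n).

(* Lebesgue measure on the line with the default display, the one that occurs in
   [lebesgue_cons]. *)
Definition lebR : set R -> \bar R := leb.

Let lebR0 : lebR set0 = 0%E. Proof. exact: measure0. Qed.
Let lebR_ge0 A : (0 <= lebR A)%E. Proof. exact: measure_ge0. Qed.
Let lebR_sigma : @semi_sigma_additive _ R R lebR.
Proof. exact: (@measure_semi_sigma_additive _ _ _ leb). Qed.
HB.instance Definition _ := isMeasure.Build _ R _ lebR lebR0 lebR_ge0 lebR_sigma.

Let lebR_sigma_finite : @sigma_finite _ R _ setT lebR.
Proof. exact: (@sigma_finiteT _ _ _ leb). Qed.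
HB.instance Definition _ := @Measure_isSigmaFinite.Build _ R _ lebR lebR_sigma_finite.

Lemma cubes_cover n : \bigcup_k cube (const_mx (- k%:R) : 'rV[R]_n) (k.*2)%:R = setT.
Proof.
apply/seteqP; split=> // v _.
have [k hk] : exists k : nat, forall i, `|v ord0 i| <= k%:R.
  exists (\max_i (Num.truncn `|v ord0 i|).+1) => i.
  have /andP[_ h] := truncn_itv (normr_ge0 (v ord0 i)).
  apply: le_trans (ltW h) _; rewrite ler_nat.
  exact: (@leq_bigmax _ (fun i => (Num.truncn `|v ord0 i|).+1)).
exists k => // i; rewrite in_itv /= mxE -addnn natrD addKr.
by have := hk i; rewrite ler_norml.
Qed.

Let lebS_sigma_finite n : sigma_finite setT (lebS n).
Proof.
exists (fun k => cube (const_mx (- k%:R) : 'rV[R]_n) (k.*2)%:R).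
  by rewrite cubes_cover.
move=> k; split; first exact: measurable_cube.
by rewrite /lebS lebesgue_cube // ltry.
Qed.
HB.instance Definition _ n := @Measure_isSigmaFinite.Build _ _ _ (lebS n) (@lebS_sigma_finite n).

(** The sigma-algebra is generated by coordinates, not by open sets. Rounding the argument to a grid
    of mesh [1 / m.+1] makes [f] a function of countably many values on measurable pieces, and
    continuity gives the pointwise limit. *)
Lemma continuous_measurable_rV n (f : 'rV[R]_n -> R) :
  continuous f -> measurable_fun setT f.
Proof.
move=> cf.
pose h (m : nat) (x : 'rV[R]_n) : 'rV[int]_n := \row_i Num.floor (x ord0 i * m.+1%:R).
pose q (m : nat) (z : 'rV[int]_n) : 'rV[R]_n := \row_i ((z ord0 i)%:~R / m.+1%:R).
apply: (@measurable_fun_cvg _ _ _ _ (fun m x => f (q m (h m x)))).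
  move=> m _ A mA; rewrite setTI.
  pose B (k : nat) : set 'rV[R]_n := if (unpickle k : option 'rV[int]_n) is Some z
    then (if f (q m z) \in A then [set x | h m x = z] else set0) else set0.
  rewrite (_ : _ @^-1` _ = \bigcup_k B k).
    apply: bigcupT_measurable => k; rewrite /B; case: unpickle => [z|//].
    case: ifP => // _.
    rewrite (_ : [set x | _] = \bigcap_(i in [set: 'I_n])
       ((fun x : 'rV[R]_n => Num.floor (x ord0 i * m.+1%:R)) @^-1` [set z ord0 i])).
      apply: fin_bigcap_measurable => // i _.
      rewrite (_ : _ @^-1` _ = (fun x : 'rV[R]_n => x ord0 i * m.+1%:R) @^-1`
         `[(z ord0 i)%:~R, (z ord0 i + 1)%:~R[%classic).
        rewrite -[X in measurable X]setTI.
        have mf : measurable_fun setT (fun x : 'rV[R]_n => x ord0 i * m.+1%:R).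
          by apply: measurable_funM => //; exact: measurable_coor_rV.
        by apply: mf => //; exact: measurable_itv.
      apply/seteqP; split => x /=; rewrite in_itv /=.
        by move=> <-; exact: floor_itv.
      by move=> hx; apply/floor_def.
    apply/seteqP; split => x /=; first by move=> <- i _ /=; rewrite mxE.
    by move=> hx; apply/rowP => i; rewrite mxE; exact: (hx i I).
  apply/seteqP; split => x /=.
    by move=> Ax; exists (pickle (h m x)) => //; rewrite /B pickleK mem_set.
  move=> [k _]; rewrite /B; case: unpickle => [z|//].
  by case: ifP => // /set_mem Az /= ->.
move=> x _.
suff hq : (fun m => q m (h m x)) @ \oo --> x by exact: cvg_comp hq (cf x).
apply/cvgrPdist_le => e e0; near=> m.
apply: norm_le_coord; first exact: ltW.
move=> i; rewrite !mxE.
have m0 : (0 : R) < m.+1%:R by rewrite ltr0n.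
have /andP[f1 f2] := floor_itv (x ord0 i * m.+1%:R).
have -> : x ord0 i - (Num.floor (x ord0 i * m.+1%:R))%:~R / m.+1%:R
   = (x ord0 i * m.+1%:R - (Num.floor (x ord0 i * m.+1%:R))%:~R) / m.+1%:R.
  by rewrite mulrBl mulfK // gt_eqF.
rewrite ger0_norm; last by rewrite divr_ge0 ?subr_ge0 // ltW.
apply: (@le_trans _ _ (m.+1%:R^-1)).
  by rewrite ler_piMl ?invr_ge0 ?(ltW m0) // lerBlDl -intrD1 ltW // -intrD1.
apply: ltW; near: m; exact: (near_infty_natSinv_lt (PosNum e0)).
Unshelve. all: by end_near. Qed.

(** [lebR] is the push-forward of [leb] along the identity between two structures with the same
    measurable sets. *)
Lemma integral_lebR (D : set R) (f : R -> \bar R) :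
  measurable D -> measurable_fun [set: R] f -> leb.-integrable D f ->
  (\int[lebR]_(t in D) f t = \int[leb]_(t in D) f t)%E.
Proof.
move=> mD mf intf.
have mid : measurable_fun [set: measurableTypeR R] (idfun : measurableTypeR R -> R).
  by move=> _ A mA; rewrite setTI preimage_id; exact: mA.
exact: (@integral_pushforward _ _ (measurableTypeR R) R R idfun mid leb D f mf intf mD).
Qed.

Lemma cons_rV0 n (p : 'rV[R]_n * R) : cons_rV p ord0 ord0 = p.2 :> R.
Proof.
transitivity ((const_mx p.2 : 'rV[R]_1) ord0 ord0); last by rewrite mxE.
have <- := @row_mxEl R 1 1 n (const_mx p.2) p.1 ord0 ord0.
by congr (cons_rV p _ _); exact/val_inj.
Qed.

Lemma cons_rVS n (p : 'rV[R]_n * R) i : cons_rV p ord0 (lift ord0 i) = p.1 ord0 i :> R.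
Proof.
have <- := @row_mxEr R 1 1 n (const_mx p.2) p.1 ord0 i.
by congr (cons_rV p _ _); exact/val_inj.
Qed.

Lemma abse_integral_le d (T : measurableType d) (mu : {measure set T -> \bar R})
    (G : T -> \bar R) (A : set T) (M : R) :
  measurable A -> measurable_fun setT G -> 0 <= M ->
  (forall x, (`|G x| <= (M * \1_A x)%:E)%E) ->
  (`|\int[mu]_x G x| <= M%:E * mu A)%E.
Proof.
move=> mA mG M0 hG.
apply: le_trans (le_abse_integral _ measurableT mG) _.
apply: (@le_trans _ _ (\int[mu]_x (M * \1_A x)%:E)%E).
  apply: ge0_le_integral => //; first exact: measurableT_comp.
    by apply/measurable_EFinP; apply: measurable_funM => //; exact: measurable_indic.
under eq_integral do rewrite EFinM.
rewrite ge0_integralZl //; last by apply/measurable_EFinP; exact: measurable_indic.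
by rewrite integral_indic // setIT.
Qed.

Lemma integrable_cube n (F : 'rV[R]_n -> R) a s (K : R) : 0 <= s ->
  measurable_fun setT F -> (forall z, cube a s z -> `|F z| <= K) ->
  (lebesgue_rV R n).-integrable (cube a s) (EFin \o F).
Proof.
move=> s0 mF hF; apply: measurable_bounded_integrable.
- exact: measurable_cube.
- by rewrite lebesgue_cube // ltry.
- exact: measurable_funTS.
- by exists K; split; [exact: num_real|move=> x Kx z Dz /=; apply: le_trans (hF z Dz) (ltW Kx)].
Qed.

(** Fubini along one axis. As [lebesgue_rV] is built by adding coordinate 0, the induction peels
    that coordinate off until it is the axis [j]. One-dimensional cancellation thereby bounds
    integrals over cubes. *)
Lemma cube_slice_bound n (F : 'rV[R]_n -> R) a s (j : 'I_n) (K M : R) : 0 <= s ->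
  measurable_fun setT F -> (forall z, cube a s z -> `|F z| <= K) ->
  (forall z, cube a s z ->
    (`|\int[leb]_(t in `[a ord0 j, (a ord0 j + s)%R]) (F (upd z j t))%:E| <= M%:E)%E) ->
  (`|\int[lebesgue_rV R n]_(z in cube a s) (F z)%:E| <= (M * s ^+ n.-1)%:E)%E.
Proof.
elim: n F a j => [|n IH] F a j s0 mF hK hM; first by case: j {hM}.
have aD : cube a s a by move=> i; rewrite in_itv /= lexx lerDl.
have M0 : 0 <= M by rewrite -lee_fin; apply: le_trans (hM _ aD); exact: abse_ge0.
pose a' : 'rV[R]_n := \row_i a ord0 (lift ord0 i).
pose I := `[a ord0 ord0, (a ord0 ord0 + s)%R]%classic.
pose D := cube a s; pose phi := @cons_rV R n.
have mI : measurable I by exact: measurable_itv.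
have lI : lebR I = s%:E.
  rewrite /lebR /I lebesgue_measure_itv /= lte_fin ltrDl; have := s0.
  by rewrite le_eqVlt => /predU1P[<-|->]; rewrite ?ltxx // -EFinB addrAC subrr add0r.
have inD v t : D (phi (v, t)) <-> cube a' s v /\ I t.
  split=> [h|[h1 h2] i].
    by split=> [i|]; [have := h (lift ord0 i); rewrite cons_rVS /= mxE|have := h ord0; rewrite cons_rV0].
  case: (unliftP ord0 i) => [k ->|->]; last by rewrite cons_rV0.
  by rewrite cons_rVS; have := h1 k; rewrite mxE.
have mphi := @measurable_cons_rV R n.
have mD : measurable D by exact: measurable_cube.
have mphiD : measurable (phi @^-1` D) by rewrite -[X in measurable X]setTI; exact: mphi.
have mFphi : measurable_fun setT (F \o phi) by exact: measurableT_comp mF mphi.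
pose H := ((EFin \o (F \o phi)) \_ (phi @^-1` D)).
have iH0 : (lebS n \x lebR)%E.-integrable (phi @^-1` D) (EFin \o (F \o phi)).
  apply: measurable_bounded_integrable => //.
  - have h : (lebesgue_rV R n.+1 D < +oo)%E by rewrite lebesgue_cube // ltry.
    exact: h.
  - exact: measurable_funTS.
  by exists K; split; [exact: num_real|move=> x Kx z Dz /=; apply: le_trans (hK _ Dz) (ltW Kx)].
have iH : (lebS n \x lebR)%E.-integrable setT H.
  by apply: (iffLR (integrable_mkcond _ _)); [exact: mphiD|exact: iH0].
have -> : (\int[lebesgue_rV R n.+1]_(z in D) (F z)%:E = \int[lebS n \x lebR]_p H p)%E.
  rewrite -[RHS]integral_mkcond.
  have -> : (\int[lebesgue_rV R n.+1]_(z in D) (F z)%:E =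
     \int[pushforward (lebS n \x lebR) phi]_(z in D) (EFin \o F) z)%E by [].
  by rewrite integral_pushforward //; exact/measurable_EFinP.
have HE v t : H (v, t) = if `[< cube a' s v >] && `[< I t >] then (F (phi (v, t)))%:E else 0%E.
  rewrite /H patchE; case: ifPn; rewrite ?inE ?notin_setE => h.
    by have [/asboolT -> /asboolT ->] := (inD v t).1 h.
  by case: ifPn => // /andP[/asboolP h1 /asboolP h2]; exfalso; apply: h; exact/inD.
(* If [j] is one of the remaining axes, coordinate 0 is integrated last and the induction hypothesis
   bounds the inner integral; if [j] is coordinate 0, the inner integral is the given line
   integral. *)
case: (unliftP ord0 j) => [j' jE|j0].
  have n0 : n = n.-1.+1 by case: n {IH F a hK hM aD a' I D phi mI lI inD mphi mD mphiD mFphi H iH0 iH HE jE j mF} j' => // -[].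
  rewrite -(integral21_prod_meas1 iH).
  have -> : (M * s ^+ n.+1.-1)%:E = ((M * s ^+ n.-1)%:E * lebR I)%E.
    by rewrite lI -EFinM /= [X in _ ^+ X]n0 exprSr mulrA.
  apply: abse_integral_le => //; first exact: (measurable_fubini_G iH).
    by rewrite mulr_ge0 // exprn_ge0.
  move=> t; rewrite indicE; have [tI|tI] := boolP (t \in I); last first.
    rewrite mulr0 /fubini_G (eq_integral (fun=> 0%E)); first by rewrite integral0 abse0.
    move=> v _; rewrite HE; case: ifPn => // /andP[_ /asboolP h].
    by rewrite mem_set in tI.
  rewrite mulr1.
  have -> : fubini_G (lebS n) H t = (\int[lebesgue_rV R n]_(v in cube a' s) (F (phi (v, t)))%:E)%E.
    rewrite [RHS]integral_mkcond; apply: eq_integral => v _.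
    rewrite HE patchE; rewrite inE in tI; rewrite (asboolT tI) andbT.
    by case: asboolP => h; [rewrite mem_set|rewrite memNset].
  rewrite inE in tI.
  apply: (IH (fun v => F (phi (v, t))) a' j') => //.
  - have -> : (fun v => F (phi (v, t))) = (F \o phi) \o (fun v => (v, t)) by [].
    by apply: measurableT_comp => //; exact: measurable_pair2.
  - by move=> v hv; apply: hK; exact/inD.
  move=> v hv; rewrite [a' ord0 j']mxE -jE.
  have -> : (fun t0 => (F (phi (upd v j' t0, t)))%:E) =
      (fun t0 => (F (upd (phi (v, t)) j t0))%:E).
    apply/funext => t0; congr (F _)%:E; apply/rowP => i; rewrite [RHS]updE jE.
    case: (unliftP ord0 i) => [k ->|->]; last by rewrite (negbTE (neq_lift ord0 j')) /phi !cons_rV0.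
    by rewrite /phi !cons_rVS updE (inj_eq lift_inj).
  by apply: hM; exact/inD.
rewrite -(integral12_prod_meas1 iH).
have -> : (M * s ^+ n.+1.-1)%:E = (M%:E * lebS n (cube a' s))%E.
  by rewrite /lebS lebesgue_cube // -EFinM.
apply: abse_integral_le => //; first exact: measurable_cube.
  exact: (measurable_fubini_F iH).
move=> v; rewrite indicE; have [vI|vI] := boolP (v \in cube a' s); last first.
  rewrite mulr0 (_ : fubini_F _ _ _ = 0%E) ?abse0 // /fubini_F.
  rewrite (eq_integral (fun=> 0%E)) ?integral0 //.
  move=> t _; rewrite HE; case: ifPn => // /andP[/asboolP h _].
  by rewrite mem_set in vI.
rewrite mulr1; rewrite inE in vI.
have a0I : I (a ord0 ord0) by rewrite /I /= in_itv /= lexx lerDl.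
have := hM (phi (v, a ord0 ord0)) ((inD _ _).2 (conj vI a0I)); rewrite j0.
have -> : (fun t0 => (F (upd (phi (v, a ord0 ord0)) ord0 t0))%:E) =
    (fun t0 => (F (phi (v, t0)))%:E).
  apply/funext => t0; congr (F _)%:E; apply/rowP => i; rewrite [LHS]updE.
  by case: (unliftP ord0 i) => [k ->|->]; rewrite /phi ?cons_rVS ?cons_rV0.
have e : (fun t => H (v, t)) = (fun t => (F (phi (v, t)))%:E) \_ I.
  apply/funext => t; rewrite HE patchE (asboolT vI) /=.
  by case: asboolP => h; [rewrite mem_set|rewrite memNset].
have -> : fubini_F lebR H v = (\int[leb]_(t in I) (F (phi (v, t)))%:E)%E.
  rewrite /fubini_F e -integral_mkcond; apply: integral_lebR => //.
    apply/measurable_EFinP.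
    have -> : (fun t => F (phi (v, t))) = (F \o phi) \o (fun t => (v, t)) by [].
    by apply: measurableT_comp => //; exact: measurable_pair1.
  apply: (@measurable_bounded_integrable _ _ _ leb (fun t => F (phi (v, t)))) => //.
  - have h : (lebR I < +oo)%E by rewrite lI ltry.
    exact: h.
  - apply: measurable_funTS.
    have -> : (fun t => F (phi (v, t))) = (F \o phi) \o (fun t => (v, t)) by [].
    by apply: measurableT_comp => //; exact: measurable_pair1.
  exists K; split; [exact: num_real|move=> x Kx z Dz /=].
  by apply: le_trans (ltW Kx); apply: hK; exact/inD.
by apply.
Qed.

End lebesgue_rV_theory.

(** * Nonstationary phase in one variable *)

Section nonstationary_phase_1d.
Context {R : realType}.
Local Notation leb := (@lebesgue_measure R).
Implicit Types (f F : R -> R) (a b t : R).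

Lemma is_derive_cont f df t : is_derive t (1 : R) f df -> {for t, continuous f}.
Proof.
by move=> h; apply: differentiable_continuous; apply/derivable1_diffP; exact: ex_derive.
Qed.

Lemma continuous_itv_integrable f a b :
  (forall t, a <= t <= b -> {for t, continuous f}) ->
  leb.-integrable `[a, b] (EFin \o f).
Proof.
move=> cf; apply: continuous_compact_integrable; first exact: segment_compact.
apply: continuous_in_subspaceT => t /set_mem /=; rewrite in_itv /=; exact: cf.
Qed.

Lemma Rintegral_derive F f a b : a < b ->
  (forall t, a <= t <= b -> is_derive t (1 : R) F (f t)) ->
  (forall t, a <= t <= b -> {for t, continuous f}) ->
  \int[leb]_(t in `[a, b]) f t = F b - F a.
Proof.
move=> ab dF cf; rewrite /Rintegral (@continuous_FTC2 _ f F) //.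
- apply: continuous_in_subspaceT => t /set_mem /=; rewrite in_itv /=; exact: cf.
- split.
  + move=> t; rewrite in_itv /= => /andP[/ltW at_ /ltW tb].
    by apply: ex_derive; apply: dF; rewrite at_ tb.
  + by apply: cvg_at_right_filter; apply: (is_derive_cont (dF _ _)); rewrite lexx ltW.
  + by apply: cvg_at_left_filter; apply: (is_derive_cont (dF _ _)); rewrite lexx ltW.
- move=> t; rewrite in_itv /= => /andP[/ltW at_ /ltW tb].
  by rewrite derive1E; apply: derive_val; apply: dF; rewrite at_ tb.
Qed.

Lemma is_deriveD_fun f g (t df dg : R) : is_derive t (1 : R) f df ->
  is_derive t (1 : R) g dg -> is_derive t (1 : R) (fun s => f s + g s) (df + dg).
Proof. exact: is_deriveD. Qed.

Lemma is_deriveM_fun f g (t df dg : R) : is_derive t (1 : R) f df ->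
  is_derive t (1 : R) g dg ->
  is_derive t (1 : R) (fun s => f s * g s) (df * g t + f t * dg).
Proof.
move=> hf hg; have := is_deriveM hf hg.
have -> // : f t *: dg + g t *: df = df * g t + f t * dg.
by rewrite addrC /GRing.scale /= [g t * _]mulrC.
Qed.

Lemma is_deriveV_fun f (t df : R) : f t != 0 -> is_derive t (1 : R) f df ->
  is_derive t (1 : R) (fun s => (f s)^-1) (- df * (f t) ^- 2).
Proof.
move=> f0 hf; apply: DeriveDef; first by apply: derivableV => //; exact: ex_derive.
by rewrite (deriveV f0 (@ex_derive _ _ _ _ _ _ _ hf)) derive_val /GRing.scale /= mulrC mulNr mulrN.
Qed.

Section bounded_derivatives.
Context {I : Type}.
Implicit Types (D : I -> R -> Prop) (u v w : I -> R -> R) (k : nat).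

(** Derivatives are given existentially, so products and inverses need no closed formula. *)
Fixpoint bdd D k u : Prop :=
  (exists C : R, forall p t, D p t -> `|u p t| <= C) /\
  match k with
  | 0 => True
  | k'.+1 => exists2 u', forall p t, D p t -> is_derive t (1 : R) (u p) (u' p t)
               & bdd D k' u'
  end.

Lemma bddW D k u : bdd D k.+1 u -> bdd D k u.
Proof.
elim: k u => [|k IH] u; first by case.
by move=> [hb [u' du hu]]; split=> //; exists u' => //; exact: IH.
Qed.

Lemma bdd0 D k u : bdd D k u -> exists C : R, forall p t, D p t -> `|u p t| <= C.
Proof. by case: k => [|k] []. Qed.

Lemma bddD D k u v : bdd D k u -> bdd D k v -> bdd D k (fun p t => u p t + v p t).
Proof.
have h0 u1 v1 : (exists C : R, forall p t, D p t -> `|u1 p t| <= C) ->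
   (exists C : R, forall p t, D p t -> `|v1 p t| <= C) ->
   exists C : R, forall p t, D p t -> `|u1 p t + v1 p t| <= C.
  move=> [A hA] [B hB]; exists (A + B) => p t Dt.
  by apply: le_trans (ler_normD _ _) _; apply: lerD; [exact: hA|exact: hB].
elim: k u v => [|k IH] u v [hu du] [hv dv]; split=> //; do ?exact: h0.
move: du dv => [u' du hu'] [v' dv hv'].
exists (fun p t => u' p t + v' p t); last exact: IH.
by move=> p t Dt; apply: is_deriveD_fun; [exact: du|exact: dv].
Qed.

Lemma bddM D k u v : bdd D k u -> bdd D k v -> bdd D k (fun p t => u p t * v p t).
Proof.
have h0 u1 v1 : (exists C : R, forall p t, D p t -> `|u1 p t| <= C) ->
   (exists C : R, forall p t, D p t -> `|v1 p t| <= C) ->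
   exists C : R, forall p t, D p t -> `|u1 p t * v1 p t| <= C.
  move=> [A hA] [B hB]; exists (A * B) => p t Dt.
  by rewrite normrM; apply: ler_pM => //; [exact: hA|exact: hB].
elim: k u v => [|k IH] u v hu0 hv0; have [hu du] := hu0; have [hv dv] := hv0.
  by split=> //; exact: h0.
split; first exact: h0.
move: du dv => [u' du hu'] [v' dv hv'].
exists (fun p t => u' p t * v p t + u p t * v' p t).
  by move=> p t Dt; apply: is_deriveM_fun; [exact: du|exact: dv].
by apply: bddD; apply: IH => //; exact: bddW.
Qed.

Lemma bdd_cst D k (c : I -> R) : (exists C : R, forall p, `|c p| <= C) ->
  bdd D k (fun p _ => c p).
Proof.
elim: k c => [|k IH] c [C hC]; (split; first by exists C => p t _); first by [].
exists (fun _ _ => 0); first by move=> p t _; exact: is_derive_cst.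
by apply: IH; exists 0 => _; rewrite normr0.
Qed.

Lemma bddV D k u (c : R) : 0 < c -> (forall p t, D p t -> c <= `|u p t|) ->
  bdd D k u -> bdd D k (fun p t => (u p t)^-1).
Proof.
move=> c0 hc.
have h0 : exists C : R, forall p t, D p t -> `|(u p t)^-1| <= C.
  exists c^-1 => p t Dt; have h := hc p t Dt; have u0 := lt_le_trans c0 h.
  by rewrite normrV ?unitfE -?normr_gt0 // lef_pV2.
elim: k => [|k IH] hu; first by split.
split=> //; have [_ [u' du hu']] := hu.
exists (fun p t => (-1) * u' p t * ((u p t)^-1 * (u p t)^-1)).
  move=> p t Dt; rewrite mulN1r -invfM -expr2; apply: is_deriveV_fun; last exact: du.
  by rewrite -normr_gt0; apply: lt_le_trans c0 (hc _ _ Dt).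
apply: bddM; last by apply: bddM; apply: IH; exact: bddW.
by apply: bddM => //; apply: bdd_cst; exists 1 => _; rewrite normrN1.
Qed.

Lemma bdd_cont D k u p t : bdd D k.+1 u -> D p t -> {for t, continuous (u p)}.
Proof. by move=> [_ [u' du _]] Dt; exact: is_derive_cont (du _ _ Dt). Qed.

(** A polynomial instead of a smooth cutoff: finitely many integrations by parts require only a zero
    of finite order at both ends of [[a, a + s]]. *)
Definition bump (s a t : R) := (t - a) * (a + s - t).

Let dbump s a t : is_derive t (1 : R) (bump s a) (a + s - t - (t - a)).
Proof.
have -> : a + s - t - (t - a) = (1 + 0) * (a + s - t) + (t - a) * (0 - 1).
  by rewrite addr0 mul1r sub0r mulrN1.
by apply: is_deriveM_fun.
Qed.

(* Integration by parts against [cos (lam * rho + th)]; the factor [bump ^+ N]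
   kills the boundary terms. *)
Lemma nonstationary_phase (a : I -> R) (s : R) (D : I -> R -> Prop)
    (rho rho' v : I -> R -> R) (c : R) (N : nat) :
  0 < s -> (forall p t, a p <= t <= a p + s -> D p t) ->
  (forall p t, D p t -> a p <= t <= a p + s) -> 0 < c ->
  (forall p t, D p t -> is_derive t (1 : R) (rho p) (rho' p t)) ->
  (forall p t, D p t -> c <= `|rho' p t|) ->
  bdd D N.+1 rho' -> bdd D N.+1 v ->
  exists C : R, forall p lam th, 0 < lam ->
    `|\int[leb]_(t in `[a p, a p + s])
        (cos (lam * rho p t + th) * (bump s (a p) t ^+ N * v p t))| <= C / lam ^+ N.
Proof.
move=> s0 hD hD' c0 drho hc; elim: N v => [|N IH] v brho bv.
  have [C hC] := bdd0 bv; exists (s * C) => p lam th lam0.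
  rewrite expr0 divr1; under eq_Rintegral do rewrite expr0 mul1r.
  have ccos t : D p t -> {for t, continuous (fun t => cos (lam * rho p t + th))}.
    move=> Dt; apply: (@continuous_comp _ _ _ (fun t => lam * rho p t + th) cos).
      apply: (@continuousD _ _ _ (fun t => lam * rho p t) (fun=> th)); last exact: cst_continuous.
      apply: (@continuousM _ _ (fun=> lam) (rho p)); first exact: cst_continuous.
      exact: is_derive_cont (drho _ _ Dt).
    exact: continuous_cos.
  have ci : leb.-integrable `[a p, a p + s] (EFin \o (fun t => cos (lam * rho p t + th) * v p t)).
    apply: continuous_itv_integrable => t /hD Dt.
    by apply: continuousM; [exact: ccos|exact: bdd_cont bv Dt].
  apply: le_trans (le_normr_Rintegral _ _) _ => //.
  apply: (@le_trans _ _ (\int[leb]_(t in `[a p, a p + s]) C)).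
    apply: le_Rintegral => //; first exact: integrable_norm ci.
      apply: continuous_itv_integrable => t _; exact: cst_continuous.
    move=> t /=; rewrite in_itv /= => /hD Dt; rewrite normrM.
    rewrite -[X in _ <= X]mul1r ler_pM //; last exact: hC.
    by rewrite ler_norml cos_geN1 cos_le1.
  have lI : leb `[a p, a p + s]%classic = s%:E.
    by rewrite lebesgue_measure_itv /= lte_fin ltrDl s0 -EFinB addrAC subrr add0r.
  rewrite Rintegral_cst // (_ : fine _ = s) 1?mulrC //.
  by rewrite -[RHS]/(fine s%:E); congr fine; exact: lI.
pose g p t := v p t * (rho' p t)^-1.
have bg : bdd D N.+2 g by apply: bddM => //; exact: bddV hc brho.
have [_ [g' dg bg']] := bg.
have bq : bdd D N.+1 (fun p t => bump s (a p) t).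
  split.
    exists (s * s) => p t Dt; have /andP[h1 h2] := hD' _ _ Dt.
    rewrite /bump normrM !ger0_norm ?subr_ge0 //; apply: ler_pM; rewrite ?subr_ge0 //.
      by rewrite lerBlDl.
    by move: h1 h2; lra.
  exists (fun p t => a p + s - t - (t - a p)); first by move=> p t _; exact: dbump.
  elim: N {IH brho bv g bg g' dg bg'} => [|N _].
    split=> //; exists (s + s) => p t Dt; have /andP[h1 h2] := hD' _ _ Dt.
    by rewrite ler_norml; apply/andP; split; lra.
  split.
    exists (s + s) => p t Dt; have /andP[h1 h2] := hD' _ _ Dt.
    by rewrite ler_norml; apply/andP; split; lra.
  exists (fun _ _ => - 1 - 1); last by apply: bdd_cst; exists (1 + 1) => _; rewrite -opprD normrN ger0_norm.
  move=> p t _; have -> : - 1 - 1 = (0 - 1) - (1 - 0) :> R by rewrite sub0r subr0.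
  exact: (is_deriveB (is_deriveB (is_derive_cst (a p + s) t (1 : R)) (is_derive_id _ _))
    (is_deriveB (is_derive_id _ _) (is_derive_cst (a p) t (1 : R)))).
have bq' : bdd D N.+1 (fun p t => a p + s - t - (t - a p)).
  split.
    exists (s + s) => p t Dt; have /andP[h1 h2] := hD' _ _ Dt.
    by rewrite ler_norml; apply/andP; split; lra.
  exists (fun _ _ => - 1 - 1); last by apply: bdd_cst; exists (1 + 1) => _; rewrite -opprD normrN ger0_norm.
  move=> p t _; have -> : - 1 - 1 = (0 - 1) - (1 - 0) :> R by rewrite sub0r subr0.
  exact: (is_deriveB (is_deriveB (is_derive_cst (a p + s) t (1 : R)) (is_derive_id _ _))
    (is_deriveB (is_derive_id _ _) (is_derive_cst (a p) t (1 : R)))).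
(* The derivative of [bump ^+ N.+1 * g] with [bump ^+ N] factored out: the amplitude left by one
   integration by parts. *)
pose v2 p t := N.+1%:R * ((a p + s - t - (t - a p)) * g p t) + bump s (a p) t * g' p t.
have bv2 : bdd D N.+1 v2.
  apply: bddD; last exact: bddM.
  apply: bddM; last by apply: bddM => //; exact: bddW.
  by apply: bdd_cst; exists N.+1%:R => _; rewrite ger0_norm.
have [C hC] := IH v2 (bddW brho) bv2.
exists C => p lam th lam0.
pose ps t := lam * rho p t + th.
pose W t := sin (ps t) * (bump s (a p) t ^+ N.+1 * g p t).
have dps t : D p t -> is_derive t (1 : R) ps (lam * rho' p t).
  move=> Dt; have -> : lam * rho' p t = (0 * rho p t + lam * rho' p t) + 0 by rewrite mul0r add0r addr0.
  exact: (is_deriveD_fun (is_deriveM_fun (is_derive_cst lam t (1 : R)) (drho p t Dt))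
    (is_derive_cst th t (1 : R))).
have dqn t : is_derive t (1 : R) (fun t => bump s (a p) t ^+ N.+1)
   (N.+1%:R * bump s (a p) t ^+ N * (a p + s - t - (t - a p))).
  have h := is_deriveX N.+1 (dbump s (a p) t).
  by rewrite exprfctE in h; exact: h.
pose A t := cos (ps t) * (bump s (a p) t ^+ N.+1 * v p t).
(* The sine is written as a shifted cosine so that the induction hypothesis applies with another
   [th]. *)
pose B t := cos (ps t + - (pi / 2)) * (bump s (a p) t ^+ N * v2 p t).
have dW t : D p t -> is_derive t (1 : R) W (lam * A t + B t).
  move=> Dt; have r0 : rho' p t != 0 by rewrite -normr_gt0; apply: lt_le_trans c0 (hc _ _ Dt).
  have -> : lam * A t + B t = (cos (ps t) * (lam * rho' p t)) * (bump s (a p) t ^+ N.+1 * g p t)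
     + sin (ps t) * (N.+1%:R * bump s (a p) t ^+ N * (a p + s - t - (t - a p)) * g p t
         + bump s (a p) t ^+ N.+1 * g' p t).
    rewrite /A /B cosBpihalf /v2 /g exprS.
    by field.
  exact: (is_deriveM_fun (is_derive1_comp (is_derive_sin (ps t)) (dps t Dt))
    (is_deriveM_fun (dqn t) (dg p t Dt))).
have cps t : D p t -> {for t, continuous ps} by move=> Dt; exact: is_derive_cont (dps _ Dt).
have cA t : D p t -> {for t, continuous A}.
  move=> Dt; apply: continuousM.
    by apply: (@continuous_comp _ _ _ ps cos); [exact: cps|exact: continuous_cos].
  apply: continuousM; first exact: is_derive_cont (dqn t).
  exact: bdd_cont bv Dt.
have cB t : D p t -> {for t, continuous B}.
  move=> Dt; apply: continuousM.
    apply: (@continuous_comp _ _ _ (fun t => ps t + - (pi / 2)) cos); last exact: continuous_cos.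
    by apply: (@continuousD _ _ _ ps (fun=> _)); [exact: cps|exact: cst_continuous].
  apply: continuousM; last exact: bdd_cont bv2 Dt.
  have h := is_deriveX N (dbump s (a p) t).
  by rewrite exprfctE in h; exact: is_derive_cont h.
have iA := continuous_itv_integrable (fun t ht => cA t (hD p t ht)).
have iB := continuous_itv_integrable (fun t ht => cB t (hD p t ht)).
(* [W] is a primitive that vanishes at both ends; solving for the integral of [A] gains the factor
   [lam^-1]. *)
have IA : \int[leb]_(t in `[a p, a p + s]) (lam * A t + B t) = 0.
  have W0 t : bump s (a p) t = 0 -> W t = 0.
    by move=> e; rewrite /W e expr0n /= mul0r mulr0.
  have -> : \int[leb]_(t in `[a p, a p + s]) (lam * A t + B t) = W (a p + s) - W (a p).
    apply: Rintegral_derive; first by rewrite ltrDl.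
      by move=> t /hD; exact: dW.
    move=> t /hD Dt; apply: continuousD; last exact: cB.
    by apply: (@continuousM _ _ (fun=> lam) A); [exact: cst_continuous|exact: cA].
  by rewrite !W0 ?subrr // /bump subrr ?mulr0 ?mul0r.
have iZ : leb.-integrable `[a p, a p + s] (EFin \o (fun t => lam * A t)).
  apply: continuous_itv_integrable => t /hD Dt.
  by apply: (@continuousM _ _ (fun=> lam) A); [exact: cst_continuous|exact: cA].
move: IA; rewrite RintegralD // RintegralZl // => IA.
have -> : \int[leb]_(t in `[a p, a p + s]) A t =
    - (lam^-1 * \int[leb]_(t in `[a p, a p + s]) B t).
  move/eqP: IA; rewrite addr_eq0 => /eqP e.
  by apply: (mulfI (lt0r_neq0 lam0)); rewrite e mulrN mulrA mulfV ?lt0r_neq0 // mul1r.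
have li0 : 0 <= lam^-1 by rewrite invr_ge0 ltW.
rewrite normrN normrM (ger0_norm li0).
have -> : C / lam ^+ N.+1 = lam^-1 * (C / lam ^+ N) by rewrite exprS invfM mulrCA.
apply: ler_wpM2l => //.
have := hC p lam (th - pi / 2) lam0; congr (`| _ | <= _).
by apply: eq_Rintegral => t _; rewrite /B /ps addrA.
Qed.

End bounded_derivatives.

End nonstationary_phase_1d.

(** * Substitutions that relabel or fix coordinates *)

Section coordinate_substitution.
Context {R : realType} {m n : nat} (sg : 'I_m -> 'I_n) (E : 'rV[R]_m -> 'rV[R]_n).
Hypothesis E_upd : forall z i t, E (upd z i t) = upd (E z) (sg i) t.
Hypothesis E_coord : forall k, (exists i, forall z, E z ord0 k = z ord0 i) \/
  (forall z w, E z ord0 k = E w ord0 k).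
Implicit Types f : 'rV[R]_n -> R.

Let continuous_E : continuous E.
Proof.
move=> x A /nbhs_ballP[e /= e0 hA]; apply/nbhs_ballP; exists e => //= y [_ h].
apply: hA; split=> // a b; rewrite ord1.
have [[i hi]|hc] := E_coord b; first by rewrite !hi.
by rewrite (hc x y); exact: ballxx.
Qed.

Lemma partial_subst f i z : derivable f (E z) (delta_mx ord0 (sg i)) ->
  derivable (fun w => f (E w)) z (delta_mx ord0 i) /\
  partial i (fun w => f (E w)) z = partial (sg i) f (E z).
Proof.
move=> df; apply: slice_is_derive.
have -> : (fun s => f (E (upd z i s))) = (fun s => f (upd (E z) (sg i) s)).
  by apply/funext => s; rewrite E_upd.
have e0 : upd (E z) (sg i) (z ord0 i) = E z by rewrite -E_upd upd_id.
by rewrite -{2}e0; apply: is_derive_slice; rewrite e0.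
Qed.

Let partial_substE f i : C_infty f ->
  partial i (fun w => f (E w)) = (fun w => partial (sg i) f (E w)).
Proof.
move=> Cf; apply/funext => z.
by have [_ ->] := partial_subst (C_infty_derivable (sg i) (E z) Cf).
Qed.

Lemma C_infty_subst f : C_infty f -> C_infty (fun z => f (E z)).
Proof.
move=> Cf k; elim: k f Cf => [|k IH] f Cf.
  by move=> x; apply: (@continuous_comp _ _ _ E f); [exact: continuous_E|exact: (C_infty_cont Cf)].
split; first by have := IH f Cf; case: k {IH} => [//|k []].
move=> i; split; first by move=> z; have [] := partial_subst (C_infty_derivable (sg i) (E z) Cf).
by rewrite partial_substE //; apply: IH; exact: C_infty_partial.
Qed.

Lemma iterp_subst f S : C_infty f ->
  iterp S (fun z => f (E z)) = (fun z => iterp (map sg S) f (E z)).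
Proof.
elim: S f => [//|i S IH] f Cf /=; rewrite partial_substE //.
by apply: IH; exact: C_infty_partial.
Qed.

End coordinate_substitution.

(** * Oscillation of phase differences *)

Section phase_kernel.
Context {R : realType} {d : nat}.
Implicit Types (phi : 'rV[R]_(d + d) -> R) (x xi b : 'rV[R]_d).
Local Notation leb := (@lebesgue_measure R).

Lemma row_mx_coord x xi k :
  row_mx x xi ord0 k = match fintype.split k with inl i => x ord0 i | inr i => xi ord0 i end.
Proof. by rewrite mxE. Qed.

Lemma row_mx_updl x xi i t : row_mx (upd x i t) xi = upd (row_mx x xi) (lshift d i) t.
Proof.
apply/rowP => k; rewrite updE !row_mx_coord; case: split_ordP => j ->.
  by rewrite updE (inj_eq (@lshift_inj _ _)).
by rewrite eq_sym eq_lrshift.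
Qed.

Lemma row_mx_updr x xi i t : row_mx x (upd xi i t) = upd (row_mx x xi) (rshift d i) t.
Proof.
apply/rowP => k; rewrite updE !row_mx_coord; case: split_ordP => j ->.
  by rewrite eq_lrshift.
by rewrite updE (inj_eq (@rshift_inj _ _)).
Qed.

Let rowl_coord xi k : (exists i, forall x, row_mx x xi ord0 k = x ord0 i) \/
  (forall x y, row_mx x xi ord0 k = row_mx y xi ord0 k).
Proof.
rewrite -(splitK k); case: (fintype.split k) => j.
  by left; exists j => x; rewrite row_mxEl.
by right=> x y; rewrite !row_mxEr.
Qed.

Let rowr_coord x k : (exists i, forall xi, row_mx x xi ord0 k = xi ord0 i) \/
  (forall xi y, row_mx x xi ord0 k = row_mx x y ord0 k).
Proof.
rewrite -(splitK k); case: (fintype.split k) => j.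
  by right=> xi y; rewrite !row_mxEl.
by left; exists j => xi; rewrite row_mxEr.
Qed.

Lemma C_infty_rowl phi xi : C_infty phi -> C_infty (fun x => phi (row_mx x xi)).
Proof. exact: (C_infty_subst (fun z i t => row_mx_updl z xi i t) (rowl_coord xi)). Qed.

Lemma C_infty_rowr phi x : C_infty phi -> C_infty (fun xi => phi (row_mx x xi)).
Proof. exact: (C_infty_subst (fun z i t => row_mx_updr x z i t) (rowr_coord x)). Qed.

Lemma fin_bound (T : finType) (P : T -> R -> Prop) :
  (forall i C C', C <= C' -> P i C -> P i C') -> (forall i, exists C, P i C) ->
  exists2 C, 0 <= C & forall i, P i C.
Proof.
move=> mono /choice[C hC]; exists (\sum_i `|C i|); first exact: sumr_ge0.
move=> i; apply: mono (hC i); rewrite (bigD1 i) //=; apply: le_trans (ler_norm _) _.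
by rewrite lerDl sumr_ge0.
Qed.

Lemma mixed_phase_bound phi S : mixed_phase phi -> has (predC is_x) S ->
  exists2 C, 0 <= C & forall (i : 'I_d) z, `|iterp S (partial (lshift d i) phi) z| <= C.
Proof.
move=> [_ h] hS; apply: (fin_bound (P := fun i C => forall z, `|iterp S (partial (lshift d i) phi) z| <= C)).
  by move=> i C C' CC' hC z; exact: le_trans (hC z) CC'.
move=> i; have [|C hC] := h (lshift d i :: S); last by exists C.
by rewrite /mixed /= hS orbT andbT /is_x /= ltn_ord.
Qed.

(** One more derivative in x turns [S] into a mixed word, so [iterp S phi] is Lipschitz in x
    uniformly in xi even where it is unbounded. *)
Lemma phase_lipschitz phi S : mixed_phase phi -> has (predC is_x) S ->
  exists2 C, 0 <= C & forall x x' xi,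
    `|iterp S phi (row_mx x xi) - iterp S phi (row_mx x' xi)| <= C * `|x - x'|.
Proof.
move=> hphi hS; have [C C0 hC] := mixed_phase_bound hphi hS.
have Cphi := hphi.1.
exists (d%:R * C); first by rewrite mulr_ge0.
move=> x x' xi.
have := lipschitz_path (B := C) (w := x') (z := x) (C_infty_rowl xi (C_infty_iterp S Cphi)).
move=> /(_ _) h; apply: le_trans (h _) _.
  move=> i v _ _.
  have [_ ->] := partial_subst (fun z i t => row_mx_updl z xi i t) (C_infty_derivable (lshift d i) (row_mx v xi) (C_infty_iterp S Cphi)).
  by rewrite partial_iterp.
apply: (@le_trans _ _ (\sum_(i < d) C * `|x - x'|)).
  apply: ler_sum => i _; apply: ler_wpM2l => //.
  by have := coord_le_norm (x - x') i; rewrite !mxE.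
by rewrite sumr_const card_ord -mulrA [d%:R * _]mulr_natl.
Qed.

(** The Jacobian of [x |-> grad_xi phi x xi] is the mixed Hessian, and all bounds used are uniform
    in [xi], hence so is [kappa]. *)
Lemma phase_expansion phi c : mixed_phase phi -> 0 < c ->
  (forall x xi, c <= `|\det (hess_x_xi phi x xi)|) ->
  exists2 kappa : R, 0 < kappa & forall x x' xi,
    `|x - x'| <= kappa * `|grad_xi phi x xi - grad_xi phi x' xi|.
Proof.
move=> hphi c0 hdet; have Cphi := hphi.1.
have hasr j : has (predC is_x) [:: rshift d j].
  by rewrite /= /is_x /= orbF -leqNgt leq_addr.
have [B B0 hB] : exists2 B, 0 <= B & forall (ij : 'I_d * 'I_d) z,
    `|partial (rshift d ij.2) (partial (lshift d ij.1) phi) z| <= B.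
  apply: (fin_bound (P := fun ij B => forall z, `|partial (rshift d ij.2) (partial (lshift d ij.1) phi) z| <= B)).
    by move=> i C C' CC' hC z; exact: le_trans (hC z) CC'.
  move=> [i j]; have [C _ hC] := mixed_phase_bound hphi (hasr j).
  by exists C => z; exact: hC.
have [B2 B20 hB2] : exists2 B, 0 <= B & forall (ijk : 'I_d * 'I_d * 'I_d) z,
    `|partial (lshift d ijk.2) (partial (rshift d ijk.1.2) (partial (lshift d ijk.1.1) phi)) z| <= B.
  apply: (fin_bound (P := fun ijk B => forall z, `|partial (lshift d ijk.2) (partial (rshift d ijk.1.2) (partial (lshift d ijk.1.1) phi)) z| <= B)).
    by move=> i C C' CC' hC z; exact: le_trans (hC z) CC'.
  move=> [[i j] k]; have [|C _ hC] := @mixed_phase_bound phi [:: rshift d j; lshift d k] hphi.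
    by rewrite /= /is_x /= -leqNgt leq_addr.
  by exists C => z; exact: hC.
have [kappa k0 hk] := hadamard_expansion (n := d) B0 B20 c0.
exists kappa => // x x' xi.
pose g j x := partial (rshift d j) phi (row_mx x xi).
have Cj j := C_infty_partial (rshift d j) Cphi.
have pg i j x0 : partial i (g j) x0 = partial (lshift d i) (partial (rshift d j) phi) (row_mx x0 xi).
  by have [_ ->] := partial_subst (fun z i t => row_mx_updl z xi i t) (C_infty_derivable (lshift d i) (row_mx x0 xi) (Cj j)).
have eg y : grad_xi phi y xi = rvec g y by [].
rewrite !eg; apply: hk.
- by move=> j; exact: C_infty_rowl.
- by move=> i j z; rewrite pg (partialC _ _ Cphi); exact: (hB (i, j)).
- move=> i j k z; have -> : partial i (g j) = fun z => partial (lshift d i) (partial (rshift d j) phi) (row_mx z xi).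
    by apply/funext => w; rewrite pg.
  have Cij := C_infty_partial (lshift d i) (Cj j).
  have [_ ->] := partial_subst (fun z i t => row_mx_updl z xi i t) (C_infty_derivable (lshift d k) (row_mx z xi) Cij).
  by rewrite (partialC (lshift d i) _ Cphi); exact: (hB2 (i, j, k)).
move=> z; have -> : jac g z = hess_x_xi phi z xi by apply/matrixP => i j; rewrite !mxE pg.
exact: hdet.
Qed.

(** A cutoff for [cube b h]: it vanishes to order [N] on the faces of the cube of side [3 * h]
    around it and is bounded below on the inner cube. *)
Definition box_weight (h : R) (N : nat) b (z : 'rV[R]_d) : R :=
  \prod_(i < d) bump (3 * h) (b ord0 i - h) (z ord0 i) ^+ N.

Lemma bdd_chain (I : Type) (D : I -> R -> Prop) (r : nat -> I -> R -> R) :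
  (forall k p t, D p t -> is_derive t (1 : R) (r k p) (r k.+1 p t)) ->
  (forall k, exists C : R, forall p t, D p t -> `|r k.+1 p t| <= C) ->
  forall N k, bdd D N (r k.+1).
Proof.
move=> dr hr; elim=> [|N IH] k; first by split.
by split=> //; exists (r k.+2) => // p t Dt; exact: dr.
Qed.

(** Divided by [|x - x'|], the phase difference has bounded xi-derivatives and, along some axis, a
    first derivative bounded below on the whole cube. So [|x - x'|] is the large parameter of
    [nonstationary_phase] along that axis. *)
Lemma kernel_decay phi c : mixed_phase phi -> 0 < c ->
  (forall x xi, c <= `|\det (hess_x_xi phi x xi)|) ->
  exists2 h0 : R, 0 < h0 & forall h N, 0 < h -> h <= h0 ->
  exists C : R, forall x x' b th, x != x' ->
    `|\int[lebesgue_rV R d]_(z in cube (b - const_mx h) (3 * h))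
      (cos (phi (row_mx x z) - phi (row_mx x' z) + th) * box_weight h N b z)|
    <= C / `|x - x'| ^+ N.
Proof.
move=> hphi c0 hdet; have Cphi := hphi.1.
have [kappa k0 hk] := phase_expansion hphi c0 hdet.
have hasr j (S : seq 'I_d) : has (predC is_x) (map (@rshift d d) (j :: S)).
  by rewrite /= /is_x /= -leqNgt leq_addr.
have [L L0 hL] : exists2 L, 0 <= L & forall (jk : 'I_d * 'I_d) x x' xi,
   `|iterp (map (@rshift d d) [:: jk.1; jk.2]) phi (row_mx x xi) -
     iterp (map (@rshift d d) [:: jk.1; jk.2]) phi (row_mx x' xi)| <= L * `|x - x'|.
  apply: (fin_bound (P := fun jk L => forall x x' xi,
   `|iterp (map (@rshift d d) [:: jk.1; jk.2]) phi (row_mx x xi) -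
     iterp (map (@rshift d d) [:: jk.1; jk.2]) phi (row_mx x' xi)| <= L * `|x - x'|)).
    by move=> i C C' CC' hC x x' xi; apply: le_trans (hC x x' xi) _; exact: ler_wpM2r.
  by move=> [j k]; have [C _ hC] := phase_lipschitz hphi (hasr j [:: k]); exists C.
(* For [h <= h0] the derivative along the chosen axis changes on the cube by at most half of its
   lower bound at [b]. *)
pose h0 := (4 * kappa * d%:R * L + 1)^-1.
have X0 : 0 <= 4 * kappa * d%:R * L by rewrite !mulr_ge0 // ltW.
have h00 : 0 < h0 by rewrite invr_gt0 ltr_wpDl.
exists h0 => // h N hpos hh0.
pose s : R := 3 * h.
have s0 : 0 < s by rewrite mulr_gt0.
(* All data are packed into one index, because [nonstationary_phase] yields a constant uniform over
   its index type; [j] is an axis along which the gradients differ most. *)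
pose cond (p : 'rV[R]_d * 'rV[R]_d * 'rV[R]_d * 'I_d * 'rV[R]_d) :=
  let: (x, x', b, j, z) := p in
  [/\ x != x', cube (b - const_mx h) s z &
   `|x - x'| <= kappa * `|(grad_xi phi x b - grad_xi phi x' b) ord0 j|].
pose I := {p | cond p}.
pose px (p : I) := (sval p).1.1.1.1. pose px' (p : I) := (sval p).1.1.1.2.
pose pb (p : I) := (sval p).1.1.2. pose pj (p : I) := (sval p).1.2.
pose pz (p : I) := (sval p).2.
pose lam (p : I) := `|px p - px' p|.
have hp (p : I) : [/\ px p != px' p, cube (pb p - const_mx h) s (pz p) &
   lam p <= kappa * `|(grad_xi phi (px p) (pb p) - grad_xi phi (px' p) (pb p)) ord0 (pj p)|].
  by rewrite /px /px' /pb /pj /pz /lam; case: p => [[[[[x x'] b] j] z] cp].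
have lam0 p : 0 < lam p by rewrite normr_gt0 subr_eq0; have [] := hp p.
pose a (p : I) := pb p ord0 (pj p) - h.
pose D (p : I) t := a p <= t <= a p + s.
(* The rescaled phase difference and its derivatives along axis [j]; order 0 may be large, higher
   orders are bounded. *)
pose r k (p : I) t :=
  (iterp (map (@rshift d d) (nseq k (pj p))) phi (row_mx (px p) (upd (pz p) (pj p) t))
  - iterp (map (@rshift d d) (nseq k (pj p))) phi (row_mx (px' p) (upd (pz p) (pj p) t)))
   / lam p.
have dr k p t : is_derive t (1 : R) (r k p) (r k.+1 p t).
  have dx x : is_derive t (1 : R)
     (fun t => iterp (map (@rshift d d) (nseq k (pj p))) phi (row_mx x (upd (pz p) (pj p) t)))
     (iterp (map (@rshift d d) (nseq k.+1 (pj p))) phi (row_mx x (upd (pz p) (pj p) t))).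
    rewrite /= -(partial_iterp _ _ Cphi) row_mx_updr.
    have -> : (fun t => iterp (map (@rshift d d) (nseq k (pj p))) phi (row_mx x (upd (pz p) (pj p) t)))
     = (fun t => iterp (map (@rshift d d) (nseq k (pj p))) phi (upd (row_mx x (pz p)) (rshift d (pj p)) t)).
      by apply/funext => u; rewrite row_mx_updr.
    by apply: is_derive_slice; apply: C_infty_derivable; exact: C_infty_iterp.
  have := is_deriveM_fun (is_deriveB (dx (px p)) (dx (px' p))) (is_derive_cst (lam p)^-1 t (1 : R)).
  by rewrite mulr0 addr0; exact.
have hr k : exists C : R, forall p t, D p t -> `|r k.+1 p t| <= C.
  have [C C0 hC] : exists2 C, 0 <= C & forall (j : 'I_d) x x' xi,
    `|iterp (map (@rshift d d) (nseq k.+1 j)) phi (row_mx x xi) -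
     iterp (map (@rshift d d) (nseq k.+1 j)) phi (row_mx x' xi)| <= C * `|x - x'|.
    apply: (fin_bound (P := fun j C => forall x x' xi,
    `|iterp (map (@rshift d d) (nseq k.+1 j)) phi (row_mx x xi) -
     iterp (map (@rshift d d) (nseq k.+1 j)) phi (row_mx x' xi)| <= C * `|x - x'|)).
      by move=> i C C' CC' hC x x' xi; apply: le_trans (hC x x' xi) _; exact: ler_wpM2r.
    by move=> j; have [C _ hC] := phase_lipschitz hphi (hasr j (nseq k j)); exists C.
  exists C => p t _; rewrite /r normrM (@ger0_norm _ (lam p)^-1) ?invr_ge0 ?(ltW (lam0 p)) //.
  by rewrite ler_pdivrMr //; exact: hC.
have cubeb (b : 'rV[R]_d) z : cube (b - const_mx h) s z -> `|z - b| <= 2 * h.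
  move=> hz; apply: norm_le_coord; first by rewrite mulr_ge0 // ltW.
  move=> i; have := hz i; rewrite in_itv /= !mxE /s ler_norml.
  by move=> /andP[h1 h2]; apply/andP; split; lra.
have updcube p t : D p t -> cube (pb p - const_mx h) s (upd (pz p) (pj p) t).
  move=> Dt i; rewrite updE; case: eqP => [->|_]; last by have [_ + _] := hp p; apply.
  by rewrite in_itv /= !mxE.
have lower p t : D p t -> (2 * kappa)^-1 <= `|r 1 p t|.
  move=> /updcube/cubeb hz; set z := upd _ _ _ in hz *.
  have [_ _ hgr] := hp p.
  pose f xi := phi (row_mx (px p) xi) - phi (row_mx (px' p) xi).
  pose g xi := partial (rshift d (pj p)) phi (row_mx (px p) xi) +
     (-1) * partial (rshift d (pj p)) phi (row_mx (px' p) xi).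
  have Cj := C_infty_partial (rshift d (pj p)) Cphi.
  have Cg : C_infty g.
    by apply: C_inftyD; [exact: C_infty_rowr|apply: C_inftyZ; exact: C_infty_rowr].
  have gb : g (pb p) = (grad_xi phi (px p) (pb p) - grad_xi phi (px' p) (pb p)) ord0 (pj p).
    by rewrite /g !mxE mulN1r.
  have gz : `|g z - g (pb p)| <= L * lam p * (d%:R * (2 * h)).
    have Lip := lipschitz_path (B := L * lam p) (w := pb p) (z := z) Cg.
    apply: le_trans (Lip _) _.
      move=> k v _ _; have dg x := C_infty_derivable k v (C_infty_rowr x Cj).
      have -> : partial k g v =
        iterp (map (@rshift d d) [:: pj p; k]) phi (row_mx (px p) v) -
        iterp (map (@rshift d d) [:: pj p; k]) phi (row_mx (px' p) v).
        rewrite /g (partialD (fun v => C_infty_derivable k v (C_infty_rowr (px p) Cj))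
         (fun v => C_infty_derivable k v (C_inftyZ (-1) (C_infty_rowr (px' p) Cj)))).
        rewrite (partialZ (-1) (fun v => C_infty_derivable k v (C_infty_rowr (px' p) Cj))).
        have P x : partial k (fun xi => partial (rshift d (pj p)) phi (row_mx x xi)) v =
           partial (rshift d k) (partial (rshift d (pj p)) phi) (row_mx x v).
          by have [_ ->] := partial_subst (fun z i t => row_mx_updr x z i t) (C_infty_derivable (rshift d k) (row_mx x v) Cj).
        by rewrite !P mulN1r.
      exact: (hL (pj p, k)).
    rewrite -mulr_sumr; apply: ler_wpM2l; first by rewrite mulr_ge0 // ltW.
    apply: (@le_trans _ _ (\sum_(i < d) (2 * h))).
      apply: ler_sum => i _; apply: le_trans hz.
      by have := coord_le_norm (z - pb p) i; rewrite !mxE.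
    by rewrite sumr_const card_ord [d%:R * _]mulr_natl.
  have r1 : r 1 p t = g z / lam p by rewrite /r /g mulN1r.
  rewrite r1 normrM (@ger0_norm _ (lam p)^-1) ?invr_ge0 ?(ltW (lam0 p)) //.
  rewrite ler_pdivlMr // invfM.
  have e1 : `|g (pb p)| <= `|g z| + `|g z - g (pb p)|.
    by rewrite -[X in `|X| <= _](subKr (g z)); exact: ler_normB.
  have e2 : L * lam p * (d%:R * (2 * h)) <= 2^-1 * kappa^-1 * lam p.
    have X1 : 4 * kappa * d%:R * L * h <= 1.
      have : (4 * kappa * d%:R * L + 1) * h <= 1.
        by rewrite -ler_pdivlMl ?mulr1 // ltr_wpDl.
      by rewrite mulrDl mul1r; move: hpos; lra.
    have kk : kappa^-1 * kappa = 1 by rewrite mulVf // gt_eqF.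
    have ki : 0 < kappa^-1 by rewrite invr_gt0.
    have -> : L * lam p * (d%:R * (2 * h)) = (kappa^-1 * kappa) * (2 * L * d%:R * h) * lam p.
      by rewrite kk; ring.
    apply: ler_wpM2r; first exact: ltW.
    rewrite -[kappa^-1 * kappa * _]mulrA [2^-1 * _]mulrC; apply: ler_wpM2l; first exact: ltW.
    by move: X1; lra.
  have e3 : kappa^-1 * lam p <= `|g (pb p)|.
    by rewrite mulrC ler_pdivrMr // mulrC gb.
  by move: e1 e2 e3 gz; lra.
(* The other factors of the weight are constant along axis [j]. *)
pose v (p : I) (t : R) := \prod_(i < d | i != pj p) bump (3 * h) (pb p ord0 i - h) (pz p ord0 i) ^+ N.
have bump_le (bi t : R) : bi - h <= t <= bi - h + s -> `|bump (3 * h) (bi - h) t| <= s * s.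
  move=> /andP[h1 h2]; rewrite /bump normrM !ger0_norm ?subr_ge0 //.
  by apply: ler_pM; rewrite ?subr_ge0 //; move: h1 h2; rewrite /s; lra.
have ss0 : 0 <= s * s by rewrite mulr_ge0 // ltW.
have hv k : bdd D k v.
  apply: bdd_cst; exists (\prod_(i < d) (1 + (s * s) ^+ N)) => p.
  have ge1 : 1 <= 1 + (s * s) ^+ N by rewrite lerDl exprn_ge0 // mulr_ge0 // ltW.
  have ge0 := le_trans ler01 ge1.
  rewrite [X in _ <= X](bigD1 (pj p)) //= normr_prod.
  apply: (@le_trans _ _ (\prod_(i < d | i != pj p) (1 + (s * s) ^+ N))); last first.
    by rewrite ler_peMl //; apply: prodr_ge0.
  apply: ler_prod => i _; rewrite normr_ge0 /= normrX.
  apply: (@le_trans _ _ ((s * s) ^+ N)); last by rewrite lerDr.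
  apply: lerXn2r; rewrite ?nnegrE //; apply: bump_le.
  by have [_ /(_ i) + _] := hp p; rewrite in_itv /= !mxE.
have [C hC] := nonstationary_phase (a := a) (s := s) (D := D) (rho := r 0%N) (rho' := r 1%N)
  (v := v) (N := N) s0 (fun p t h => h) (fun p t h => h) (ltac:(rewrite invr_gt0 mulr_gt0 //) : 0 < (2 * kappa)^-1)
  (fun p t _ => dr 0%N p t) lower (bdd_chain (fun k p t _ => dr k p t) hr N.+1 0%N) (hv N.+1).
exists (C * s ^+ d.-1) => x x' b th xx'.
have l0 : 0 < `|x - x'| by rewrite normr_gt0 subr_eq0.
(* The sup norm of the gradient difference is attained at some coordinate. *)
have [j hj] : exists j : 'I_d, `|x - x'| <= kappa * `|(grad_xi phi x b - grad_xi phi x' b) ord0 j|.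
  have [i hi] : exists i : 'I_d, `|grad_xi phi x b - grad_xi phi x' b| = `|(grad_xi phi x b - grad_xi phi x' b) ord0 i|.
    have nz : mx_norm (grad_xi phi x b - grad_xi phi x' b) != 0.
      have : 0 < kappa * `|grad_xi phi x b - grad_xi phi x' b| by exact: lt_le_trans (hk x x' b).
      by rewrite pmulr_rgt0 // => /lt0r_neq0.
    have [[u i] e] := mx_norm_neq0 nz.
    by exists i; rewrite {1}/Num.norm /= e ord1.
  by exists i; rewrite -hi; exact: hk.
pose F z := cos (phi (row_mx x z) - phi (row_mx x' z) + th) * box_weight h N b z.
have mF : measurable_fun setT F.
  apply: measurable_funM.
    apply: continuous_measurable_rV; apply: C_infty_cont; apply: C_infty_cos.
    have -> : (fun z => phi (row_mx x z) - phi (row_mx x' z)) =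
       (fun z => phi (row_mx x z) + (-1) * phi (row_mx x' z)).
      by apply/funext => z; rewrite mulN1r.
    by apply: C_inftyD; [exact: C_infty_rowr|apply: C_inftyZ; exact: C_infty_rowr].
  apply: measurable_prod => i _; apply: measurable_funX.
  have mi := measurable_coor_rV (T := R) i.
  by apply: measurable_funM; apply: measurable_funB => //; exact: measurable_cst.
have cos1 (u : R) : `|cos u| <= 1 by rewrite ler_norml cos_geN1 cos_le1.
have hF z : cube (b - const_mx h) s z -> `|F z| <= \prod_(i < d) (s * s) ^+ N.
  move=> hz; rewrite /F normrM -[X in _ <= X]mul1r; apply: ler_pM => //.
  rewrite /box_weight normr_prod; apply: ler_prod => i _; rewrite normr_ge0 /= normrX.
  apply: lerXn2r; rewrite ?nnegrE //; apply: bump_le.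
  by have := hz i; rewrite in_itv /= !mxE.
have s0' := ltW s0.
have := @cube_slice_bound R d F (b - const_mx h) s j _ (C / `|x - x'| ^+ N) s0' mF hF.
have iF : (lebesgue_rV R d).-integrable (cube (b - const_mx h) s) (EFin \o F).
  exact: integrable_cube s0' mF hF.
rewrite -EFin_normr_Rintegral //; last exact: measurable_cube.
rewrite lee_fin => hfin.
have -> : C * s ^+ d.-1 / `|x - x'| ^+ N = C / `|x - x'| ^+ N * s ^+ d.-1 by rewrite mulrAC.
apply: hfin => z hz.
pose p : I := exist _ (x, x', b, j, z) (And3 xx' hz hj).
have := hC p _ th l0.
have eF : (fun t => F (upd z j t)) =
   (fun t => cos (`|x - x'| * r 0%N p t + th) * (bump s (a p) t ^+ N * v p t)).
  apply/funext => t.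
  have -> : `|x - x'| * r 0%N p t = phi (row_mx x (upd z j t)) - phi (row_mx x' (upd z j t)).
    by rewrite mulrC; exact: (divfK (lt0r_neq0 l0)).
  rewrite /F.
  congr (_ * _); rewrite /box_weight (bigD1 j) //= updE eqxx; congr (_ * _).
  by apply: eq_bigr => i ij; rewrite updE (negbTE ij).
have -> : (b - const_mx h) ord0 j = a p by rewrite !mxE.
rewrite -eF => hI.
have mFu : measurable_fun setT (fun t => F (upd z j t)).
  have -> : (fun t => F (upd z j t)) = F \o upd z j by [].
  apply: measurableT_comp mF _; apply: measurable_fun_rV => i.
  have [ij|ij] := eqVneq i j.
    have -> : (fun t => upd z j t ord0 i) = idfun by apply/funext => t; rewrite updE ij eqxx.
    exact: measurable_id.
  have -> : (fun t => upd z j t ord0 i) = (fun=> z ord0 i).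
    by apply/funext => t; rewrite updE (negbTE ij).
  exact: measurable_cst.
have lI : leb `[a p, a p + s]%classic = s%:E.
  by rewrite lebesgue_measure_itv /= lte_fin ltrDl s0 -EFinB addrAC subrr add0r.
have iFu : leb.-integrable `[a p, a p + s] (EFin \o (fun t => F (upd z j t))).
  apply: (@measurable_bounded_integrable _ _ _ leb (fun t => F (upd z j t))) => //.
  - have hl : (leb `[a p, (a p + s)%R]%classic < +oo)%E by rewrite lI ltry.
    exact: hl.
  - exact: measurable_funTS.
  exists (\prod_(i < d) (s * s) ^+ N); split; [exact: num_real|move=> u Ku t Dt /=].
  apply: le_trans (ltW Ku); apply: hF; apply: (updcube p).
  by move: Dt; rewrite /= in_itv.
by rewrite -EFin_normr_Rintegral // lee_fin.
Qed.

End phase_kernel.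

(** * Schur's test on a lattice *)

Section lattice_sums.
Context {R : realType}.

Let pot (t : R) : R := t / (1 + `|t|).

Let pot_le1 t : `|pot t| <= 1.
Proof.
have h : 0 < 1 + `|t| by rewrite ltr_wpDr.
by rewrite /pot normrM normfV (gtr0_norm h) ler_pdivrMr // mul1r lerDr.
Qed.

(* The increments of the bounded function [t / (1 + |t|)] dominate the terms. *)
Lemma lattice_sum_1d (L a : nat) :
  \sum_(k < L) (1 + (a%:R - k%:R) ^+ 2)^-1 <= 6 :> R.
Proof.
have step (k : nat) : (1 + (a%:R - k%:R) ^+ 2)^-1 <=
    3 * (pot (k.+1%:R - a%:R) - pot (k%:R - a%:R)) :> R.
  have key (m : R) : 0 <= m -> 1 <= m \/ m = 0 ->
     (1 + m ^+ 2)^-1 <= 3 * (pot (m + 1) - pot m).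
    move=> m0 hm; rewrite /pot !ger0_norm ?addr_ge0 //.
    have d1 : 0 < 1 + m by rewrite ltr_wpDr.
    have d2 : 0 < 1 + (m + 1) by rewrite ltr_wpDr // addr_ge0.
    have -> : 3 * ((m + 1) / (1 + (m + 1)) - m / (1 + m)) = 3 / ((1 + m) * (1 + (m + 1))).
      by field; rewrite !gt_eqF.
    rewrite ler_pdivlMr ?mulr_gt0 // mulrC ler_pdivrMr ?ltr_wpDr ?sqr_ge0 //.
    by case: hm => [h|->]; nra.
  have key2 (m : R) : 1 <= m -> (1 + m ^+ 2)^-1 <= 3 * (pot (- (m - 1)) - pot (- m)).
    move=> m1; have m0 : 0 <= m by exact: le_trans m1.
    rewrite /pot !normrN !ger0_norm ?subr_ge0 //.
    have d1 : 0 < 1 + m by rewrite ltr_wpDr.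
    have d2 : 0 < 1 + (m - 1) by lra.
    have -> : 3 * (- (m - 1) / (1 + (m - 1)) - - m / (1 + m)) = 3 / ((1 + m) * (1 + (m - 1))).
      by field; rewrite !gt_eqF.
    rewrite ler_pdivlMr ?mulr_gt0 // mulrC ler_pdivrMr ?ltr_wpDr ?sqr_ge0 //.
    by nra.
  have [ak|ka] := leqP a k.
    have -> : k.+1%:R - a%:R = (k - a)%:R + 1 :> R by rewrite -addn1 natrD natrB // addrAC.
    have -> : k%:R - a%:R = (k - a)%:R :> R by rewrite natrB.
    have -> : (a%:R - k%:R) ^+ 2 = (k - a)%:R ^+ 2 :> R by rewrite natrB // -sqrrN opprB.
    apply: key => //; case: (k - a)%N => [|q]; [by right|left].
    by rewrite ler1n.
  have -> : k.+1%:R - a%:R = - ((a - k)%:R - 1) :> R.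
    by rewrite natrB ?(ltnW ka) // -addn1 natrD; ring.
  have -> : k%:R - a%:R = - (a - k)%:R :> R by rewrite natrB ?(ltnW ka) // opprB.
  have -> : a%:R - k%:R = (a - k)%:R :> R by rewrite natrB ?(ltnW ka).
  by apply: key2; rewrite ler1n subn_gt0.
apply: (@le_trans _ _ (\sum_(k < L) 3 * (pot (k.+1%:R - a%:R) - pot (k%:R - a%:R)))).
  by apply: ler_sum => k _; exact: step.
rewrite -mulr_sumr -(big_mkord xpredT (fun k : nat => pot (k.+1%:R - a%:R) - pot (k%:R - a%:R))).
rewrite (telescope_sumr (fun k : nat => pot (k%:R - a%:R))) //.
have := pot_le1 (L%:R - a%:R); have := pot_le1 (0%:R - a%:R).
by rewrite !ler_norml => /andP[? ?] /andP[? ?]; lra.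
Qed.

Lemma schur_bound (T : finType) (k : T -> T -> R) (c : T -> R) (M : R) :
  (forall l l', 0 <= k l l') -> (forall l l', k l l' = k l' l) ->
  (forall l, \sum_l' k l l' <= M) ->
  \sum_l \sum_l' `|c l| * `|c l'| * k l l' <= M * \sum_l c l ^+ 2.
Proof.
move=> k0 ks kM.
have amgm (x y : R) : `|x| * `|y| <= 2^-1 * (x ^+ 2 + y ^+ 2).
  rewrite -(real_normK (num_real x)) -(real_normK (num_real y)).
  by have := sqr_ge0 (`|x| - `|y|); lra.
apply: (@le_trans _ _ (\sum_l \sum_l' (2^-1 * (c l ^+ 2 * k l l') + 2^-1 * (c l' ^+ 2 * k l l')))).
  apply: ler_sum => l _; apply: ler_sum => l' _.
  apply: le_trans (ler_wpM2r (k0 _ _) (amgm _ _)) _.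
  by rewrite -mulrA mulrDl mulrDr.
have h : \sum_l \sum_l' 2^-1 * (c l ^+ 2 * k l l') <= 2^-1 * (M * \sum_l c l ^+ 2).
  rewrite mulr_sumr mulr_sumr; apply: ler_sum => l _.
  rewrite -mulr_sumr -mulr_sumr; apply: ler_wpM2l => //.
  by rewrite [M * _]mulrC; apply: ler_wpM2l; rewrite ?sqr_ge0.
under eq_bigr do rewrite big_split /=.
rewrite big_split /= [X in _ + X]exchange_big /=.
under [X in _ + X]eq_bigr do under eq_bigr do rewrite ks.
by have := h; lra.
Qed.

(** A product weight: its sum over the lattice factors into one-dimensional sums, each at most 6
    whatever [L]. *)
Definition lattice_weight d L (l l' : {ffun 'I_d -> 'I_L}) : R :=
  \prod_(i < d) (1 + ((l i)%:R - (l' i)%:R) ^+ 2)^-1.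

Lemma lattice_weight_sum d L (l : {ffun 'I_d -> 'I_L}) :
  \sum_l' lattice_weight l l' <= 6 ^+ d.
Proof.
rewrite /lattice_weight -(bigA_distr_bigA (fun (i : 'I_d) (k : 'I_L) => (1 + ((l i)%:R - k%:R) ^+ 2)^-1)) /=.
rewrite -[X in _ ^+ X]card_ord -prodr_const; apply: ler_prod => i _.
rewrite lattice_sum_1d andbT; apply: sumr_ge0 => k _.
by rewrite invr_ge0 addr_ge0 // sqr_ge0.
Qed.

Lemma lattice_weight_ge0 d L (l l' : {ffun 'I_d -> 'I_L}) : 0 <= lattice_weight l l'.
Proof. by apply: prodr_ge0 => i _; rewrite invr_ge0 addr_ge0 // sqr_ge0. Qed.

Lemma lattice_weight_sym d L (l l' : {ffun 'I_d -> 'I_L}) :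
  lattice_weight l l' = lattice_weight l' l.
Proof. by apply: eq_bigr => i _; rewrite -sqrrN opprB. Qed.

Definition lattice_point d L (x0 : 'rV[R]_d) (h : R) (l : {ffun 'I_d -> 'I_L}) : 'rV[R]_d :=
  \row_i (x0 ord0 i + h * (l i)%:R).

(** The distance [D] is at least [h] and at least [h] times each index difference [m], so [D ^+ 2]
    is at least [h ^+ 2 / 2 * (1 + m ^+ 2)]. The power [d.*2] supplies one such factor per
    coordinate. *)
Lemma lattice_dist d L x0 h (l l' : {ffun 'I_d -> 'I_L}) : 0 < h -> l != l' ->
  lattice_point x0 h l != lattice_point x0 h l' /\
  (`|lattice_point x0 h l - lattice_point x0 h l'| ^+ (d.*2))^-1 <=
    (2 / h ^+ 2) ^+ d * lattice_weight l l'.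
Proof.
move=> h0 ll'; set D := `|_ - _|.
have coordE i : (lattice_point x0 h l - lattice_point x0 h l') ord0 i =
    h * ((l i)%:R - (l' i)%:R) by rewrite !mxE; ring.
have hD i : h * `|(l i)%:R - (l' i)%:R| <= D.
  have := coord_le_norm (lattice_point x0 h l - lattice_point x0 h l') i.
  by rewrite coordE normrM (gtr0_norm h0).
have hDh : h <= D.
  have [i hi] : exists i, l i != l' i.
    apply/existsP; rewrite -negb_forall; apply: contra ll' => /forallP hl.
    by apply/eqP/ffunP => i; exact/eqP.
  apply: le_trans (hD i); rewrite ler_peMr ?(ltW h0) //.
  have ne : (l i : nat) != l' i by rewrite (inj_eq val_inj).
  case: (ltngtP (l i) (l' i)) ne => // lt _.
    by rewrite distrC -natrB ?(ltnW lt) // normr_nat ler1n subn_gt0.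
  by rewrite -natrB ?(ltnW lt) // normr_nat ler1n subn_gt0.
have D0 : 0 < D := lt_le_trans h0 hDh.
split; first by rewrite -subr_eq0 -normr_gt0.
have h20 : 0 < h ^+ 2 by rewrite exprn_gt0.
have -> : (D ^+ d.*2)^-1 = \prod_(i < d) (D ^+ 2)^-1.
  by rewrite prodr_const card_ord -muln2 mulnC exprM exprVn.
have -> : (2 / h ^+ 2) ^+ d = \prod_(i < d) (2 / h ^+ 2) by rewrite prodr_const card_ord.
rewrite -big_split /=; apply: ler_prod => i _; rewrite invr_ge0 sqr_ge0 /=.
set m := _%:R - _%:R; have m1 : 0 < 1 + m ^+ 2 by rewrite ltr_wpDr ?sqr_ge0.
have -> : 2 / h ^+ 2 * (1 + m ^+ 2)^-1 = (h ^+ 2 / 2 * (1 + m ^+ 2))^-1.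
  by rewrite [RHS]invfM [in RHS]invf_div.
have p1 : 0 < h ^+ 2 / 2 * (1 + m ^+ 2) by rewrite mulr_gt0 // divr_gt0.
have p2 : 0 < D ^+ 2 by rewrite exprn_gt0.
rewrite lef_pV2 ?posrE //.
have hm : h * `|m| <= D := hD i.
have hm2 : h ^+ 2 * m ^+ 2 <= D ^+ 2.
  rewrite -[m ^+ 2]real_normK ?num_real // -exprMn.
  by rewrite lerXn2r ?nnegrE ?mulr_ge0 ?(ltW h0) ?(ltW D0).
have hh2 : h ^+ 2 <= D ^+ 2 by rewrite lerXn2r ?nnegrE ?(ltW h0) ?(ltW D0).
by move: hm2 hh2; lra.
Qed.

End lattice_sums.

(** * The sampling inequality *)

Section sampling.
Context {R : realType} {d : nat}.
Implicit Types (phi : 'rV[R]_(d + d) -> R) (x xi b : 'rV[R]_d).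
Local Notation mu := (lebesgue_rV R d).

Lemma integrable_le (D : set 'rV[R]_d) (f g : 'rV[R]_d -> R) : measurable D ->
  measurable_fun D f -> mu.-integrable D (EFin \o g) ->
  (forall x, D x -> `|f x| <= g x) -> mu.-integrable D (EFin \o f).
Proof.
move=> mD mf ig fg; apply: le_integrable ig => //; first exact/measurable_EFinP.
move=> x Dx /=; rewrite lee_fin; apply: le_trans (fg x Dx) _; exact: ler_norm.
Qed.

Lemma integrable_scale (D : set 'rV[R]_d) (k : R) (f : 'rV[R]_d -> R) : measurable D ->
  mu.-integrable D (EFin \o f) -> mu.-integrable D (EFin \o (fun x => k * f x)).
Proof.
move=> mD h; rewrite (_ : EFin \o _ = (fun x => k%:E * (EFin \o f) x)%E) //.
exact: integrableZl.
Qed.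

Lemma integrable_add (D : set 'rV[R]_d) (f g : 'rV[R]_d -> R) : measurable D ->
  mu.-integrable D (EFin \o f) -> mu.-integrable D (EFin \o g) ->
  mu.-integrable D (EFin \o (fun x => f x + g x)).
Proof.
move=> mD hf hg; rewrite (_ : EFin \o _ = (EFin \o f) \+ (EFin \o g))%E //.
exact: integrableD.
Qed.

Lemma Rintegral_sum (T : finType) (D : set 'rV[R]_d) (f : T -> 'rV[R]_d -> R) : measurable D ->
  (forall i, mu.-integrable D (EFin \o f i)) ->
  mu.-integrable D (EFin \o (fun x => \sum_i f i x)) /\
  \int[mu]_(x in D) (\sum_i f i x) = \sum_i \int[mu]_(x in D) f i x.
Proof.
move=> mD hf.
have H (r : seq T) : mu.-integrable D (EFin \o (fun x => \sum_(i <- r) f i x)) /\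
  \int[mu]_(x in D) (\sum_(i <- r) f i x) = \sum_(i <- r) \int[mu]_(x in D) f i x.
  elim: r => [|i r [IH1 IH2]].
    have -> : (fun x => \sum_(i <- [::]) f i x) = (fun=> 0) by apply/funext => x; rewrite big_nil.
    split; first exact: integrable0.
    by rewrite big_nil /Rintegral integral0.
  have -> : (fun x => \sum_(j <- i :: r) f j x) = (fun x => f i x + \sum_(j <- r) f j x).
    by apply/funext => x; rewrite big_cons.
  split; first exact: integrable_add.
  by rewrite big_cons -IH2 RintegralD.
exact: H.
Qed.

Lemma integrable_cosM (th : 'rV[R]_d -> R) (g : 'rV[R]_d -> R) (D : set 'rV[R]_d) :
  measurable D -> measurable_fun setT th -> mu.-integrable D (EFin \o g) ->
  mu.-integrable D (EFin \o (fun x => g x * cos (th x))).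
Proof.
move=> mD mth ig; have /integrableP[/measurable_EFinP mg _] := ig.
apply: (@integrable_le _ _ (fun x => `|g x|)) => //.
- apply: measurable_funM => //; apply: measurable_funTS.
  apply: (measurableT_comp _ mth); apply: continuous_measurable_fun.
  exact: continuous_cos.
- exact: integrable_norm.
move=> x _; rewrite normrM -[X in _ <= X]mulr1 ler_pM //.
by rewrite ler_norml cos_geN1 cos_le1.
Qed.

(** By duality: with [cc l] the samples and [H] the sum of the [cc l * cos (P l)], the sum [E] of
    squares is the integral of [g * H], and almost orthogonality of the cosines bounds the integral
    of [H ^+ 2] over the cube by [C * E]. *)
Lemma sampling_estimate phi c : mixed_phase phi -> 0 < c ->
  (forall x xi, c <= `|\det (hess_x_xi phi x xi)|) ->
  exists2 h0 : R, 0 < h0 & forall h, 0 < h -> h <= h0 ->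
  exists2 C : R, 0 < C & forall L (x0 b : 'rV[R]_d) (tau : {ffun 'I_d -> 'I_L} -> R)
      (g : 'rV[R]_d -> R),
    measurable_fun setT g -> (forall z, ~ cube b h z -> g z = 0) ->
    mu.-integrable setT (EFin \o (fun z => g z ^+ 2)) ->
    \sum_l (\int[mu]_z (g z * cos (phi (row_mx (lattice_point x0 h l) z) + tau l))) ^+ 2
    <= C * \int[mu]_z (g z ^+ 2).
Proof.
move=> hphi c0 hdet; have Cphi := hphi.1.
have [h0 h00 hker] := kernel_decay hphi c0 hdet.
exists h0 => // h hpos hh0; have [K0 hK0] := hker h d.*2 hpos hh0.
pose K := `|K0|; have Kge0 : 0 <= K by exact: normr_ge0.
have pw0 : 0 <= (2 / h ^+ 2) ^+ d.
  by rewrite exprn_ge0 // divr_ge0 // exprn_ge0 // ltW.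
have hK x x' b th : x != x' ->
    `|\int[mu]_(z in cube (b - const_mx h) (3 * h))
      (cos (phi (row_mx x z) - phi (row_mx x' z) + th) * box_weight h d.*2 b z)|
    <= K / `|x - x'| ^+ d.*2.
  move=> xx'; apply: le_trans (hK0 x x' b th xx') _; apply: ler_wpM2r; last exact: ler_norm.
  by rewrite invr_ge0 exprn_ge0.
pose s : R := 3 * h; have s0 : 0 < s by rewrite mulr_gt0.
have ss0 : 0 <= s * s by rewrite mulr_ge0 // ltW.
pose om : R := \prod_(i < d) (h * h) ^+ d.*2.
have om0 : 0 < om by apply: prodr_gt0 => i _; rewrite exprn_gt0 // mulr_gt0.
pose Wm : R := \prod_(i < d) (s * s) ^+ d.*2.
have Wm0 : 0 <= Wm by apply: prodr_ge0 => i _; rewrite exprn_ge0 // mulr_ge0 // ltW.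
(* The first term serves the diagonal, where the kernel does not oscillate, the second the decay off
   the diagonal. *)
pose C1 := Wm * s ^+ d + K * (2 / h ^+ 2) ^+ d.
have C10 : 0 <= C1.
  apply: addr_ge0; first by rewrite mulr_ge0 // exprn_ge0 // ltW.
  exact: mulr_ge0.
pose C := om^-1 * (C1 * 6 ^+ d) + 1.
have C0 : 0 < C by rewrite ltr_wpDl // mulr_ge0 ?invr_ge0 ?(ltW om0) // mulr_ge0.
exists C => // L x0 b tau g mg gsupp ig2.
pose box := cube (b - const_mx h) s.
have mbox : measurable box by exact: measurable_cube.
have mcell : measurable (cube b h) by exact: measurable_cube.
have w_le z : box z -> `|box_weight h d.*2 b z| <= Wm.
  move=> hz; rewrite /box_weight normr_prod; apply: ler_prod => i _; rewrite normr_ge0 /= normrX.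
  apply: lerXn2r; rewrite ?nnegrE //.
  have := hz i; rewrite in_itv /= !mxE => /andP[h1 h2]; rewrite /bump normrM !ger0_norm ?subr_ge0 //.
  by apply: ler_pM; rewrite ?subr_ge0 //; move: h1 h2; rewrite /s; lra.
have w_ge0 z : box z -> 0 <= box_weight h d.*2 b z.
  move=> hz; apply: prodr_ge0 => i _; rewrite exprn_ge0 //.
  by have := hz i; rewrite in_itv /= !mxE => /andP[h1 h2]; rewrite mulr_ge0 ?subr_ge0.
have w_om z : cube b h z -> om <= box_weight h d.*2 b z.
  move=> hz; apply: ler_prod => i _; rewrite exprn_ge0 ?mulr_ge0 ?(ltW hpos) //=.
  have := hz i; rewrite in_itv /= => /andP[h1 h2].
  have b1 : h <= z ord0 i - (b ord0 i - h) by lra.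
  have b2 : h <= b ord0 i - h + 3 * h - z ord0 i by lra.
  apply: lerXn2r; rewrite ?nnegrE /bump ?mulr_ge0 ?(ltW hpos) //.
  - exact: le_trans (ltW hpos) b1.
  - exact: le_trans (ltW hpos) b2.
  by apply: ler_pM; rewrite ?(ltW hpos).
have cell_box z : cube b h z -> box z.
  by move=> hz i; have := hz i; rewrite !in_itv /= !mxE /s => /andP[h1 h2]; apply/andP; split; lra.
have mw : measurable_fun setT (box_weight h d.*2 b).
  apply: measurable_prod => i _; apply: measurable_funX.
  have mi := measurable_coor_rV (T := R) i.
  by apply: measurable_funM; apply: measurable_funB => //; exact: measurable_cst.
pose X (l : {ffun 'I_d -> 'I_L}) := lattice_point x0 h l.
pose P l z := phi (row_mx (X l) z) + tau l.
have mP l : measurable_fun setT (P l).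
  apply: measurable_funD; last exact: measurable_cst.
  by apply: continuous_measurable_rV; apply: C_infty_cont; exact: C_infty_rowr.
have mcos : measurable_fun setT (@cos R).
  by apply: continuous_measurable_fun; exact: continuous_cos.
have cos1 (u : R) : `|cos u| <= 1 by rewrite ler_norml cos_geN1 cos_le1.
have ig : mu.-integrable setT (EFin \o g).
  apply: (@integrable_le _ _ (fun z => \1_(cube b h) z + g z ^+ 2)) => //.
    have i1 : mu.-integrable setT (EFin \o \1_(cube b h)).
      apply/integrableP; split; first by apply/measurable_EFinP; exact: measurable_indic.
      rewrite (eq_integral (fun x => (\1_(cube b h) x)%:E)); last first.
        by move=> t _; rewrite gee0_abs // lee_fin.
      by rewrite integral_indic // setIT lebesgue_cube ?ltry // ltW.
    exact: integrable_add.
  move=> z _; rewrite indicE; have [hz|hz] := boolP (z \in cube b h).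
    have := sqr_ge0 (`|g z| - 1); rewrite -(real_normK (num_real (g z))) /=.
    by have := sqr_ge0 (`|g z|); have := normr_ge0 (g z); lra.
  by rewrite notin_setE in hz; rewrite gsupp // normr0 expr0n /= addr0.
have igc l : mu.-integrable setT (EFin \o (fun z => g z * cos (P l z))).
  exact: integrable_cosM.
pose cc l := \int[mu]_z (g z * cos (P l z)).
pose H z := \sum_l cc l * cos (P l z).
have igcc l : mu.-integrable setT (EFin \o (fun z => cc l * (g z * cos (P l z)))).
  exact: (integrable_scale _ measurableT (igc l)).
pose E := \sum_l cc l ^+ 2.
have gHE : mu.-integrable setT (EFin \o (fun z => g z * H z)) /\ \int[mu]_z (g z * H z) = E.
  have [i1 i2] := Rintegral_sum measurableT igcc.
  have e : (fun z => \sum_l cc l * (g z * cos (P l z))) = (fun z => g z * H z).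
    by apply/funext => z; rewrite /H mulr_sumr; apply: eq_bigr => l _; rewrite mulrCA.
  rewrite -e; split => //; rewrite i2; apply: eq_bigr => l _.
  by rewrite (RintegralZl (cc l) measurableT (igc l)) -expr2.
have mH : measurable_fun setT H.
  apply: measurable_sum => l; apply: measurable_funM => //; exact: measurableT_comp mcos (mP l).
pose HC := \sum_l `|cc l|.
have Hb z : `|H z| <= HC.
  apply: le_trans (ler_norm_sum _ _ _) _; apply: ler_sum => l _.
  by rewrite normrM ler_piMr.
pose kk l l' z := cc l * cc l' * (cos (P l z - P l' z) * box_weight h d.*2 b z).
have ik l l' : mu.-integrable box (EFin \o kk l l').
  apply: (@integrable_cube _ _ _ _ _ (`|cc l * cc l'| * Wm)); first exact: ltW.
    apply: measurable_funM => //; apply: measurable_funM => //.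
    by apply: (measurableT_comp mcos); exact: measurable_funB.
  move=> z hz; rewrite /kk normrM; apply: ler_wpM2l => //.
  by rewrite normrM -[X in _ <= X]mul1r; apply: ler_pM => //; exact: w_le.
have sum_le : \int[mu]_(z in box) (\sum_l \sum_l' kk l l' z) <= (C1 * 6 ^+ d) * E.
  have ik2 l : mu.-integrable box (EFin \o (fun z => \sum_l' kk l l' z)).
    by have [] := Rintegral_sum mbox (ik l).
  rewrite (Rintegral_sum mbox ik2).2.
  apply: (@le_trans _ _ (\sum_l \sum_l' `|cc l| * `|cc l'| * (C1 * lattice_weight l l'))).
    apply: ler_sum => l _; rewrite (Rintegral_sum mbox (ik l)).2; apply: ler_sum => l' _.
    have i0 : mu.-integrable box (EFin \o (fun z => cos (P l z - P l' z) * box_weight h d.*2 b z)).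
      apply: (@integrable_cube _ _ _ _ _ Wm); first exact: ltW.
        apply: measurable_funM => //.
        by apply: (measurableT_comp mcos); exact: measurable_funB.
      by move=> z hz; rewrite normrM -[X in _ <= X]mul1r; apply: ler_pM => //; exact: w_le.
    rewrite (RintegralZl _ mbox i0); apply: le_trans (ler_norm _) _; rewrite normrM normrM.
    apply: ler_wpM2l; first by rewrite mulr_ge0.
    have [e|ll'] := eqVneq l l'.
      subst l'; apply: le_trans (le_normr_Rintegral _ _) _ => //.
      have -> : lattice_weight l l = 1 :> R.
        by apply: big1 => i _; rewrite subrr expr0n addr0 invr1.
      rewrite mulr1; apply: (@le_trans _ _ (\int[mu]_(z in box) Wm)).
        apply: le_Rintegral => //; first exact: integrable_norm.
          by apply: (@integrable_cube _ _ _ _ _ Wm); [exact: ltW|exact: measurable_cst|move=> z _; rewrite ger0_norm].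
        by move=> z hz; rewrite normrM -[X in _ <= X]mul1r; apply: ler_pM => //; exact: w_le.
      rewrite Rintegral_cst //.
      have -> : fine (mu box) = s ^+ d by rewrite /box lebesgue_cube ?(ltW s0).
      by rewrite lerDl; exact: mulr_ge0.
    have [XX hX] := lattice_dist x0 hpos ll'.
    have := hK _ _ b (tau l - tau l') XX.
    have -> : (fun z => cos (phi (row_mx (X l) z) - phi (row_mx (X l') z) + (tau l - tau l')) * box_weight h d.*2 b z)
       = (fun z => cos (P l z - P l' z) * box_weight h d.*2 b z).
      by apply/funext => z; rewrite /P opprD [X in cos X * _]addrACA.
    move=> /le_trans; apply; apply: (@le_trans _ _ (K * ((2 / h ^+ 2) ^+ d * lattice_weight l l'))).
      by apply: ler_wpM2l.
    rewrite mulrA; apply: ler_wpM2r; first exact: lattice_weight_ge0.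
    by rewrite lerDr mulr_ge0 // exprn_ge0 // ltW.
  apply: (@schur_bound _ _ (fun l l' => C1 * lattice_weight l l')).
  - by move=> l l'; rewrite mulr_ge0 // lattice_weight_ge0.
  - by move=> l l'; rewrite lattice_weight_sym.
  by move=> l; rewrite -mulr_sumr; apply: ler_wpM2l => //; exact: lattice_weight_sum.
have iH2 : mu.-integrable (cube b h) (EFin \o (fun z => H z ^+ 2)).
  apply: (@integrable_cube _ _ _ _ _ (HC ^+ 2)); first exact: ltW.
    exact: measurable_funX.
  by move=> z _; rewrite normrX lerXn2r ?nnegrE // (le_trans _ (Hb z)).
have H2_le : \int[mu]_(z in cube b h) (H z ^+ 2) <= C * E.
  have iK : mu.-integrable box (EFin \o (fun z => \sum_l \sum_l' kk l l' z)).
    have ik2 l : mu.-integrable box (EFin \o (fun z => \sum_l' kk l l' z)).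
      by have [] := Rintegral_sum mbox (ik l).
    by have [] := Rintegral_sum mbox ik2.
  (* Adding the square of the sine sum leaves only cosines of phase differences, which
     [kernel_decay] controls. *)
  pose S z := \sum_l cc l * sin (P l z).
  have KE z : \sum_l \sum_l' kk l l' z = (H z ^+ 2 + S z ^+ 2) * box_weight h d.*2 b z.
    rewrite !expr2 /H /S !big_distrlr /= -big_split /= mulr_suml; apply: eq_bigr => l _.
    rewrite -big_split /= mulr_suml; apply: eq_bigr => l' _.
    by rewrite /kk cosB; ring.
  have : om * \int[mu]_(z in cube b h) (H z ^+ 2) <= \int[mu]_(z in box) (\sum_l \sum_l' kk l l' z).
    rewrite -(RintegralZl om mcell iH2).
    rewrite [X in X <= _]Rintegral_mkcond [X in _ <= X]Rintegral_mkcond.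
    apply: le_Rintegral => //.
    - have := (integrable_mkcond _ mcell).1 (integrable_scale om mcell iH2).
      by congr (integrable _ _ _); apply/funext => z /=; rewrite !patchE; case: ifP.
    - have := (integrable_mkcond _ mbox).1 iK.
      by congr (integrable _ _ _); apply/funext => z /=; rewrite !patchE; case: ifP.
    move=> z _; rewrite !patchE KE.
    have HS0 : 0 <= H z ^+ 2 + S z ^+ 2 by rewrite addr_ge0 // sqr_ge0.
    case: ifPn => hz.
      rewrite inE in hz; rewrite mem_set; last exact: cell_box.
      rewrite mulrC; apply: ler_pM; rewrite ?sqr_ge0 ?(ltW om0) ?w_om //.
      by rewrite lerDl sqr_ge0.
    case: ifPn => // hz'; rewrite inE in hz'.
    by rewrite mulr_ge0 // w_ge0.
  move=> h1; have h2 := le_trans h1 sum_le.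
  have E0 : 0 <= E by apply: sumr_ge0 => l _; exact: sqr_ge0.
  apply: (@le_trans _ _ (om^-1 * (C1 * 6 ^+ d * E))); first by rewrite ler_pdivlMl.
  by rewrite mulrA; apply: ler_wpM2r => //; rewrite lerDl.
have [igH gH] := gHE.
(* Absorption: the term with [H] is at most half of [e] itself. *)
have fin (e q C' k : R) : 0 < C' -> e <= 2^-1 * (C' * q + C'^-1 * k) -> k <= C' * e -> e <= C' * q.
  move=> C'0 h1 h2; have : C'^-1 * k <= e by rewrite ler_pdivrMl.
  by lra.
apply: (fin _ _ _ (\int[mu]_(z in cube b h) (H z ^+ 2))) => //.
rewrite -/E -gH.
have iHr : mu.-integrable setT (EFin \o ((fun z => H z ^+ 2) \_ (cube b h))).
  have := (integrable_mkcond _ mcell).1 iH2.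
  by congr (integrable _ _ _); apply/funext => z /=; rewrite !patchE; case: ifP.
have i1 := integrable_scale C measurableT ig2.
have i2 := integrable_scale C^-1 measurableT iHr.
have i3 := integrable_add measurableT i1 i2.
have iR := integrable_scale 2^-1 measurableT i3.
have -> : 2^-1 * (C * \int[mu]_z (g z ^+ 2) + C^-1 * \int[mu]_(z in cube b h) (H z ^+ 2)) =
   \int[mu]_z (2^-1 * (C * g z ^+ 2 + C^-1 * ((fun z => H z ^+ 2) \_ (cube b h)) z)).
  rewrite (RintegralZl _ measurableT i3) (RintegralD measurableT i1 i2).
  rewrite (RintegralZl _ measurableT ig2) (RintegralZl _ measurableT iHr).
  by congr (_ * (_ + _ * _)); exact: Rintegral_mkcond.
apply: le_Rintegral => // z _; rewrite patchE; case: ifPn => hz.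
  have := sqr_ge0 (C * g z - H z); have Ci : 0 < C^-1 by rewrite invr_gt0.
  have CC : C^-1 * C = 1 by rewrite mulVf // gt_eqF.
  move=> h1; have h2 := mulr_ge0 (ltW Ci) h1.
  have e : C^-1 * (C * g z - H z) ^+ 2 = (C^-1 * C) * (C * g z ^+ 2) - 2 * (C^-1 * C) * (g z * H z) + C^-1 * H z ^+ 2.
    by ring.
  by move: h2; rewrite e CC; lra.
rewrite notin_setE in hz; rewrite gsupp // mul0r expr0n /= !mulr0 addr0 mulr0 //.
Qed.

End sampling.

(** * Summation by parts on a grid *)

Section hardy_krause.
Context {R : realType} {e n : nat} {P : finType}.
Variables (z : P -> 'rV[R]_e) (h : R).
Hypotheses (h0 : 0 < h) (n0 : (0 < n)%N).
Implicit Types (F : P -> 'rV[R]_e -> R) (M : P -> {ffun 'I_e -> 'I_n} -> R).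

Definition grid p (j : {ffun 'I_e -> 'I_n}) : 'rV[R]_e :=
  \row_i (z p ord0 i + h / n%:R * (j i)%:R).

Let node p i (m : nat) : R := z p ord0 i + h / n%:R * m%:R.

Let n0R : 0 < n%:R :> R. Proof. by rewrite ltr0n. Qed.

Let node_cube p i m w : (m <= n)%N -> cube (z p) h w -> cube (z p) h (upd w i (node p i m)).
Proof.
move=> mn hw k; rewrite updE; case: eqP => [->|_]; last exact: hw.
rewrite in_itv /= /node lerDl lerD2l mulr_ge0 ?divr_ge0 ?(ltW h0) //=.
by rewrite mulrAC ler_pdivrMr // ler_wpM2l ?(ltW h0) // ler_nat.
Qed.

Let C_infty_upd f i t : C_infty f -> C_infty (fun w : 'rV[R]_e => f (upd w i t)).
Proof.
move=> Cf; have -> : (fun w => f (upd w i t)) = (fun w => f (frz (pred1 i) (const_mx t) w)).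
  by apply/funext => w; rewrite upd_frz.
exact: C_infty_frz.
Qed.

Let iterp_upd f i t T w : C_infty f -> i \notin T ->
  iterp T (fun w : 'rV[R]_e => f (upd w i t)) w = iterp T f (upd w i t).
Proof.
move=> Cf iT; have -> : (fun w => f (upd w i t)) = (fun w => f (frz (pred1 i) (const_mx t) w)).
  by apply/funext => v; rewrite upd_frz.
by rewrite (iterp_frz _ _ _ Cf) has_pred1 (negbTE iT) upd_frz.
Qed.

(* The values on a grid are written as iterated sums of mixed differences, one
   coordinate at a time; each mixed difference is controlled by a mixed derivative. *)
Lemma hardy_krause (C : R) (s : seq 'I_e) F M (A : R) : uniq s -> 0 <= C -> 0 <= A ->
  (forall p, C_infty (F p)) ->
  (forall T, uniq T -> {subset T <= s} -> forall p w, cube (z p) h w -> `|iterp T (F p) w| <= C) ->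
  (forall p (w w' : 'rV[R]_e), (forall i, i \in s -> w ord0 i = w' ord0 i) -> F p w = F p w') ->
  (forall m : 'I_e -> nat, \sum_p `|\sum_(j : {ffun 'I_e -> 'I_n}) ([forall i, m i <= j i]%N)%:R * M p j| <= A) ->
  `|\sum_p \sum_j F p (grid p j) * M p j| <= C * (1 + h) ^+ size s * A.
Proof.
move=> us C0 A0; elim: s us F M => [|i s IH] us F M CF hF Fdep hM.
  rewrite expr0 mulr1; apply: le_trans (ler_norm_sum _ _ _) _.
  have zz p : cube (z p) h (z p) by move=> i; rewrite in_itv /= lexx lerDl ltW.
  apply: (@le_trans _ _ (\sum_p C * `|\sum_j M p j|)).
    apply: ler_sum => p _.
    have -> : \sum_j F p (grid p j) * M p j = F p (z p) * \sum_j M p j.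
      by rewrite mulr_sumr; apply: eq_bigr => j _; congr (_ * _); exact: Fdep.
    rewrite normrM; apply: ler_wpM2r => //.
    exact: (hF [::] isT (fun _ h => h) p (z p) (zz p)).
  rewrite -mulr_sumr; apply: ler_wpM2l => //.
  have := hM (fun=> 0%N); apply: le_trans; apply: ler_sum => p _.
  rewrite le_eqVlt; apply/orP; left; apply/eqP; congr (`|_|); apply: eq_bigr => j _.
  by rewrite (_ : [forall i, _] = true) ?mul1r //; apply/forallP.
move: us => /andP[is_ us].
pose F0 p w := F p (upd w i (z p ord0 i)).
(* Scaled to a difference quotient, so that the bound [C] on derivatives carries over; the [n] terms
   then weigh [h / n] each and together cost a factor [h]. *)
pose Dm (m : nat) p w := n%:R / h * (F p (upd w i (node p i m.+1)) + (-1) * F p (upd w i (node p i m))).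
pose M' (m : nat) p (j : {ffun 'I_e -> 'I_n}) := (m < j i)%N%:R * M p j.
have node0 p : node p i 0 = z p ord0 i by rewrite /node mulr0 addr0.
(* The value at [J] is the initial value plus the increments with [m < J]; after exchanging sums
   that condition becomes a restriction on [M]. *)
have tele (f : nat -> R) (J : 'I_n) : f J = f 0%N + \sum_(m < n) (m < J)%N%:R * (f m.+1 - f m).
  rewrite -(big_mkord xpredT (fun m => (m < J)%N%:R * (f m.+1 - f m))).
  rewrite (@big_cat_nat _ _ _ J) ?(ltnW (ltn_ord J)) //=.
  rewrite [X in _ + (_ + X)]big_nat_cond [X in _ + (_ + X)]big1 ?addr0; last first.
    by move=> m /andP[/andP[Jm _] _]; rewrite ltnNge Jm mul0r.
  rewrite big_nat_cond (eq_bigr (fun m => f m.+1 - f m)); last first.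
    by move=> m /andP[/andP[_ mJ] _]; rewrite mJ mul1r.
  by rewrite -big_nat_cond telescope_sumr // addrC subrK.
have gridJ p j : upd (grid p j) i (node p i (j i)) = grid p j.
  by apply/rowP => k; rewrite updE !mxE; case: eqP => // ->.
have split_F : \sum_p \sum_j F p (grid p j) * M p j = \sum_p \sum_j F0 p (grid p j) * M p j
   + \sum_(m < n) h / n%:R * \sum_p \sum_j Dm m p (grid p j) * M' m p j.
  under [X in _ = _ + X]eq_bigr do rewrite mulr_sumr.
  rewrite [X in _ + X]exchange_big /= -big_split /=; apply: eq_bigr => p _.
  under [X in _ = _ + X]eq_bigr do rewrite mulr_sumr.
  rewrite [X in _ + X]exchange_big /= -big_split /=; apply: eq_bigr => j _.
  rewrite -{1}[grid p j]gridJ (tele (fun m => F p (upd (grid p j) i (node p i m))) (j i)).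
  rewrite mulrDl node0; congr (_ + _); rewrite mulr_suml; apply: eq_bigr => m _.
  rewrite /Dm /M' mulN1r.
  move: (_ - _) (M p j) (_%:R : R) => x y b.
  by field; rewrite !gt_eqF.
have hX0 : `|\sum_p \sum_j F0 p (grid p j) * M p j| <= C * (1 + h) ^+ size s * A.
  apply: IH => //.
  - by move=> p; exact: C_infty_upd.
  - move=> T uT Ts p w hw; rewrite iterp_upd //; last first.
      by apply/negP => /Ts is'; rewrite is' in is_.
    apply: hF => //; first by move=> k /Ts ks; rewrite inE ks orbT.
    by rewrite -node0; exact: node_cube.
  move=> p w w' hw; apply: Fdep => k; rewrite !inE => /orP[/eqP ->|ks]; rewrite !updE ?eqxx //.
  by case: eqP => // _; exact: hw.
have hX m : (m < n)%N -> `|\sum_p \sum_j Dm m p (grid p j) * M' m p j| <= C * (1 + h) ^+ size s * A.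
  move=> mn; apply: IH => //.
  - move=> p; apply: C_inftyZ; apply: C_inftyD; first exact: C_infty_upd.
    by apply: C_inftyZ; exact: C_infty_upd.
  - move=> T uT Ts p w hw.
    have iT : i \notin T by apply/negP => /Ts is'; rewrite is' in is_.
    have C1 t := C_infty_upd i t (CF p).
    rewrite iterpZ; last by apply: C_inftyD => //; exact: C_inftyZ.
    rewrite iterpD //; last exact: C_inftyZ.
    rewrite iterpZ // !iterp_upd // mulN1r.
    have [c hc ->] := slice_MVT w (node p i m) (node p i m.+1)
      (fun v => C_infty_derivable i v (C_infty_iterp T (CF p))).
    have -> : node p i m.+1 - node p i m = h / n%:R.
      by rewrite /node -[m.+1]addn1 natrD; ring.
    rewrite [X in `|X|](_ : _ = partial i (iterp T (F p)) (upd w i c)); last first.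
      by move: (partial _ _ _) => x; field; rewrite !gt_eqF.
    rewrite partial_iterp //; apply: (hF (i :: T)).
    + by rewrite /= iT.
    + by move=> k; rewrite !inE => /orP[->//|/Ts ->]; rewrite orbT.
    move=> k; rewrite updE; case: eqP => [->|_]; last exact: hw.
    have nm : node p i m <= node p i m.+1.
      by rewrite /node lerD2l ler_wpM2l ?divr_ge0 ?(ltW h0) // ler_nat.
    move: hc; rewrite (min_idPl nm) (max_idPr nm) in_itv /= => /andP[c1 c2].
    apply/andP; split.
      by apply: le_trans c1; rewrite /node lerDl mulr_ge0 ?divr_ge0 ?(ltW h0).
    apply: le_trans c2 _; rewrite /node lerD2l mulrAC ler_pdivrMr // ler_wpM2l ?(ltW h0) //.
    by rewrite ler_nat.
  - move=> p w w' hw; rewrite /Dm; congr (_ * (_ + _ * _)); apply: Fdep => k;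
      rewrite !inE => /orP[/eqP ->|ks]; rewrite !updE ?eqxx //;
      by case: eqP => // _; exact: hw.
  (* Two lower bounds on coordinate [i] merge into their maximum, so orthant sums of [M'] are
     orthant sums of [M]. *)
  move=> m'; pose m2 k := if k == i then maxn (m' i) m.+1 else m' k.
  have := hM m2; congr (_ <= _); apply: eq_bigr => p _; congr (`| _ |); apply: eq_bigr => j _.
  rewrite /M' mulrA -natrM mulnb; congr (_%:R * _); congr nat_of_bool.
  apply/idP/idP => [/forallP hj|/andP[/forallP hj mj]].
    apply/andP; split; last by have := hj i; rewrite /m2 eqxx geq_max => /andP[].
    apply/forallP => k; have := hj k; rewrite /m2; case: eqP => [->|//].
    by rewrite geq_max => /andP[].
  by apply/forallP => k; rewrite /m2; case: eqP => [->|_]; rewrite ?geq_max ?hj.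
rewrite split_F; apply: le_trans (ler_normD _ _) _.
set X := C * (1 + h) ^+ size s * A in hX0 hX *.
have -> : C * (1 + h) ^+ size (i :: s) * A = X + h * X by rewrite /X /= exprS; ring.
apply: lerD => //; apply: le_trans (ler_norm_sum _ _ _) _.
apply: (@le_trans _ _ (\sum_(m < n) h / n%:R * X)).
  apply: ler_sum => m _; rewrite normrM ger0_norm ?divr_ge0 ?(ltW h0) //.
  by apply: ler_wpM2l; [rewrite divr_ge0 // ltW|exact: hX].
have fin (q k : R) : 0 < k -> k * (h / k * q) = h * q.
  by move=> k0; field; rewrite gt_eqF.
by rewrite sumr_const card_ord -[X in X <= _]mulr_natl fin.
Qed.

End hardy_krause.

(** * The slowly varying remainder of the phase *)

Section amplitude.
Context {R : realType} {d : nat}.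
Implicit Types (phi a : 'rV[R]_(d + d) -> R) (c z : 'rV[R]_(d + d)).

(** Up to the constant [phi c], a mixed second difference of the phase; the constant, possibly
    large, is invisible to derivatives. *)
Definition twist phi c z : R :=
  phi z - phi (frz (predC is_x) c z) - phi (frz is_x c z).

Lemma twistE phi c : twist phi c =
  (fun z => phi z + (-1) * phi (frz (predC is_x) c z) + (-1) * phi (frz is_x c z)).
Proof. by apply/funext => z; rewrite /twist !mulN1r. Qed.

Lemma C_infty_twist phi c : C_infty phi -> C_infty (twist phi c).
Proof.
move=> Cphi; rewrite twistE; apply: C_inftyD; last by apply: C_inftyZ; exact: C_infty_frz.
by apply: C_inftyD => //; apply: C_inftyZ; exact: C_infty_frz.
Qed.

(* Near the corner [c] the phase is a function of x plus a function of xi up to a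
   remainder whose derivatives are all bounded. *)
Lemma twist_bound phi h T : mixed_phase phi -> 0 <= h -> T != [::] ->
  exists C : R, forall c z, cube c h z -> `|iterp T (twist phi c) z| <= C.
Proof.
move=> [Cphi hm] h0 T0.
have Cf m c := C_infty_frz m c Cphi.
have CT := C_infty_iterp T Cphi.
have iE c z : iterp T (twist phi c) z = iterp T phi z
    - (if has (predC is_x) T then 0 else iterp T phi (frz (predC is_x) c z))
    - (if has is_x T then 0 else iterp T phi (frz is_x c z)).
  rewrite twistE iterpD; [|by apply: C_inftyD => //; exact: C_inftyZ|exact: C_inftyZ].
  rewrite iterpD //; last exact: C_inftyZ.
  by rewrite !iterpZ // !iterp_frz // !mulN1r.
(* When [T] lies in one group of variables, it acts on a difference in the other group; the mean
   value theorem supplies the missing derivative and a factor [h]. *)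
have diff_bound (m : pred 'I_(d + d)) : (forall k, m k -> mixed (rcons T k)) ->
    exists C : R, forall c z, cube c h z -> `|iterp T phi z - iterp T phi (frz m c z)| <= C.
  move=> hmk.
  have [B B0 hB] : exists2 B : R, 0 <= B & forall (k : 'I_(d + d)),
      m k -> forall z, `|iterp (rcons T k) phi z| <= B.
    apply: (fin_bound (P := fun k B => m k -> forall z, `|iterp (rcons T k) phi z| <= B)).
      by move=> k C C' CC' hC mk z; exact: le_trans (hC mk z) CC'.
    move=> k; case: (boolP (m k)) => mk; last by exists 0.
    by have [C hC] := hm _ (hmk k mk); exists C.
  exists (\sum_(k < d + d) B * h) => c z hz.
  apply: le_trans (lipschitz_path (B := B) (w := frz m c z) (z := z) CT _) _.
    move=> k v _; rewrite frzE; case: ifPn => [mk _|_]; last by rewrite eqxx.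
    rewrite partial_iterp //; have -> : iterp T (partial k phi) = iterp (rcons T k) phi.
      have := iterp_perm (S := k :: T) (T := rcons T k) Cphi.
      by rewrite perm_sym perm_rcons perm_refl => /(_ isT).
    exact: hB.
  apply: ler_sum => k _; apply: ler_wpM2l => //; rewrite frzE; case: ifP => _; last by rewrite subrr normr0.
  by have := hz k; rewrite in_itv /= => /andP[h1 h2]; rewrite ger0_norm ?subr_ge0 // lerBlDl.
have hasT : has is_x T || has (predC is_x) T.
  by case: (T) T0 => // k S _ /=; case: (is_x k) => //=; rewrite orbT.
have [hx|hx] := boolP (has is_x T); have [hnx|hnx] := boolP (has (predC is_x) T).
- have [|C hC] := hm T; first by rewrite /mixed hx hnx.
  by exists C => c z _; rewrite iE hx hnx !subr0.
- have [|C hC] := diff_bound (predC is_x).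
    by move=> k mk; rewrite /mixed !has_rcons hx mk orbT.
  by exists C => c z hz; rewrite iE hx (negbTE hnx) subr0; exact: hC.
- have [|C hC] := diff_bound is_x.
    by move=> k mk; rewrite /mixed !has_rcons hnx mk orbT.
  by exists C => c z hz; rewrite iE hnx (negbTE hx) subr0; exact: hC.
by rewrite (negbTE hx) (negbTE hnx) in hasT.
Qed.

Definition amplitude phi a (p : 'rV[R]_(d + d) * R) z : R :=
  cos (twist phi p.1 z + p.2) * a z.

Lemma C_infty_amplitude phi a p : C_infty phi -> C_infty a -> C_infty (amplitude phi a p).
Proof.
by move=> Cphi Ca; apply: C_inftyM => //; apply: C_infty_cos; exact: C_infty_twist.
Qed.

Lemma amplitude_bound phi a h k : mixed_phase phi -> bounded_smooth a -> 0 <= h ->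
  bounded_partials (fun p z => cube p.1 h z) k (amplitude phi a).
Proof.
move=> hphi [Ca ha] h0; have Cphi := hphi.1.
apply: bounded_partialsM => //.
- by move=> p; apply: C_infty_cos; exact: C_infty_twist.
- apply: bounded_partials_cos; first by move=> p; exact: C_infty_twist.
  move=> i S _; have [C hC] := twist_bound (T := i :: S) hphi h0 isT.
  by exists C => p z; exact: hC.
by move=> S _; have [C hC] := ha S; exists C.
Qed.

(** Summation by parts meets only words without repetition; these have length at most [d + d], so
    finitely many constants are involved. *)
Lemma amplitude_bound_uniform phi a h : mixed_phase phi -> bounded_smooth a -> 0 <= h ->
  exists2 C : R, 0 <= C & forall T, uniq T -> forall p z, cube p.1 h z ->
    `|iterp T (amplitude phi a p) z| <= C.
Proof.
move=> hphi ha h0.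
have [C C0 hC] : exists2 C : R, 0 <= C & forall (T : (d + d).-bseq 'I_(d + d)) p z, cube p.1 h z ->
    `|iterp T (amplitude phi a p) z| <= C.
  apply: (fin_bound (P := fun (T : (d + d).-bseq 'I_(d + d)) C => forall p z, cube p.1 h z ->
    `|iterp T (amplitude phi a p) z| <= C)).
    by move=> T C C' CC' hC p z hz; exact: le_trans (hC p z hz) CC'.
  move=> T; have [C hC] := amplitude_bound hphi ha h0 (size_bseq T).
  by exists C.
exists C => // T uT p z hz.
have sT : (size T <= d + d)%N.
  by have := uniq_leq_size uT (fun i _ => mem_enum 'I_(d + d) i); rewrite size_enum_ord.
exact: (hC (Bseq sT)).
Qed.

(** Exchanging x and xi gives the phase of the transposed operator, whose sampling inequality is the
    second one needed. *)
Definition swap z : 'rV[R]_(d + d) := row_mx (rsubmx z) (lsubmx z).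

Definition swap_ord (k : 'I_(d + d)) : 'I_(d + d) :=
  match fintype.split k with inl j => rshift d j | inr j => lshift d j end.

Lemma swap_ord_l j : swap_ord (lshift d j) = rshift d j.
Proof. by rewrite /swap_ord (unsplitK (inl j : 'I_d + 'I_d)%type). Qed.

Lemma swap_ord_r j : swap_ord (rshift d j) = lshift d j.
Proof. by rewrite /swap_ord (unsplitK (inr j : 'I_d + 'I_d)%type). Qed.

Lemma swap_ordK k : swap_ord (swap_ord k) = k.
Proof. by case: (split_ordP k) => j ->; rewrite ?swap_ord_l ?swap_ord_r ?swap_ord_l. Qed.

Lemma swapE z k : swap z ord0 k = z ord0 (swap_ord k).
Proof.
by case: (split_ordP k) => j ->; rewrite ?swap_ord_l ?swap_ord_r /swap ?row_mxEl ?row_mxEr mxE.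
Qed.

Lemma swap_row (x xi : 'rV[R]_d) : swap (row_mx x xi) = row_mx xi x.
Proof. by rewrite /swap row_mxKl row_mxKr. Qed.

Lemma swap_upd z i t : swap (upd z i t) = upd (swap z) (swap_ord i) t.
Proof.
apply/rowP => k; rewrite updE !swapE updE.
by rewrite -(inj_eq (can_inj swap_ordK)) swap_ordK.
Qed.

Let swap_coord k : (exists i, forall z, swap z ord0 k = z ord0 i) \/
  (forall z w, swap z ord0 k = swap w ord0 k).
Proof. by left; exists (swap_ord k) => z; rewrite swapE. Qed.

Lemma is_x_swap k : is_x (swap_ord k) = ~~ is_x k.
Proof.
case: (split_ordP k) => j ->; rewrite ?swap_ord_l ?swap_ord_r /is_x /=.
  by rewrite ltn_ord ltnNge leq_addr.
by rewrite ltn_ord ltnNge leq_addr.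
Qed.

Lemma mixed_phase_swap phi : mixed_phase phi -> mixed_phase (fun z => phi (swap z)).
Proof.
move=> [Cphi hm]; split; first exact: (C_infty_subst swap_upd swap_coord).
move=> S hS; have [|C hC] := hm (map swap_ord S).
  have := hS; rewrite /mixed !has_map andbC => /andP[h1 h2]; apply/andP; split.
    by apply: sub_has h1 => k /=; rewrite is_x_swap.
  by apply: sub_has h2 => k /=; rewrite is_x_swap negbK.
by exists C => z; rewrite (iterp_subst swap_upd _ Cphi); exact: hC.
Qed.

Lemma det_hess_swap phi x xi : C_infty phi ->
  \det (hess_x_xi (fun z => phi (swap z)) xi x) = \det (hess_x_xi phi x xi).
Proof.
move=> Cphi; rewrite -[RHS]det_tr; congr (\det _); apply/matrixP => i j; rewrite !mxE.
have Cs : C_infty (fun z => phi (swap z)) by exact: (C_infty_subst swap_upd swap_coord).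
have e1 : partial (lshift d i) (partial (rshift d j) (fun z => phi (swap z))) =
   iterp [:: rshift d j; lshift d i] (fun z => phi (swap z)) by [].
rewrite e1 (iterp_subst swap_upd _ Cphi) /= swap_ord_l swap_ord_r swap_row.
by rewrite (partialC _ _ Cphi).
Qed.

End amplitude.

(** * Coarse cubes and fine cells *)

Section cells.
Context {R : realType} {d : nat} (h : R) (K : nat).
Hypotheses (h0 : 0 < h) (K0 : (0 < K)%N).
Local Notation LI := {ffun 'I_d -> 'I_K.*2}.
Local Notation NI := {ffun 'I_d -> 'I_K}.
Implicit Types (l : LI) (j : NI) (x : 'rV[R]_d).

(** [K] has two roles: [K.*2] coarse cubes of side [h] per axis, and [K] fine cells per coarse side.
    One limit both exhausts the space and refines the mesh. *)
Definition corner l : 'rV[R]_d := lattice_point (const_mx (- (h * K%:R))) h l.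

(** Half-open, so that distinct cells are disjoint. *)
Definition cell l j : set 'rV[R]_d := [set x | forall i,
  x ord0 i \in `[corner l ord0 i + h / K%:R * (j i)%:R,
                 corner l ord0 i + h / K%:R * (j i).+1%:R[ ].

(** Corners computed from [x] alone, so that [K] may tend to infinity at fixed [x]; the coarse one
    does not move at all. *)
Definition coarse x : 'rV[R]_d := \row_i (h * (Num.floor (x ord0 i / h))%:~R).

Definition fine_pt x : 'rV[R]_d :=
  \row_i (h / K%:R * (Num.floor (x ord0 i * K%:R / h))%:~R).

Let KR0 : 0 < K%:R :> R. Proof. by rewrite ltr0n. Qed.

Lemma measurable_cell l j : measurable (cell l j).
Proof.
rewrite (_ : cell l j = \bigcap_(i in [set: 'I_d])
  ((fun v : 'rV[R]_d => v ord0 i) @^-1` [set` `[corner l ord0 i + h / K%:R * (j i)%:R,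
                 corner l ord0 i + h / K%:R * (j i).+1%:R[])).
  apply: fin_bigcap_measurable => // i _; rewrite -[X in measurable X]setTI.
  by apply: measurable_coor_rV => //; exact: measurable_itv.
by apply/seteqP; split => v /= hv i; [move=> _; exact: hv|exact: (hv i I)].
Qed.

Lemma cell_floor l j x : cell l j x -> forall i,
  Num.floor (x ord0 i / h) = (l i)%:Z - K%:Z /\
  Num.floor (x ord0 i * K%:R / h) = (K * l i + j i)%:Z - (K * K)%:Z.
Proof.
move=> hx i; have := hx i; rewrite in_itv /= !mxE => /andP[h1 h2].
have hn : h != 0 by rewrite gt_eqF.
have Kn : K%:R != 0 :> R by rewrite gt_eqF.
have jK : (j i).+1%:R <= K%:R :> R by rewrite ler_nat.
have e (m : nat) : - (h * K%:R) + h * (l i)%:R + h / K%:R * m%:R =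
   h / K%:R * (K%:R * (l i)%:R + m%:R - K%:R * K%:R) by field.
split; apply: floor_def.
  rewrite intrD1 rmorphB /= -!pmulrn ler_pdivlMr // ltr_pdivrMr //.
  apply/andP; split.
    have hj : 0 <= h / K%:R * (j i)%:R by rewrite mulr_ge0 ?divr_ge0 ?(ltW h0).
    by move: h1 hj; lra.
  apply: lt_le_trans h2 _.
  have : h / K%:R * (j i).+1%:R <= h by rewrite mulrAC ler_pdivrMr // ler_wpM2l // ltW.
  by lra.
rewrite intrD1 rmorphB /= -!pmulrn natrD !natrM ler_pdivlMr // ltr_pdivrMr //.
rewrite !e in h1 h2.
have m1 u v : h / K%:R * u <= v -> u * h <= v * K%:R.
  by rewrite [h / K%:R * u]mulrAC ler_pdivrMr // [h * u]mulrC.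
have m2 u v : v < h / K%:R * u -> v * K%:R < u * h.
  by rewrite [h / K%:R * u]mulrAC ltr_pdivlMr // [h * u]mulrC.
rewrite m1 //=; apply: lt_le_trans (m2 _ _ h2) _; rewrite ler_wpM2r ?(ltW h0) //.
by rewrite -addn1 natrD; lra.
Qed.

Lemma cell_uniq l j l' j' x : cell l j x -> cell l' j' x -> l = l' /\ j = j'.
Proof.
move=> h1 h2; have e i : l i = l' i /\ j i = j' i.
  have [a1 b1] := cell_floor h1 i; have [a2 b2] := cell_floor h2 i.
  rewrite a1 in a2; rewrite b1 in b2.
  have el : (l i : nat) = l' i by have /addIr [] := a2.
  split; apply: val_inj => //=.
  by have /addIr [] := b2; rewrite el => /addnI.
by split; apply/ffunP => i; have [] := e i.
Qed.

Lemma cell_cube l j x : cell l j x -> cube (corner l) h x.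
Proof.
move=> hx i; have := hx i; rewrite !in_itv /= => /andP[h1 h2]; apply/andP; split.
  by apply: le_trans h1; rewrite lerDl mulr_ge0 ?divr_ge0 ?(ltW h0).
apply: le_trans (ltW h2) _; rewrite lerD2l mulrAC ler_pdivrMr // ler_wpM2l ?(ltW h0) //.
by rewrite ler_nat.
Qed.

Lemma cell_coarse l j x : cell l j x -> corner l = coarse x.
Proof.
move=> hx; apply/rowP => i; rewrite !mxE (cell_floor hx i).1 rmorphB /= -!pmulrn; ring.
Qed.

Lemma cell_fine l j x i : cell l j x ->
  corner l ord0 i + h / K%:R * (j i)%:R = fine_pt x ord0 i.
Proof.
move=> hx; rewrite !mxE (cell_floor hx i).2 rmorphB /= -!pmulrn natrD !natrM.
by field; rewrite !gt_eqF.
Qed.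

Lemma cell_exists x : (forall i, `|x ord0 i| < h * K%:R) -> exists l j, cell l j x.
Proof.
move=> hx.
have hn : h != 0 by rewrite gt_eqF.
have Kn : K%:R != 0 :> R by rewrite gt_eqF.
have ex i : exists lj : 'I_K.*2 * 'I_K,
    - (h * K%:R) + h * lj.1%:R + h / K%:R * lj.2%:R <= x ord0 i <
    - (h * K%:R) + h * lj.1%:R + h / K%:R * lj.2.+1%:R.
  have := hx i; rewrite ltr_norml => /andP[x1 x2].
  (* The position in units of fine cells, counted from the lower end; division by [K] splits its
     integer part into coarse and fine index. *)
  pose y := (x ord0 i + h * K%:R) * K%:R / h.
  have y0 : 0 <= y.
    by rewrite /y divr_ge0 ?(ltW h0) // mulr_ge0 // -lerBlDr sub0r ltW.
  have y1 : y < (K.*2 * K)%:R.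
    rewrite /y ltr_pdivrMr // natrM -mul2n natrM.
    have -> : 2%:R * K%:R * K%:R * h = (2 * (h * K%:R)) * K%:R :> R by ring.
    by rewrite ltr_pM2r //; lra.
  pose u := Num.truncn y.
  have /andP[u1 u2] := truncn_itv y0.
  have uK : (u < K.*2 * K)%N by rewrite -(ltr_nat R); exact: le_lt_trans u1 y1.
  have lK : (u %/ K < K.*2)%N by rewrite ltn_divLR.
  have jK : (u %% K < K)%N by rewrite ltn_mod.
  exists (Ordinal lK, Ordinal jK) => /=.
  have xy : x ord0 i = - (h * K%:R) + h / K%:R * y.
    by rewrite /y; field; rewrite ?hn ?Kn.
  have hK : 0 < h / K%:R by rewrite divr_gt0.
  have eu (m : nat) : - (h * K%:R) + h * (u %/ K)%:R + h / K%:R * m%:R =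
     - (h * K%:R) + h / K%:R * (u %/ K * K + m)%:R.
    by rewrite natrD natrM; field.
  rewrite !eu xy lerD2l ltrD2l ler_pM2l // ltr_pM2l //.
  by rewrite addnS -divn_eq; apply/andP.
have /choice[f hf] := ex.
exists [ffun i => (f i).1], [ffun i => (f i).2] => i.
by rewrite in_itv /= !mxE !ffunE; exact: hf.
Qed.

Lemma cell_bound l j x i : cell l j x -> `|x ord0 i| <= h * K%:R.
Proof.
move=> /cell_cube/(_ i); rewrite in_itv /= !mxE => /andP[h1 h2].
have l2 : (l i).+1%:R <= 2 * K%:R :> R.
  by rewrite -natrM ler_nat mul2n.
have h3 : h * (l i).+1%:R <= h * (2 * K%:R) by rewrite ler_wpM2l // ltW.
have h4 : 0 <= h * (l i)%:R by rewrite mulr_ge0 // ltW.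
by rewrite -addn1 natrD in h3; rewrite ler_norml; apply/andP; split; lra.
Qed.

Lemma sum_cells_le1 (Q : LI -> NI -> bool) x :
  \sum_l \sum_j (Q l j)%:R * \1_(cell l j) x <= 1 :> R.
Proof.
have [[l [j hx]]|nx] := pselect (exists l j, cell l j x).
  rewrite (bigD1 l) //= (bigD1 j) //= big1 => [|j' jj']; last first.
    rewrite indicE memNset ?mulr0 // => hx'; have [_ e] := cell_uniq hx hx'.
    by rewrite e eqxx in jj'.
  rewrite big1 => [|l' ll']; last first.
    apply: big1 => j' _; rewrite indicE memNset ?mulr0 // => hx'.
    by have [e _] := cell_uniq hx hx'; rewrite e eqxx in ll'.
  by rewrite !addr0 indicE mem_set // mulr1 lern1; case: (Q l j).
rewrite big1 // => l _; apply: big1 => j _; rewrite indicE memNset ?mulr0 // => hx.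
by apply: nx; exists l, j.
Qed.

End cells.

(** * Splitting grid indices between the two variables *)

Section ffun_split.
Context {R : realType} {d n : nat}.

Definition ffun_l (J : {ffun 'I_(d + d) -> 'I_n}) : {ffun 'I_d -> 'I_n} :=
  [ffun i => J (lshift d i)].
Definition ffun_r (J : {ffun 'I_(d + d) -> 'I_n}) : {ffun 'I_d -> 'I_n} :=
  [ffun i => J (rshift d i)].
Definition ffun_join (p : {ffun 'I_d -> 'I_n} * {ffun 'I_d -> 'I_n}) :
    {ffun 'I_(d + d) -> 'I_n} :=
  [ffun k => match fintype.split k with inl i => p.1 i | inr i => p.2 i end].

Lemma ffun_joinl j j' : ffun_l (ffun_join (j, j')) = j.
Proof. by apply/ffunP => i; rewrite !ffunE (unsplitK (inl i : 'I_d + 'I_d)%type). Qed.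

Lemma ffun_joinr j j' : ffun_r (ffun_join (j, j')) = j'.
Proof. by apply/ffunP => i; rewrite !ffunE (unsplitK (inr i : 'I_d + 'I_d)%type). Qed.

Lemma ffun_joinK J : ffun_join (ffun_l J, ffun_r J) = J.
Proof. by apply/ffunP => k; rewrite ffunE; case: split_ordP => i ->; rewrite ffunE. Qed.

Lemma sum_ffun_split (f g : {ffun 'I_d -> 'I_n} -> R) :
  \sum_J f (ffun_l J) * g (ffun_r J) = (\sum_j f j) * (\sum_j g j).
Proof.
rewrite big_distrlr /= pair_big /=.
rewrite (reindex (fun J => (ffun_l J, ffun_r J))) //=.
exists ffun_join => [J _|[j j'] _]; first exact: ffun_joinK.
by rewrite ffun_joinl ffun_joinr.
Qed.

End ffun_split.

Lemma sum_quad (R : realType) (A B C D : finType) (F : A * B * C * D -> R) :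
  \sum_a \sum_b \sum_c \sum_e F (a, b, c, e) = \sum_t F t.
Proof. by rewrite !pair_bigA /=; apply: eq_bigr => -[[[a b] c] e]. Qed.

(** * The discretized operator and its bound *)

Section step_operator.
Context {R : realType} {d : nat} (h : R) (K : nat).
Hypotheses (h0 : 0 < h) (K0 : (0 < K)%N).
Local Notation mu := (lebesgue_rV R d).
Local Notation LI := {ffun 'I_d -> 'I_K.*2}.
Local Notation NI := {ffun 'I_d -> 'I_K}.
Local Notation JI := {ffun 'I_(d + d) -> 'I_K}.
Implicit Types (l k : LI) (j : NI) (x : 'rV[R]_d) (g v : 'rV[R]_d -> R)
  (phi a : 'rV[R]_(d + d) -> R).

Definition L12 g := [/\ measurable_fun setT g, mu.-integrable setT (EFin \o g) &
  mu.-integrable setT (EFin \o (fun z => g z ^+ 2))].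

Definition samples phi (C : R) := forall (x0 b : 'rV[R]_d) (tau : LI -> R) g,
  measurable_fun setT g -> (forall z, ~ cube b h z -> g z = 0) ->
  mu.-integrable setT (EFin \o (fun z => g z ^+ 2)) ->
  \sum_l (\int[mu]_z (g z * cos (phi (row_mx (lattice_point x0 h l) z) + tau l))) ^+ 2
    <= C * \int[mu]_z (g z ^+ 2).

Local Notation cor := (corner h (K := K)).

(** The boolean selects cosine or sine in the expansion [cos_split]. *)
Definition shift_of (s : bool) : R := s%:R * (pi / 2).

(** For fixed [k] these are samples in [l] of one function supported in a cube; in [coefV] the roles
    of [l] and [k] are exchanged. *)
Definition coefG phi g (s : bool) l k j : R :=
  \int[mu]_z (\1_(cell h k j) z * g z * cos (phi (row_mx (cor l) z) + - shift_of s)).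

Definition coefV phi v (s : bool) l k j : R :=
  coefG (fun z => phi (swap z)) v s k l j.

Let meas_phase phi x t : C_infty phi ->
  measurable_fun setT (fun z => phi (row_mx x z) + t).
Proof.
move=> Cphi; apply: measurable_funD; last exact: measurable_cst.
by apply: continuous_measurable_rV; apply: C_infty_cont; exact: C_infty_rowr.
Qed.

Let meas_indic k j : measurable_fun setT (\1_(cell h k j) : 'rV[R]_d -> R).
Proof. by apply: measurable_indic; exact: measurable_cell. Qed.

Let indic_le k j z : 0 <= (\1_(cell h k j) z : R) <= 1.
Proof. by rewrite indicE; case: (_ \in _); rewrite /= lexx ler01. Qed.

Let int_indicM g k j : L12 g -> mu.-integrable setT (EFin \o (fun z => \1_(cell h k j) z * g z)).
Proof.
move=> [mg ig _]; apply: (@integrable_le _ _ _ _ (fun z => `|g z|)) => //.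
- by apply: measurable_funM => //; exact: meas_indic.
- exact: integrable_norm.
move=> z _; have /andP[i0 i1] := indic_le k j z.
by rewrite normrM (ger0_norm i0) ler_piMl.
Qed.

Lemma int_coef phi g s l k j : C_infty phi -> L12 g -> mu.-integrable setT
  (EFin \o (fun z => \1_(cell h k j) z * g z * cos (phi (row_mx (cor l) z) + - shift_of s))).
Proof.
move=> Cphi Lg; apply: integrable_cosM => //; first exact: meas_phase.
exact: int_indicM.
Qed.

Definition chi (Q : NI -> bool) k z : R := \sum_j (Q j)%:R * \1_(cell h k j) z.

Let chi_ge0 Q k z : 0 <= chi Q k z.
Proof.
by apply: sumr_ge0 => j _; apply: mulr_ge0.
Qed.

Let chi_sum Q z : \sum_k chi Q k z <= 1.
Proof. exact: (sum_cells_le1 h0 K0 (fun _ => Q)). Qed.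

Let chi_le1 Q k z : chi Q k z <= 1.
Proof.
apply: le_trans (chi_sum Q z); rewrite (bigD1 k) //= lerDl.
by apply: sumr_ge0 => k' _; exact: chi_ge0.
Qed.

Let meas_chi Q k : measurable_fun setT (chi Q k).
Proof.
apply: measurable_sum => j; apply: measurable_funM; first exact: measurable_cst.
exact: meas_indic.
Qed.

(** The sampling inequality is applied to [g] restricted to the selected fine cells of each coarse
    cube; disjointness of the cells adds up the right-hand sides. [Q] will be an orthant of fine
    indices. *)
Lemma samples_sum phi C (Q : NI -> bool) g s : C_infty phi -> samples phi C -> 0 <= C -> L12 g ->
  \sum_k \sum_l (\sum_j (Q j)%:R * coefG phi g s l k j) ^+ 2 <= C * \int[mu]_z (g z ^+ 2).
Proof.
move=> Cphi hs C0 Lg; have [mg ig ig2] := Lg.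
have isq k : mu.-integrable setT (EFin \o (fun z => (chi Q k z * g z) ^+ 2)).
  apply: (@integrable_le _ _ _ _ (fun z => g z ^+ 2)) => //.
    by apply: measurable_funX; apply: measurable_funM => //; exact: meas_chi.
  move=> z _; rewrite normrX normrM (ger0_norm (chi_ge0 _ _ _)) exprMn real_normK ?num_real //.
  by rewrite ler_piMl ?sqr_ge0 // expr_le1 // chi_le1.
have step k : \sum_l (\sum_j (Q j)%:R * coefG phi g s l k j) ^+ 2 <=
    C * \int[mu]_z ((chi Q k z * g z) ^+ 2).
  have := hs (const_mx (- (h * K%:R))) (cor k) (fun=> - shift_of s) (fun z => chi Q k z * g z).
  move=> /(_ _ _ (isq k)) H; apply: le_trans (H _ _).
  - rewrite le_eqVlt; apply/orP; left; apply/eqP; apply: eq_bigr => l _; congr (_ ^+ 2).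
    have := Rintegral_sum measurableT (fun j => integrable_scale (Q j)%:R measurableT (int_coef s l k j Cphi Lg)).
    move=> [_ e]; transitivity (\int[mu]_z (\sum_j (Q j)%:R *
       (\1_(cell h k j) z * g z * cos (phi (row_mx (cor l) z) + - shift_of s)))).
      rewrite e; apply: eq_bigr => j _.
      by rewrite (RintegralZl _ measurableT (int_coef s l k j Cphi Lg)).
    apply: eq_Rintegral => z _; rewrite /chi !mulr_suml; apply: eq_bigr => j _.
    by rewrite !mulrA.
  - by apply: measurable_funM => //; exact: meas_chi.
  move=> z nz; rewrite /chi big1 ?mul0r // => j _; rewrite indicE memNset ?mulr0 // => hz.
  by apply: nz; exact: cell_cube hz.
apply: le_trans (ler_sum _ (fun k _ => step k)) _; rewrite -mulr_sumr; apply: ler_wpM2l => //.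
have [i1 <-] := Rintegral_sum measurableT isq.
apply: le_Rintegral => // z _.
apply: (@le_trans _ _ (\sum_k chi Q k z * g z ^+ 2)).
  apply: ler_sum => k _; rewrite exprMn; apply: ler_wpM2r; first exact: sqr_ge0.
  by rewrite expr2 ler_piMl // ?chi_ge0 // chi_le1.
by rewrite -mulr_suml ler_piMl // ?sqr_ge0 // chi_sum.
Qed.

Definition cor2 (p : LI * LI) : 'rV[R]_(d + d) := row_mx (cor p.1) (cor p.2).

Definition step_amp phi a tau (s1 s2 : bool) (p : LI * LI) (J : JI) : R :=
  amplitude phi a (cor2 p, tau + shift_of s1 + shift_of s2) (grid cor2 h p J).

Definition step_form phi a tau v g s1 s2 : R :=
  \sum_p \sum_J step_amp phi a tau s1 s2 p J *
    (coefV phi v s1 p.1 p.2 (ffun_l J) * coefG phi g s2 p.1 p.2 (ffun_r J)).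

(** [hardy_krause] reduces the form to orthant sums, and an orthant in the joint index is a product
    of orthants. Each pair of cubes then contributes a product of two numbers, whose squares are
    summed by the two sampling inequalities. *)
Lemma step_form_bound phi a tau v g s1 s2 (C1 C2 CB : R) :
  C_infty phi -> C_infty a -> samples phi C1 -> samples (fun z => phi (swap z)) C2 ->
  C_infty (fun z => phi (swap z)) -> 0 <= C1 -> 0 <= C2 -> 0 <= CB ->
  (forall T, uniq T -> forall p z, cube p.1 h z -> `|iterp T (amplitude phi a p) z| <= CB) ->
  L12 v -> L12 g ->
  `|step_form phi a tau v g s1 s2| <= CB * (1 + h) ^+ (d + d) *
     (2^-1 * (C2 * \int[mu]_z (v z ^+ 2) + C1 * \int[mu]_z (g z ^+ 2))).
Proof.
move=> Cphi Ca hC1 hC2 Cs C10 C20 CB0 hCB Lv Lg.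
have sq0 w : 0 <= \int[mu]_z (w z ^+ 2) by apply: Rintegral_ge0 => z _; exact: sqr_ge0.
have A0 : 0 <= 2^-1 * (C2 * \int[mu]_z (v z ^+ 2) + C1 * \int[mu]_z (g z ^+ 2)).
  by rewrite mulr_ge0 // addr_ge0 // mulr_ge0 // sq0.
have := @hardy_krause R (d + d) K _ cor2 h h0 K0 CB (enum 'I_(d + d))
  (fun p => amplitude phi a (cor2 p, tau + shift_of s1 + shift_of s2))
  (fun p J => coefV phi v s1 p.1 p.2 (ffun_l J) * coefG phi g s2 p.1 p.2 (ffun_r J))
  _ (enum_uniq _) CB0 A0.
rewrite size_enum_ord; apply.
- by move=> p; exact: C_infty_amplitude.
- by move=> T uT _ p w hw; exact: (hCB T uT (_, _) w hw).
- by move=> p w w' ww'; congr amplitude; apply/rowP => i; apply: ww'; rewrite mem_enum.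
move=> m.
pose Q1 (j : NI) := [forall i, (m (lshift d i) <= j i)%N].
pose Q2 (j : NI) := [forall i, (m (rshift d i) <= j i)%N].
have QE (J : JI) : [forall i, (m i <= J i)%N] = Q1 (ffun_l J) && Q2 (ffun_r J).
  apply/forallP/andP => [hJ|[/forallP h1 /forallP h2] k].
    by split; apply/forallP => i; rewrite ffunE.
  by case: (split_ordP k) => i ->; [have := h1 i|have := h2 i]; rewrite ffunE.
have e p : \sum_(J : JI) ([forall i, (m i <= J i)%N])%:R *
      (coefV phi v s1 p.1 p.2 (ffun_l J) * coefG phi g s2 p.1 p.2 (ffun_r J)) =
   (\sum_j (Q1 j)%:R * coefV phi v s1 p.1 p.2 j) * (\sum_j (Q2 j)%:R * coefG phi g s2 p.1 p.2 j).
  rewrite -sum_ffun_split; apply: eq_bigr => J _.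
  by rewrite QE -mulnb natrM mulrACA.
under eq_bigr do rewrite e.
have amgm (x y : R) : `|x * y| <= 2^-1 * (x ^+ 2 + y ^+ 2).
  rewrite normrM -(real_normK (num_real x)) -(real_normK (num_real y)).
  by have := sqr_ge0 (`|x| - `|y|); lra.
apply: le_trans (ler_sum _ (fun p _ => amgm _ _)) _.
rewrite -mulr_sumr; apply: ler_wpM2l => //; rewrite big_split /=; apply: lerD.
  have := samples_sum Q1 s1 Cs hC2 C20 Lv; apply: le_trans.
  by rewrite pair_big.
have := samples_sum Q2 s2 Cphi hC1 C10 Lg; apply: le_trans.
by rewrite exchange_big pair_big.
Qed.

Definition step_op phi a tau g x : R :=
  \sum_p \sum_(J : JI) \sum_s1 \sum_s2 (\1_(cell h p.1 (ffun_l J)) x *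
    cos (phi (row_mx x (cor p.2)) + - shift_of s1)) *
    (step_amp phi a tau s1 s2 p J * coefG phi g s2 p.1 p.2 (ffun_r J)).

Lemma measurable_step_op phi a tau g : C_infty phi ->
  measurable_fun setT (step_op phi a tau g).
Proof.
move=> Cphi; apply: measurable_sum => p; apply: measurable_sum => J.
apply: measurable_sum => s1; apply: measurable_sum => s2.
apply: measurable_funM; last exact: measurable_cst.
apply: measurable_funM; first exact: meas_indic.
apply: (@measurableT_comp _ _ _ _ _ _ (@cos R)).
  by apply: continuous_measurable_fun; exact: continuous_cos.
apply: measurable_funD; last exact: measurable_cst.
by apply: continuous_measurable_rV; apply: C_infty_cont; exact: C_infty_rowl.
Qed.

Lemma L12_bounded_cube v (M : R) : measurable_fun setT v ->
  (forall z, `|v z| <= M) -> (forall z, ~ cube (const_mx (- (h * K%:R))) (2 * (h * K%:R)) z -> v z = 0) ->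
  L12 v.
Proof.
move=> mv hM sv; split => //.
  have mc : measurable (cube (const_mx (- (h * K%:R)) : 'rV[R]_d) (2 * (h * K%:R))) by exact: measurable_cube.
  have := (integrable_mkcond _ mc).1 (integrable_cube (K := M) _ mv (fun z _ => hM z)).
  move=> /(_ _) H.
  have := H; rewrite (_ : (EFin \o v) \_ _ = EFin \o v); first by apply; rewrite mulr_ge0 // mulr_ge0 // ltW.
  apply/funext => z; rewrite patchE; case: ifPn => //; rewrite notin_setE => hz.
  by rewrite /= sv.
have mc : measurable (cube (const_mx (- (h * K%:R)) : 'rV[R]_d) (2 * (h * K%:R))) by exact: measurable_cube.
have mv2 : measurable_fun setT (fun z => v z ^+ 2) by exact: measurable_funX.
have hM2 z : `|v z ^+ 2| <= M ^+ 2.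
  by rewrite normrX lerXn2r ?nnegrE // (le_trans _ (hM z)).
have := (integrable_mkcond _ mc).1 (integrable_cube (K := M ^+ 2) _ mv2 (fun z _ => hM2 z)).
move=> /(_ _) H.
have := H; rewrite (_ : (EFin \o _) \_ _ = EFin \o (fun z => v z ^+ 2)); first by apply; rewrite mulr_ge0 // mulr_ge0 // ltW.
apply/funext => z; rewrite patchE; case: ifPn => //; rewrite notin_setE => hz.
by rewrite /= sv // expr0n.
Qed.

(** At fixed [K] the function is bounded with bounded support, hence a legitimate test function for
    itself in [step_op_bound]. *)
Lemma L12_step_op phi a tau g : C_infty phi -> L12 (step_op phi a tau g).
Proof.
move=> Cphi.
apply: (@L12_bounded_cube _ (\sum_p \sum_(J : JI) \sum_s1 \sum_s2
    `|step_amp phi a tau s1 s2 p J * coefG phi g s2 p.1 p.2 (ffun_r J)|)).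
- exact: measurable_step_op.
- move=> z; apply: le_trans (ler_norm_sum _ _ _) _; apply: ler_sum => p _.
  apply: le_trans (ler_norm_sum _ _ _) _; apply: ler_sum => J _.
  apply: le_trans (ler_norm_sum _ _ _) _; apply: ler_sum => s1 _.
  apply: le_trans (ler_norm_sum _ _ _) _; apply: ler_sum => s2 _.
  rewrite normrM ler_piMl // normrM.
  have /andP[i0 i1] := indic_le p.1 (ffun_l J) z.
  rewrite (ger0_norm i0) mulr_ile1 //.
  by rewrite ler_norml cos_geN1 cos_le1.
move=> z nz; apply: big1 => p _; apply: big1 => J _; apply: big1 => s1 _; apply: big1 => s2 _.
rewrite indicE memNset ?mul0r // => hz; apply: nz => i.
have := cell_bound h0 K0 i hz; rewrite in_itv /= mxE ler_norml => /andP[h1 h2].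
by apply/andP; split; lra.
Qed.

Lemma step_op_form phi a tau v g : C_infty phi -> C_infty (fun z => phi (swap z)) -> L12 v ->
  \int[mu]_z (v z * step_op phi a tau g z) =
  \sum_s1 \sum_s2 step_form phi a tau v g s1 s2.
Proof.
move=> Cphi Cs Lv.
pose T := ((LI * LI) * JI * bool * bool)%type.
pose c (t : T) := let: (p, J, s1, s2) := t in
  step_amp phi a tau s1 s2 p J * coefG phi g s2 p.1 p.2 (ffun_r J).
pose f (t : T) z := let: (p, J, s1, s2) := t in
  \1_(cell h p.1 (ffun_l J)) z * v z * cos (phi (swap (row_mx (cor p.2) z)) + - shift_of s1).
have iF t : mu.-integrable setT (EFin \o f t).
  case: t => [[[p J] s1] s2]; exact: (int_coef s1 p.2 p.1 (ffun_l J) Cs Lv).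
have [_ e] := Rintegral_sum measurableT (fun t => integrable_scale (c t) measurableT (iF t)).
transitivity (\int[mu]_z (\sum_t c t * f t z)).
  apply: eq_Rintegral => z _; rewrite /step_op mulr_sumr.
  rewrite -(sum_quad (fun t => c t * f t z)).
  apply: eq_bigr => p _; rewrite mulr_sumr; apply: eq_bigr => J _.
  rewrite mulr_sumr; apply: eq_bigr => s1 _; rewrite mulr_sumr; apply: eq_bigr => s2 _.
  by rewrite /c /f swap_row; ring.
rewrite e; under eq_bigr do rewrite (RintegralZl _ measurableT (iF _)).
rewrite -(sum_quad (fun t => c t * \int[mu]_z f t z)).
under eq_bigr do rewrite exchange_big /=.
rewrite exchange_big /=; apply: eq_bigr => s1 _.
under eq_bigr do rewrite exchange_big /=.
rewrite exchange_big /=; apply: eq_bigr => s2 _.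
apply: eq_bigr => p _; apply: eq_bigr => J _.
by rewrite /coefV {2}/coefG; ring.
Qed.

Lemma step_op_bound phi a tau g (C1 C2 CB : R) :
  C_infty phi -> C_infty a -> samples phi C1 -> samples (fun z => phi (swap z)) C2 ->
  C_infty (fun z => phi (swap z)) -> 0 <= C1 -> 0 <= C2 -> 0 <= CB ->
  (forall T, uniq T -> forall p z, cube p.1 h z -> `|iterp T (amplitude phi a p) z| <= CB) ->
  L12 g ->
  \int[mu]_z (step_op phi a tau g z ^+ 2) <=
    (4 * (CB * (1 + h) ^+ (d + d)) * (C1 + C2 + 1)) ^+ 2 * \int[mu]_z (g z ^+ 2).
Proof.
move=> Cphi Ca hC1 hC2 Cs C10 C20 CB0 hCB Lg.
set B := CB * (1 + h) ^+ (d + d); set w := step_op phi a tau g.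
have B0 : 0 <= B by rewrite mulr_ge0 // exprn_ge0 // addr_ge0 // ltW.
have Lw : L12 w by exact: L12_step_op.
have [mw iw iw2] := Lw.
pose X := \int[mu]_z (w z ^+ 2); pose Y := \int[mu]_z (g z ^+ 2).
have sq0 u : 0 <= \int[mu]_z (u z ^+ 2) by apply: Rintegral_ge0 => z _; exact: sqr_ge0.
have X0 : 0 <= X by exact: sq0. have Y0 : 0 <= Y by exact: sq0.
pose q := 4 * B * (C1 + C2 + 1).
have q0 : 0 <= q by apply: mulr_ge0; [exact: mulr_ge0|rewrite !addr_ge0].
(* Tested against [ep] times itself. The form is bounded by a sum of squares, and the choice
   [ep = q^-1] below recovers the bound that a product of norms would give. *)
have main (ep : R) : 0 < ep -> ep * X <= q / 2 * (ep ^+ 2 * X + Y).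
  move=> ep0; pose v z := ep * w z.
  have v2 : (fun z => v z ^+ 2) = (fun z => ep ^+ 2 * w z ^+ 2) by apply/funext => z; rewrite /v exprMn.
  have Lv : L12 v.
    split; first by apply: measurable_funM => //; exact: measurable_cst.
      exact: integrable_scale.
    by rewrite v2; exact: integrable_scale.
  have V2 : \int[mu]_z (v z ^+ 2) = ep ^+ 2 * X.
    by rewrite v2 (RintegralZl _ measurableT iw2).
  have := step_op_form a tau g Cphi Cs Lv.
  have -> : \int[mu]_z (v z * step_op phi a tau g z) = ep * X.
    rewrite -(RintegralZl _ measurableT iw2); apply: eq_Rintegral => z _.
    by rewrite /v -/w expr2 mulrA.
  move=> ->.
  have hb s1 s2 : step_form phi a tau v g s1 s2 <= B * (2^-1 * (C2 * (ep ^+ 2 * X) + C1 * Y)).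
    apply: le_trans (ler_norm _) _; rewrite -V2.
    exact: step_form_bound.
  apply: (@le_trans _ _ (\sum_(s1 : bool) \sum_(s2 : bool) B * (2^-1 * (C2 * (ep ^+ 2 * X) + C1 * Y)))).
    by apply: ler_sum => s1 _; apply: ler_sum => s2 _; exact: hb.
  rewrite !sumr_const !card_bool.
  have P0 : 0 <= ep ^+ 2 * X by rewrite mulr_ge0 // sqr_ge0.
  have fin (b c1 c2 p y : R) : 0 <= b -> 0 <= c1 -> 0 <= c2 -> 0 <= p -> 0 <= y ->
     (b * (2^-1 * (c2 * p + c1 * y))) *+ 2 *+ 2 <= 4 * b * (c1 + c2 + 1) / 2 * (p + y).
    move=> b0 c10 c20 p0 y0; rewrite -mulrnA -mulr_natr.
    have n1 : 0 <= b * (c1 * p) by rewrite !mulr_ge0.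
    have n2 : 0 <= b * (c2 * y) by rewrite !mulr_ge0.
    have n3 : 0 <= b * p by rewrite mulr_ge0.
    have n4 : 0 <= b * y by rewrite mulr_ge0.
    by lra.
  exact: fin.
rewrite -/q -/X -/Y; have [q00|qn] := eqVneq q 0.
  by have := main 1 ltr01; rewrite q00 mul0r mul0r mul1r expr0n /= mul0r.
have qp : 0 < q by rewrite lt_def qn.
have := main q^-1 _; rewrite invr_gt0 => /(_ qp) H.
have fin (x y p : R) : 0 < p -> p^-1 * x <= p / 2 * (p^-1 ^+ 2 * x + y) -> x <= p ^+ 2 * y.
  move=> p0 H1; have pp : p * p^-1 = 1 by rewrite mulfV // gt_eqF.
  have e1 : p / 2 * (p^-1 ^+ 2 * x + y) = (p * p^-1) * (p^-1 * x) / 2 + p * y / 2 by ring.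
  have e2 : p^-1 * x <= p * y by move: H1; rewrite e1 pp; lra.
  have := ler_wpM2l (ltW p0) e2; rewrite !mulrA pp mul1r -expr2 //.
exact: fin H.
Qed.

End step_operator.

(** * Limit theorems for real integrals *)

Section limits.
Context d0 (T : measurableType d0) (R : realType) (mu : {measure set T -> \bar R}).

Lemma dominated_Rintegral (f_ : nat -> T -> R) (f G : T -> R) :
  (forall n, measurable_fun setT (f_ n)) ->
  (forall x, f_ ^~ x @ \oo --> f x) -> mu.-integrable setT (EFin \o G) ->
  (forall n x, `|f_ n x| <= G x) ->
  (fun n => \int[mu]_x f_ n x) @ \oo --> \int[mu]_x f x.
Proof.
move=> mf cf iG hG.
have mf' : measurable_fun setT f by exact: (@measurable_fun_cvg _ _ _ _ f_).
have := @dominated_convergence _ _ _ mu setT measurableT (fun n x => (f_ n x)%:E) (EFin \o f) (EFin \o G).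
case.
- by move=> n; exact/measurable_EFinP.
- exact/measurable_EFinP.
- apply: aeW => x _; apply: cvg_EFin; first by apply: nearW.
  exact: cf.
- exact: iG.
- by apply: aeW => x n _; rewrite /= lee_fin.
move=> iF _ H; apply: fine_cvg.
by rewrite fineK //; exact: integrable_fin_num.
Qed.

Lemma fatou_sqr (f_ : nat -> T -> R) (f : T -> R) (M : R) :
  (forall n, measurable_fun setT (f_ n)) ->
  (forall x, f_ ^~ x @ \oo --> f x) ->
  (forall n, (\int[mu]_x ((f_ n x) ^+ 2)%:E <= M%:E)%E) ->
  measurable_fun setT f /\ (\int[mu]_x ((f x) ^+ 2)%:E <= M%:E)%E.
Proof.
move=> mf cf hM.
have mf' : measurable_fun setT f by exact: (@measurable_fun_cvg _ _ _ _ f_).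
split => //.
have h := @fatou _ _ _ mu setT measurableT (fun n x => ((f_ n x) ^+ 2)%:E).
have {}h := h (fun n => (measurable_EFinP _ _).2 (measurable_funX 2 (mf n))) (fun n x _ => ltac:(rewrite lee_fin; exact: sqr_ge0)).
have e : (\int[mu]_x ((f x) ^+ 2)%:E = \int[mu]_x limn_einf (fun n => ((f_ n x) ^+ 2)%:E))%E.
  apply: eq_integral => x _.
  have c2 : (fun n => ((f_ n x) ^+ 2)%:E) @ \oo --> ((f x) ^+ 2)%:E.
    apply: cvg_EFin; first exact: nearW.
    by rewrite !expr2; apply: cvgM; exact: cf.
  by rewrite is_cvg_limn_einfE; [rewrite (cvg_lim _ c2)|apply/cvg_ex; exists ((f x) ^+ 2)%:E].
rewrite e; apply: le_trans h _; rewrite limn_einf_lim; apply: lime_le; first exact: is_cvg_einfs.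
apply: nearW => n; apply: le_trans (hM n); apply: ereal_inf_lbound.
by exists n => //=.
Qed.

End limits.

(** * Passage to the limit in the mesh *)

Section core_bound.
Context {R : realType} {d : nat}.
Implicit Types (phi a : 'rV[R]_(d + d) -> R) (x : 'rV[R]_d) (g : 'rV[R]_d -> R).
Local Notation mu := (lebesgue_rV R d).

Definition fio phi a tau g x : R :=
  \int[mu]_z (cos (phi (row_mx x z) + tau) * a (row_mx x z) * g z).

Lemma sumSumE (A B C D : finType) (f c : A * B * C * D -> R) (u : A * B * C * D -> 'rV[R]_d -> R) :
  (forall t, mu.-integrable setT (EFin \o u t)) ->
  \sum_t c t * \int[mu]_z u t z = \int[mu]_z (\sum_t c t * u t z).
Proof.
move=> iu; have [_ ->] := Rintegral_sum measurableT (fun t => integrable_scale (c t) measurableT (iu t)).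
by apply: eq_bigr => t _; rewrite (RintegralZl _ measurableT (iu t)).
Qed.

(** Equal to [phi] at [w = row_mx x z]. The two oscillating terms stay exact; only the last one will
    be evaluated at a grid point [w]. *)
Definition split_phase phi x x0 z z0 : 'rV[R]_(d + d) -> R := fun w =>
  phi (row_mx x z0) + phi (row_mx x0 z) + twist phi (row_mx x0 z0) w.

Lemma twist_row phi x0 z0 x z : twist phi (row_mx x0 z0) (row_mx x z) =
  phi (row_mx x z) - phi (row_mx x z0) - phi (row_mx x0 z).
Proof.
rewrite /twist; congr (_ - phi _ - phi _); apply/rowP => k; rewrite frzE;
  case: (split_ordP k) => i ->; rewrite /= /is_x /= ?row_mxEl ?row_mxEr ?ltn_ord //=.
  by rewrite ltnNge leq_addr.
by rewrite ltnNge leq_addr.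
Qed.

(** The addition formulas with every factor a cosine; the shifts of [C] absorb the signs. *)
Let cos_split (A B C : R) : cos (A + B + C) =
  \sum_(s1 : bool) \sum_(s2 : bool) cos (A + - shift_of s1 : R) * cos (B + - shift_of s2) *
     cos (C + shift_of s1 + shift_of s2).
Proof.
rewrite !big_bool /= /shift_of !mul0r !mul1r !oppr0 !addr0 !cosBpihalf.
have cp (u : R) : cos (u + pi / 2) = - sin u by rewrite cosDpihalf.
have cpp (u : R) : cos (u + pi / 2 + pi / 2) = - cos u.
  by rewrite cosDpihalf sinDpihalf.
by rewrite cpp !cp cosD cosD sinD; ring.
Qed.

Section fixed_step.
Variables (h : R) (h0 : 0 < h) (K : nat) (K0 : (0 < K)%N).
Variables (phi a : 'rV[R]_(d + d) -> R) (tau CA : R).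
Hypotheses (Cphi : C_infty phi) (Ca : C_infty a) (hCA : forall w, `|a w| <= CA).
Local Notation LI := {ffun 'I_d -> 'I_K.*2}.
Local Notation JI := {ffun 'I_(d + d) -> 'I_K}.

Definition step_kernel x (z : 'rV[R]_d) : R :=
  \sum_(p : LI * LI) \sum_(J : JI) \sum_s1 \sum_s2
   (\1_(cell h p.1 (ffun_l J)) x * cos (phi (row_mx x (corner h p.2)) + - shift_of s1) *
    step_amp h phi a tau s1 s2 p J) *
   (\1_(cell h p.2 (ffun_r J)) z * cos (phi (row_mx (corner h p.1) z) + - shift_of s2)).

Let indic_out (A : set 'rV[R]_d) y : ~ A y -> \1_A y = 0 :> R.
Proof. by move=> hy; rewrite indicE memNset. Qed.

Let fx (x : 'rV[R]_d) := fine_pt h K x.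

Definition local_kernel x (z : 'rV[R]_d) (w : 'rV[R]_(d + d)) : R :=
  cos (split_phase phi x (coarse h x) z (coarse h z) w + tau) * a w.

Lemma step_kernelE x (z : 'rV[R]_d) :
  (exists (l : LI) j, cell h l j x) -> (exists (k : LI) j, cell h k j z) ->
  step_kernel x z = local_kernel x z (row_mx (fx x) (fx z)).
Proof.
move=> [l [j hx]] [k [j' hz]]; rewrite /step_kernel.
rewrite (bigD1 (l, k)) //= (bigD1 (ffun_join (j, j'))) //=.
rewrite [X in _ + X + _]big1 ?addr0 => [|J JJ]; last first.
  apply: big1 => s1 _; apply: big1 => s2 _.
  have [xJ|xJ] := pselect (cell h l (ffun_l J) x); last first.
    by rewrite (indic_out xJ) !mul0r.
  have [zJ|zJ] := pselect (cell h k (ffun_r J) z); last first.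
    by rewrite (indic_out zJ) mul0r mulr0.
  have [_ e1] := cell_uniq h0 K0 hx xJ; have [_ e2] := cell_uniq h0 K0 hz zJ.
  by rewrite -(ffun_joinK J) -e1 -e2 eqxx in JJ.
rewrite [X in _ + X]big1 ?addr0 => [|[l' k'] /= lk]; last first.
  apply: big1 => J _; apply: big1 => s1 _; apply: big1 => s2 _.
  have [xJ|xJ] := pselect (cell h l' (ffun_l J) x); last first.
    by rewrite (indic_out xJ) !mul0r.
  have [zJ|zJ] := pselect (cell h k' (ffun_r J) z); last first.
    by rewrite (indic_out zJ) mul0r mulr0.
  have [e1 _] := cell_uniq h0 K0 hx xJ; have [e2 _] := cell_uniq h0 K0 hz zJ.
  by rewrite e1 e2 eqxx in lk.
rewrite ffun_joinl ffun_joinr !indicE (mem_set hx) (mem_set hz) /local_kernel /split_phase.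
rewrite -[X in cos X * a _]addrA cos_split mulr_suml.
have ew : grid (cor2 h (K := K)) h (l, k) (ffun_join (j, j')) = row_mx (fx x) (fx z).
  apply/rowP => i; rewrite mxE /cor2 /= ffunE; case: (split_ordP i) => q ->.
    by rewrite !row_mxEl (cell_fine h0 K0 q hx).
  by rewrite !row_mxEr (cell_fine h0 K0 q hz).
apply: eq_bigr => s1 _; rewrite mulr_suml; apply: eq_bigr => s2 _.
rewrite /step_amp /amplitude ew /cor2 /= (cell_coarse h0 K0 hx) (cell_coarse h0 K0 hz) !mul1r.
by rewrite !addrA; ring.
Qed.

(** Independent of [K], as dominated convergence requires: at most one pair of cells contributes at
    [x] and [z]. *)
Lemma step_kernel_bound x (z : 'rV[R]_d) : `|step_kernel x z| <= CA.
Proof.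
have CA0 : 0 <= CA by exact: le_trans (hCA 0).
have zero : (forall l k : LI, forall J : JI, ~ (cell h l (ffun_l J) x /\ cell h k (ffun_r J) z)) ->
    step_kernel x z = 0.
  move=> nc; apply: big1 => p _; apply: big1 => J _; apply: big1 => s1 _; apply: big1 => s2 _.
  have [xJ|xJ] := pselect (cell h p.1 (ffun_l J) x); last first.
    by rewrite (indic_out xJ) !mul0r.
  have [zJ|zJ] := pselect (cell h p.2 (ffun_r J) z); last first.
    by rewrite (indic_out zJ) mul0r mulr0.
  by exfalso; apply: (nc p.1 p.2 J).
have [[l [j hx]]|nx] := pselect (exists (l : LI) j, cell h l j x); last first.
  by rewrite zero ?normr0 // => l k J [hx _]; apply: nx; exists l, (ffun_l J).
have [[k [j' hz]]|nz] := pselect (exists (l : LI) j, cell h l j z); last first.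
  by rewrite zero ?normr0 // => l' k J [_ hz]; apply: nz; exists k, (ffun_r J).
rewrite step_kernelE; [|by exists l, j|by exists k, j'].
rewrite normrM -[X in _ <= X]mul1r ler_pM //.
by rewrite ler_norml cos_geN1 cos_le1.
Qed.

Lemma measurable_step_kernel x : measurable_fun setT (step_kernel x).
Proof.
apply: measurable_sum => p; apply: measurable_sum => J.
apply: measurable_sum => s1; apply: measurable_sum => s2.
apply: measurable_funM; first exact: measurable_cst.
apply: measurable_funM; first by apply: measurable_indic; exact: measurable_cell.
apply: (@measurableT_comp _ _ _ _ _ _ (@cos R)).
  by apply: continuous_measurable_fun; exact: continuous_cos.
apply: measurable_funD; last exact: measurable_cst.
by apply: continuous_measurable_rV; apply: C_infty_cont; exact: C_infty_rowr.
Qed.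

Lemma step_opE g x : L12 g -> step_op h K phi a tau g x = \int[mu]_z (step_kernel x z * g z).
Proof.
move=> Lg.
pose c (t : LI * LI * JI * bool * bool) := let: (p, J, s1, s2) := t in
   \1_(cell h p.1 (ffun_l J)) x * cos (phi (row_mx x (corner h p.2)) + - shift_of s1) *
    step_amp h phi a tau s1 s2 p J.
pose u (t : LI * LI * JI * bool * bool) z := let: (p, J, s1, s2) := t in
   \1_(cell h p.2 (ffun_r J)) z * g z * cos (phi (row_mx (corner h p.1) z) + - shift_of s2).
have iu t : mu.-integrable setT (EFin \o u t).
  by case: t => [[[p J] s1] s2]; apply: int_coef.
transitivity (\sum_t c t * \int[mu]_z u t z).
  rewrite -(sum_quad (fun t => c t * \int[mu]_z u t z)) /step_op.
  do 4 (apply: eq_bigr => ? _); rewrite /c /u /coefG.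
  by rewrite !mulrA.
rewrite (sumSumE c) //; apply: eq_Rintegral => z _.
rewrite -(sum_quad (fun t => c t * u t z)) /step_kernel mulr_suml.
apply: eq_bigr => p _; rewrite mulr_suml; apply: eq_bigr => J _.
rewrite mulr_suml; apply: eq_bigr => s1 _; rewrite mulr_suml; apply: eq_bigr => s2 _.
by rewrite /c /u; ring.
Qed.

End fixed_step.

Lemma fine_pt_cvg (h : R) x : 0 < h -> (fun K => fine_pt h K.+1 x) @ \oo --> x.
Proof.
move=> h0; apply/cvgrPdist_le => e e0; near=> m.
apply: norm_le_coord; first exact: ltW.
move=> i; rewrite !mxE.
have m0 : (0 : R) < m.+1%:R by rewrite ltr0n.
have /andP[f1 f2] := floor_itv (x ord0 i * m.+1%:R / h).
set y := x ord0 i * m.+1%:R / h in f1 f2 *.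
have -> : x ord0 i - h / m.+1%:R * (Num.floor y)%:~R = h / m.+1%:R * (y - (Num.floor y)%:~R).
  by rewrite /y; field; rewrite !gt_eqF.
rewrite ger0_norm; last by rewrite mulr_ge0 ?divr_ge0 ?subr_ge0 // ltW.
apply: (@le_trans _ _ (h / m.+1%:R)).
  rewrite ler_piMr ?divr_ge0 ?(ltW h0) //.
  by rewrite lerBlDl ltW // -intrD1.
rewrite mulrC -ler_pdivlMr //; apply: ltW.
near: m; exact: (near_infty_natSinv_lt (PosNum (divr_gt0 e0 h0))).
Unshelve. all: by end_near. Qed.

(** Once the cells cover both points, the kernel is the continuous function [local_kernel], which
    does not depend on [K], evaluated at fine corners that converge to [row_mx x z]. *)
Lemma step_op_cvg (h : R) phi a tau CA g x : 0 < h -> C_infty phi -> C_infty a ->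
  (forall w, `|a w| <= CA) -> L12 g ->
  (fun K => step_op h K.+1 phi a tau g x) @ \oo --> fio phi a tau g x.
Proof.
move=> h0 Cphi Ca hCA Lg; have [mg ig _] := Lg.
rewrite (_ : (fun K => _) = (fun K => \int[mu]_z (step_kernel h K.+1 phi a tau x z * g z))); last first.
  by apply/funext => K; exact: step_opE.
apply: (@dominated_Rintegral _ _ _ _ _ _ (fun z => CA * `|g z|)).
- by move=> K; apply: measurable_funM => //; exact: measurable_step_kernel.
- move=> z.
  suff : (fun K => step_kernel h K.+1 phi a tau x z) @ \oo --> cos (phi (row_mx x z) + tau) * a (row_mx x z).
    by move=> H; apply: cvgM H _; exact: cvg_cst.
  have Cl : C_infty (local_kernel h phi a tau x z).
    apply: C_inftyM => //; apply: C_infty_cos; apply: C_inftyD; first exact: C_infty_cst.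
    exact: C_infty_twist.
  have -> : cos (phi (row_mx x z) + tau) * a (row_mx x z) = local_kernel h phi a tau x z (row_mx x z).
    rewrite /local_kernel /split_phase twist_row; congr (cos (_ + _) * _).
    by rewrite [_ - phi _ - _]addrAC; ring.
  have cw : (fun K => row_mx (fine_pt h K.+1 x) (fine_pt h K.+1 z)) @ \oo --> row_mx x z.
    apply/cvgrPdist_le => e e0.
    have /cvgrPdist_le/(_ _ e0) nx := fine_pt_cvg (x := x) h0.
    have /cvgrPdist_le/(_ _ e0) nz := fine_pt_cvg (x := z) h0.
    near=> K; apply: norm_le_coord; first exact: ltW.
    have ex : `|x - fine_pt h K.+1 x| <= e.
      by near: K; exact: nx.
    have ez : `|z - fine_pt h K.+1 z| <= e.
      by near: K; exact: nz.
    move=> i; case: (split_ordP i) => q ->; rewrite mxE [X in _ + X]mxE ?row_mxEl ?row_mxEr.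
      by have := coord_le_norm (x - fine_pt h K.+1 x) q; rewrite !mxE => /le_trans; apply.
    by have := coord_le_norm (z - fine_pt h K.+1 z) q; rewrite !mxE => /le_trans; apply.
  have cl : continuous (local_kernel h phi a tau x z) by exact: C_infty_cont.
  have := cvg_comp _ _ cw (cl (row_mx x z)).
  apply: cvg_trans; apply: near_eq_cvg; near=> K.
  have big (y : 'rV[R]_d) : (\sum_i `|y ord0 i| / h) < K%:R -> exists (l : {ffun 'I_d -> 'I_K.+1.*2}) j, cell h l j y.
    move=> hK; apply: cell_exists => // i.
    rewrite mulrC -ltr_pdivrMr //; apply: (@le_lt_trans _ _ (\sum_i `|y ord0 i| / h)).
      rewrite (bigD1 i) //= lerDl; apply: sumr_ge0 => k _.
      by rewrite divr_ge0 // ltW.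
    by apply: lt_trans hK _; rewrite ltr_nat.
  rewrite /= (step_kernelE h0 _ _ _ _ (big x _) (big z _)) //.
    by near: K; exact: nbhs_infty_gtr.
  by near: K; exact: nbhs_infty_gtr.
- by apply: integrable_scale => //; exact: integrable_norm.
move=> K z; rewrite normrM; apply: ler_wpM2r => //.
exact: step_kernel_bound.
Unshelve. all: by end_near. Qed.

Theorem fio_bound phi a (c : R) : mixed_phase phi -> bounded_smooth a -> 0 < c ->
  (forall x xi, c <= `|\det (hess_x_xi phi x xi)|) ->
  exists2 C : R, 0 <= C & forall tau g, L12 g ->
    measurable_fun setT (fio phi a tau g) /\
    (\int[mu]_x ((fio phi a tau g x) ^+ 2)%:E <= (C * \int[mu]_x (g x ^+ 2))%:E)%E.
Proof.
move=> hphi ha c0 hdet; have Cphi := hphi.1; have [Ca haS] := ha.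
have hs := mixed_phase_swap hphi.
have hdet' x xi : c <= `|\det (hess_x_xi (fun z => phi (swap z)) x xi)|.
  by rewrite det_hess_swap.
have [h1 h10 S1] := sampling_estimate hphi c0 hdet.
have [h2 h20 S2] := sampling_estimate hs c0 hdet'.
(* The cubes in x and in z share one side, which must suit both sampling inequalities. *)
pose h := Num.min h1 h2.
have h0 : 0 < h by rewrite lt_min h10.
have hh1 : h <= h1 by rewrite ge_min lexx.
have hh2 : h <= h2 by rewrite ge_min lexx orbT.
have [C1 C10 H1] := S1 h h0 hh1.
have [C2 C20 H2] := S2 h h0 hh2.
have [CB CB0 HB] := amplitude_bound_uniform hphi ha (ltW h0).
have [CA hCA] := haS [::].
exists ((4 * (CB * (1 + h) ^+ (d + d)) * (C1 + C2 + 1)) ^+ 2); first exact: sqr_ge0.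
move=> tau g Lg; apply: (@fatou_sqr _ _ _ _ (fun K => step_op h K.+1 phi a tau g)).
- by move=> K; exact: measurable_step_op.
- by move=> x; exact: step_op_cvg hCA Lg.
move=> K.
have samp1 : samples h K.+1 phi C1 by move=> x0 b t v; exact: H1.
have samp2 : samples h K.+1 (fun z => phi (swap z)) C2 by move=> x0 b t v; exact: H2.
have [_ _ i2] := L12_step_op h0 (ltn0Sn K) a tau g Cphi.
have := step_op_bound h0 (ltn0Sn K) tau Cphi Ca samp1 samp2 hs.1 (ltW C10) (ltW C20) CB0 HB Lg.
by rewrite -lee_fin /Rintegral fineK //; exact: integrable_fin_num.
Qed.

End core_bound.

(** * Mean square estimates and completeness *)

Section mean_square.
Context d0 (T : measurableType d0) (R : realType) (mu : {measure set T -> \bar R}).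
Implicit Types (u v w : T -> R) (a b c : R).

(** Square integrability carried with an explicit real bound, so that estimates compose without
    square roots or infinite values. *)
Definition msq u a := measurable_fun setT u /\ (\int[mu]_x ((u x) ^+ 2)%:E <= a%:E)%E.

Lemma measurable_sqr_EFin u : measurable_fun setT u ->
  measurable_fun setT (fun x => ((u x) ^+ 2)%:E).
Proof. by move=> mu0; apply/measurable_EFinP; exact: measurable_funX. Qed.

Lemma msq_dom u v a : measurable_fun setT u -> (forall x, `|u x| <= `|v x|) -> msq v a ->
  msq u a.
Proof.
move=> mu0 uv [mv h]; split => //; apply: le_trans h; apply: ge0_le_integral => //.
- by move=> x _; rewrite lee_fin sqr_ge0.
- exact: measurable_sqr_EFin.
- exact: measurable_sqr_EFin.
- by move=> x _; rewrite lee_fin -real_normK ?num_real // -[leRHS]real_normK ?num_real // lerXn2r ?nnegrE.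
Qed.

Lemma msqW u a b : a <= b -> msq u a -> msq u b.
Proof. by move=> ab [mu0 h]; split => //; apply: le_trans h _; rewrite lee_fin. Qed.

Lemma msqZ c u a : msq u a -> msq (fun x => c * u x) (c ^+ 2 * a).
Proof.
move=> [mu0 h]; split; first exact: measurable_funM.
rewrite (eq_integral (fun x => (c ^+ 2)%:E * ((u x) ^+ 2)%:E)%E); last first.
  by move=> x _; rewrite -EFinM exprMn.
rewrite ge0_integralZl //.
- by rewrite [leRHS]EFinM; apply: lee_wpmul2l => //; rewrite lee_fin sqr_ge0.
- exact: measurable_sqr_EFin.
- by move=> x _; rewrite lee_fin sqr_ge0.
- by rewrite lee_fin sqr_ge0.
Qed.

Lemma msqD u v a b : msq u a -> msq v b -> msq (fun x => u x + v x) (2 * a + 2 * b).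
Proof.
move=> hu hv.
have par (p q : R) : (p + q) ^+ 2 <= 2 * p ^+ 2 + 2 * q ^+ 2.
  by rewrite -subr_ge0 (_ : _ - _ = (p - q) ^+ 2) ?sqr_ge0 //; ring.
split; first by apply: measurable_funD; [exact: hu.1|exact: hv.1].
have h2 : (0 : R) <= 2 by [].
apply: (@le_trans _ _ (\int[mu]_x ((2 * (u x) ^+ 2)%:E + (2 * (v x) ^+ 2)%:E))%E).
  apply: ge0_le_integral => //.
  - by move=> x _; rewrite lee_fin sqr_ge0.
  - by apply: measurable_sqr_EFin; apply: measurable_funD; [exact: hu.1|exact: hv.1].
  - apply: emeasurable_funD; apply/measurable_EFinP; apply: measurable_funM => //; apply: measurable_funX.
      exact: hu.1.
    exact: hv.1.
  - by move=> x _; rewrite -EFinD lee_fin.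
have dbl w : measurable_fun setT w ->
    (\int[mu]_x (2 * (w x) ^+ 2)%:E = 2%:E * \int[mu]_x ((w x) ^+ 2)%:E)%E.
  move=> mw; rewrite -ge0_integralZl //; first exact: measurable_sqr_EFin.
  by move=> x _; rewrite lee_fin sqr_ge0.
rewrite ge0_integralD //; first last.
- by apply/measurable_EFinP; apply: measurable_funM => //; apply: measurable_funX; exact: hv.1.
- by move=> x _; rewrite lee_fin mulr_ge0 ?sqr_ge0.
- by apply/measurable_EFinP; apply: measurable_funM => //; apply: measurable_funX; exact: hu.1.
- by move=> x _; rewrite lee_fin mulr_ge0 ?sqr_ge0.
rewrite (dbl _ hu.1) (dbl _ hv.1) [leRHS]EFinD [X in (_ <= X + _)%E]EFinM [X in (_ <= _ + X)%E]EFinM; apply: leeD.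
  by apply: lee_wpmul2l => //; exact: hu.2.
by apply: lee_wpmul2l => //; exact: hv.2.
Qed.

Lemma msqN u a : msq u a -> msq (fun x => - u x) a.
Proof.
move=> h; apply: (msq_dom _ _ h); last by move=> x; rewrite normrN.
by apply: measurableT_comp => //; exact: h.1.
Qed.

Lemma msqB u v a b : msq u a -> msq v b -> msq (fun x => u x - v x) (2 * a + 2 * b).
Proof. by move=> hu hv; exact: (msqD hu (msqN hv)). Qed.

Lemma msq_ae u v a : measurable_fun setT v -> {ae mu, forall x, u x = v x} -> msq u a -> msq v a.
Proof.
move=> mv uv [mu0 h]; split => //; apply: le_trans h; rewrite le_eqVlt; apply/orP; left; apply/eqP.
apply: ge0_ae_eq_integral => //; try exact: measurable_sqr_EFin; try by move=> x _; rewrite lee_fin sqr_ge0.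
by apply: filterS uv => x e _; rewrite e.
Qed.

Lemma msq_eq0 u : (forall e, 0 < e -> msq u e) -> {ae mu, forall x, u x = 0}.
Proof.
move=> h; have mu0 := (h 1 ltr01).1.
have e0 : (\int[mu]_x `|((u x) ^+ 2)%:E| = 0)%E.
  apply/eqP; rewrite eq_le; apply/andP; split; last exact: integral_ge0.
  apply/lee_addgt0Pr => e e0; rewrite add0e; apply: le_trans (h e e0).2.
  by rewrite le_eqVlt; apply/orP; left; apply/eqP; apply: eq_integral => x _; rewrite gee0_abs // lee_fin sqr_ge0.
have /(ae_eq_integral_abs _ measurableT (measurable_sqr_EFin mu0)) := e0.
by apply: filterS => x /(_ I) [] /eqP; rewrite sqrf_eq0 => /eqP.
Qed.

(* Riesz-Fischer along a fast subsequence; the limit satisfies the Cauchy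
   estimates of the sequence itself. *)
Lemma msq_cauchy_cvg (g : nat -> T -> R) (eps : nat -> R) :
  eps @ \oo --> (0 : R) ->
  (forall n, measurable_fun setT (g n)) ->
  (forall m n, (m <= n)%N -> msq (fun x => g n x - g m x) (eps m)) ->
  exists w, forall n, msq (fun x => w x - g n x) (eps n).
Proof.
move=> eps0 mg hg.
have [s hs] : exists s : nat -> nat, forall k, (k <= s k)%N /\ eps (s k) <= 8^-1 ^+ k.
  suff ex k : exists m, (k <= m)%N /\ eps m <= 8^-1 ^+ k.
    by have [s hs] := choice ex; exists s.
  have e0 : (0 : R) < 8^-1 ^+ k by rewrite exprn_gt0 // invr_gt0.
  have /cvgrPdist_le/(_ _ e0) [N _ hN] := eps0.
  exists (maxn k N); split; first exact: leq_maxl.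
  by have := hN (maxn k N) (leq_maxr _ _); rewrite /= sub0r normrN => /(le_trans (ler_norm _)).
pose dk k x := g (s k.+1) x - g (s k) x.
(* With these weights the integral of [F] is at most the sum of the [4^-1 ^+ k], and
   [|t| <= 2^-k + 2^k t^2] turns finiteness of [F] into convergence of the telescoping series. *)
pose q k : R := 2 ^+ k.
have q0 k : 0 < q k by rewrite exprn_gt0.
have hd k : msq (dk k) (8^-1 ^+ k).
  have [_ e1] := hs k; have [_ e2] := hs k.+1.
  (* The choice of [s] is not monotone, so either index may be the larger. *)
  have [le|/ltnW le] := leqP (s k) (s k.+1); first exact: msqW e1 (hg _ _ le).
  have : msq (dk k) (eps (s k.+1)).
    apply: (msq_dom _ _ (hg _ _ le)); first exact: measurable_funB.
    by move=> x; rewrite distrC.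
  apply: msqW; apply: le_trans e2 _; rewrite exprSr ler_piMr ?exprn_ge0 //.
  by rewrite invf_le1 // ler1n.
pose F x := (\sum_(0 <= k <oo) (q k * (dk k x) ^+ 2)%:E)%E.
have mk k : measurable_fun setT (fun x => (q k * (dk k x) ^+ 2)%:E).
  apply/measurable_EFinP; apply: measurable_funM => //; apply: measurable_funX; exact: (hd k).1.
have k0 k x : setT x -> (0 <= (q k * (dk k x) ^+ 2)%:E)%E.
  by move=> _; rewrite lee_fin mulr_ge0 ?sqr_ge0 // ltW.
have mF : measurable_fun setT F.
  apply: (@ge0_emeasurable_sum _ _ _ _ (fun k x => (q k * (dk k x) ^+ 2)%:E) predT) => [k x _ _|k _]; last exact: mk.
  exact: k0.
have F0 x : (0 <= F x)%E by apply: nneseries_ge0 => k _ _; exact: k0.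
have iF : mu.-integrable setT F.
  apply/integrableP; split => //.
  rewrite (eq_integral F); last by move=> x _; rewrite gee0_abs.
  rewrite /F integral_nneseries //.
  apply: (@le_lt_trans _ _ (\sum_(0 <= k <oo) (4^-1 ^+ k)%:E)%E).
    apply: lee_nneseries => k _; first by (move=> *; apply: integral_ge0 => x; exact: k0).
    have -> : (\int[mu]_x (q k * (dk k x) ^+ 2)%:E = (q k)%:E * \int[mu]_x ((dk k x) ^+ 2)%:E)%E.
      rewrite -ge0_integralZl //; last by rewrite lee_fin ltW.
        exact: measurable_sqr_EFin (hd k).1.
      by move=> x _; rewrite lee_fin sqr_ge0.
    apply: le_trans (lee_wpmul2l _ (hd k).2) _; first by rewrite lee_fin ltW.
    by rewrite -EFinM lee_fin /q -exprMn (_ : 2 * 8^-1 = 4^-1 :> R) //; lra.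
  have cg : series (fun k => (4^-1 : R) ^+ k) @ \oo --> (1 / (1 - 4^-1) : R).
    have := @cvg_geometric_series R 1 4^-1; rewrite (_ : geometric _ _ = (fun k => 4^-1 ^+ k)).
      by apply; rewrite ger0_norm // invf_lt1 // ltr1n.
    by apply/funext => k; rewrite /geometric /= mul1r.
  suff -> : (\sum_(0 <= k <oo) (4^-1 ^+ k)%:E)%E = (1 / (1 - 4^-1) : R)%:E by rewrite ltry.
  apply: cvg_lim => //.
  rewrite (_ : (fun n => _) = EFin \o series (fun k => (4^-1 : R) ^+ k)).
    by apply: cvg_EFin => //; exact: nearW.
  by apply/funext => n; rewrite /= /series /= sumEFin.
pose A := [set x | (F x < +oo)%E].
have mA : measurable A.
  by rewrite -[A]setTI; exact: emeasurable_fun_infty_o.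
have aeA : {ae mu, forall x, A x}.
  by apply: filterS (integrable_ae measurableT iF) => x /(_ I); rewrite ge0_fin_numE.
(* Set to 0 outside [A], so that the limit exists everywhere and is measurable. *)
pose gA k x := g (s k) x * \1_A x.
have cA x : cvgn (gA ^~ x).
  have [Ax|nAx] := pselect (A x); last first.
    rewrite (_ : gA ^~ x = cst 0); first exact: is_cvg_cst.
    by apply/funext => k; rewrite /gA indicE memNset // mulr0.
  rewrite (_ : gA ^~ x = (fun k => g (s k) x)); last first.
    by apply/funext => k; rewrite /gA indicE mem_set // mulr1.
  have -> : (fun k => g (s k) x) = (fun k => g (s 0%N) x + series (dk ^~ x) k).
    by apply/funext => k; rewrite (eq_sum_telescope (fun k => g (s k) x)).
  apply: is_cvgD; first exact: is_cvg_cst.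
  apply: normed_cvg; apply: nondecreasing_is_cvgn.
    apply: (@nondecreasing_series R (fun k => `|dk k x|) predT) => k _ _; exact: normr_ge0.
  exists (2 + fine (F x)) => _ [n _ <-].
  have geo : \sum_(0 <= k < n) (2^-1 : R) ^+ k <= 2.
    suff -> : \sum_(0 <= k < n) (2^-1 : R) ^+ k = 2 - 2 * 2^-1 ^+ n.
      by rewrite lerBlDr lerDl mulr_ge0 // exprn_ge0.
    elim: n => [|n IH]; first by rewrite big_nil expr0; lra.
    by rewrite big_nat_recr //= IH exprS; set y := _ ^+ n; lra.
  have part : \sum_(0 <= k < n) (q k * (dk k x) ^+ 2) <= fine (F x).
    rewrite -lee_fin fineK; last by rewrite ge0_fin_numE.
    rewrite -sumEFin; apply: nneseries_lim_ge => k _ _; exact: k0.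
  apply: le_trans (lerD geo part); rewrite -big_split /=; apply: ler_sum => k _.
  have amgm (p t : R) : 0 < p -> `|t| <= p^-1 + p * t ^+ 2.
    move=> p0; rewrite -(real_normK (num_real t)) -subr_ge0.
    have -> : p^-1 + p * `|t| ^+ 2 - `|t| = p^-1 * ((1 - p * `|t|) ^+ 2 + p * `|t|).
      by field; rewrite gt_eqF.
    by rewrite mulr_ge0 ?invr_ge0 ?(ltW p0) // addr_ge0 ?sqr_ge0 // mulr_ge0 // ltW.
  by rewrite exprVn; exact: amgm.
exists (fun x => limn (gA ^~ x)) => n.
have mgA k : measurable_fun setT (gA k) by apply: measurable_funM => //; exact: measurable_indic.
have cw x : gA ^~ x @ \oo --> limn (gA ^~ x) by exact: cA.
have mw : measurable_fun setT (fun x => limn (gA ^~ x)) by exact: (measurable_fun_cvg mgA).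
have H : msq (fun x => limn (gA ^~ x) - g n x * \1_A x) (eps n).
  (* The shift by [n] ensures [n <= s (k + n)], so every term obeys the Cauchy bound [eps n]. *)
  apply: (fatou_sqr (f_ := fun k x => gA (k + n)%N x - g n x * \1_A x)).
  - by move=> k; apply: measurable_funB => //; apply: measurable_funM => //; exact: measurable_indic.
  - move=> x; apply: cvgB; last exact: cvg_cst.
    have := cw x; rewrite -(cvg_shiftn n (gA ^~ x)); exact.
  move=> k; have le : (n <= s (k + n)%N)%N by apply: leq_trans (hs _).1; rewrite leq_addl.
  apply: (msq_dom _ _ (hg _ _ le)).2.
    by apply: measurable_funB => //; apply: measurable_funM => //; exact: measurable_indic.
  move=> x; rewrite /gA -mulrBl normrM ler_piMr // indicE.
  by case: (_ \in _); rewrite ?normr0 ?normr1.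
apply: msq_ae H; first exact: measurable_funB.
by apply: filterS aeA => x Ax; rewrite indicE mem_set // mulr1.
Qed.

End mean_square.

Lemma msq_cvg0 d0 (T : measurableType d0) (R : realType) (mu : {measure set T -> \bar R})
    (u : T -> R) (eps : nat -> R) :
  eps @ \oo --> (0 : R) -> (forall n, msq mu u (eps n)) -> {ae mu, forall x, u x = 0}.
Proof.
move=> eps0 h; apply: msq_eq0 => e e0.
have /cvgrPdist_le/(_ _ e0) [N _ hN] := eps0.
apply: msqW (h N); have := hN N (leqnn _).
by rewrite /= sub0r normrN => /(le_trans (ler_norm _)).
Qed.

Lemma msq_ext d0 (T : measurableType d0) (R : realType) (mu : {measure set T -> \bar R})
    (u v : T -> R) a : u =1 v -> msq mu u a -> msq mu v a.
Proof. by move=> /funext ->. Qed.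

(** * Extension from integrable functions to L^2 *)

Section extension.
Context {R : realType} {d : nat}.
Local Notation mu := (lebesgue_rV R d).
Implicit Types (u v w g : 'rV[R]_d -> R) (a c h C : R).

Lemma msq_integrable u a : msq mu u a -> mu.-integrable setT (EFin \o (fun z => u z ^+ 2)).
Proof.
move=> [mu0 h]; apply/integrableP; split; first exact: measurable_sqr_EFin.
apply: le_lt_trans (ltry a); apply: le_trans h.
by rewrite le_eqVlt; apply/orP; left; apply/eqP; apply: eq_integral => x _; rewrite gee0_abs // lee_fin sqr_ge0.
Qed.

Lemma integrable_msq u : measurable_fun setT u ->
  mu.-integrable setT (EFin \o (fun z => u z ^+ 2)) -> msq mu u (\int[mu]_x (u x ^+ 2)).
Proof.
move=> mu0 iu; split => //; rewrite /Rintegral fineK //.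
exact: (integrable_fin_num _ iu).
Qed.

Definition trunc (n : nat) u : 'rV[R]_d -> R :=
  fun x => u x * \1_(cube (const_mx (- n%:R)) (n.*2)%:R) x.

Lemma trunc_le n u x : `|trunc n u x| <= `|u x|.
Proof.
by rewrite normrM ler_piMr // indicE; case: (_ \in _); rewrite ?normr0 ?normr1.
Qed.

Lemma trunc_rem_le n u x : `|u x - trunc n u x| <= `|u x|.
Proof.
rewrite -[X in X - _]mulr1 -mulrBr normrM ler_piMr // indicE.
by case: (_ \in _); rewrite ?subrr ?subr0 ?normr0 ?normr1.
Qed.

Lemma in_cube_centered n (x : 'rV[R]_d) : cube (const_mx (- n%:R)) (n.*2)%:R x <-> forall i, `|x ord0 i| <= n%:R.
Proof.
rewrite /cube /=; split => h i; have := h i; rewrite !mxE in_itv /= ler_norml -addnn natrD addKr //.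
Qed.

Lemma trunc_incr_le m n u x : (m <= n)%N -> `|trunc n u x - trunc m u x| <= `|u x - trunc m u x|.
Proof.
move=> mn; rewrite /trunc -[X in _ <= `|X - _|]mulr1 -!mulrBr !normrM ler_wpM2l // !indicE.
case: (boolP (x \in cube (const_mx (- m%:R)) _)) => hm; last first.
  by rewrite !subr0; case: (_ \in _); rewrite ?normr0 ?normr1.
have -> : x \in cube (const_mx (- n%:R)) (n.*2)%:R.
  rewrite inE; apply/in_cube_centered => i; move: hm; rewrite inE => /in_cube_centered h.
  by apply: le_trans (h i) _; rewrite ler_nat.
by rewrite lexx.
Qed.

Lemma truncD c n u v x : trunc n (fun x => c * u x + v x) x = c * trunc n u x + trunc n v x.
Proof. by rewrite /trunc; ring. Qed.

Lemma measurable_trunc n u : measurable_fun setT u -> measurable_fun setT (trunc n u).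
Proof.
by move=> mu0; apply: measurable_funM => //; apply: measurable_indic; exact: measurable_cube.
Qed.

Lemma msq_trunc n u a : msq mu u a -> msq mu (trunc n u) a.
Proof.
by move=> h; apply: (msq_dom _ _ h) => [|x]; [exact: measurable_trunc h.1|exact: trunc_le].
Qed.

Lemma msq_trunc_rem n u a : msq mu u a -> msq mu (fun x => u x - trunc n u x) a.
Proof.
move=> h; apply: (msq_dom _ _ h) => [|x]; last exact: trunc_rem_le.
by apply: measurable_funB; [exact: h.1|exact: measurable_trunc h.1].
Qed.

Lemma integrable_indic_cube (b : 'rV[R]_d) h : 0 <= h ->
  mu.-integrable setT (EFin \o \1_(cube b h)).
Proof.
move=> h0; have mc := measurable_cube b h.
apply/integrableP; split; first by apply/measurable_EFinP; exact: measurable_indic.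
rewrite (eq_integral (fun x => (\1_(cube b h) x)%:E)); last first.
  by move=> t _; rewrite gee0_abs // lee_fin.
by rewrite integral_indic // setIT lebesgue_cube ?ltry.
Qed.

Lemma L12_trunc n u a : msq mu u a -> L12 (trunc n u).
Proof.
move=> h; have mt := measurable_trunc n h.1; split => //; last exact: msq_integrable (msq_trunc n h).
have n0 : (0 : R) <= (n.*2)%:R by exact: ler0n.
have i1 := integrable_indic_cube (const_mx (- n%:R)) n0.
have i2 := integrable_add measurableT i1 (msq_integrable h).
apply: (integrable_le measurableT mt i2) => x _; rewrite /trunc normrM indicE.
case: (_ \in _) => /=; rewrite ?normr0 ?mulr0 ?addr_ge0 ?sqr_ge0 // normr1 mulr1.
rewrite -(real_normK (num_real (u x))); set t := `|_|.
by have := sqr_ge0 (t - 1); rewrite sqrrB expr1n mulr1; have := normr_ge0 (u x); rewrite -/t; lra.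
Qed.

Definition tail n u : R := \int[mu]_x ((u x - trunc n u x) ^+ 2).

Lemma msq_tail n u a : msq mu u a -> msq mu (fun x => u x - trunc n u x) (tail n u).
Proof.
move=> h; have h' := msq_trunc_rem n h.
by apply: integrable_msq; [exact: h'.1|exact: msq_integrable h'].
Qed.

Lemma tail_cvg0 u a : msq mu u a -> (fun n => tail n u) @ \oo --> (0 : R).
Proof.
move=> h; have <- : \int[mu]_x (0 : R) = 0 by rewrite /Rintegral integral0.
apply: (@dominated_Rintegral _ _ _ _ _ _ (fun x => u x ^+ 2)).
- by move=> n; apply: measurable_funX; exact: (msq_trunc_rem n h).1.
- move=> x; apply: cvg_near_cst.
  have : (\bigcup_k cube (const_mx (- k%:R) : 'rV[R]_d) (k.*2)%:R) x by rewrite cubes_cover.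
  move=> [k _ hk]; exists k => // n /= kn.
  suff hn : cube (const_mx (- n%:R)) (n.*2)%:R x.
    by rewrite /trunc indicE mem_set // mulr1 subrr expr0n.
  move/in_cube_centered in hk; apply/in_cube_centered => i.
  by apply: le_trans (hk i) _; rewrite ler_nat.
- exact: msq_integrable h.
move=> n x; rewrite ger0_norm ?sqr_ge0 // -real_normK ?num_real // -[leRHS]real_normK ?num_real //.
by rewrite lerXn2r ?nnegrE //; exact: trunc_rem_le.
Qed.

Definition L12_op (B : ('rV[R]_d -> R) -> 'rV[R]_d -> R) C := [/\ 0 <= C,
  forall g a, L12 g -> msq mu g a -> msq mu (B g) (C * a) &
  forall c u v, L12 u -> L12 v -> forall x, B (fun z => c * u z + v z) x = c * B u x + B v x].

(** Linear only almost everywhere, because the limit defining [E] is chosen separately for each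
    function. *)
Definition L2_op (E : ('rV[R]_d -> R) -> 'rV[R]_d -> R) := 
  (exists2 C, 0 <= C & forall u a, msq mu u a -> msq mu (E u) (C * a)) /\
  forall c u v a b, msq mu u a -> msq mu v b ->
    {ae mu, forall x, E (fun z => c * u z + v z) x = c * E u x + E v x}.

Lemma L12_lin c u v : L12 u -> L12 v -> L12 (fun x => c * u x + v x).
Proof.
move=> [m1 i1 s1] [m2 i2 s2]; have m3 : measurable_fun setT (fun x => c * u x + v x).
  by apply: measurable_funD => //; exact: measurable_funM.
split => //; first by apply: integrable_add => //; exact: integrable_scale.
exact: (msq_integrable (msqD (msqZ c (integrable_msq m1 s1)) (integrable_msq m2 s2))).
Qed.

Lemma L12Z c u : L12 u -> L12 (fun x => c * u x).
Proof.
move=> Lu; rewrite (_ : (fun x => _) = (fun x => (c - 1) * u x + u x)); first exact: L12_lin.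
by apply/funext => x; ring.
Qed.

(** [near_trunc] determines the extension almost everywhere. Linearity and agreement with [B] follow
    by bounding the mean square of a difference by combinations of tails, which tend to 0. *)
Lemma L2_op_extension B C : L12_op B C ->
  exists2 E, L2_op E & forall u, L12 u -> {ae mu, forall x, E u x = B u x}.
Proof.
move=> [C0 hB lB].
have subB u v : L12 u -> L12 v -> forall x, B u x - B v x = B (fun z => -1 * v z + u z) x.
  by move=> Lu Lv x; rewrite lB // mulN1r addrC.
pose near_trunc u w := forall n, msq mu (fun x => w x - B (trunc n u) x) (C * tail n u).
have ex u : exists w, (exists a, msq mu u a) -> near_trunc u w.
  have [[a h]|nh] := pselect (exists a, msq mu u a); last by exists (cst 0).
  suff [w hw] : exists w, near_trunc u w by exists w.
  apply: msq_cauchy_cvg.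
  - by rewrite -(mulr0 C); apply: cvgM; [exact: cvg_cst|exact: tail_cvg0 h].
  - by move=> n; exact: (hB _ _ (L12_trunc n h) (msq_trunc n h)).1.
  move=> m n mn.
  have Lm := L12_trunc m h; have Ln := L12_trunc n h.
  rewrite (_ : (fun x => _) = B (fun z => -1 * trunc m u z + trunc n u z)); last first.
    by apply/funext => x; exact: subB.
  apply: hB; first exact: L12_lin.
  apply: (msq_dom _ _ (msq_tail m h)) => [|x]; first by have [] := L12_lin (-1) Lm Ln.
  by rewrite mulN1r addrC; exact: trunc_incr_le.
have [E hE] := choice ex.
have cE u a : msq mu u a -> forall K, (fun n => K * (C * tail n u)) @ \oo --> (0 : R).
  move=> h K; rewrite -(mulr0 K) -(mulr0 C); apply: cvgM; first exact: cvg_cst.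
  by apply: cvgM; [exact: cvg_cst|exact: tail_cvg0 h].
exists E; first split.
(* Comparison with the truncation of index 0 already gives the bound, without a limit. *)
- exists (2 * C + 2 * C) => [|u a h]; first by rewrite addr_ge0 // mulr_ge0.
  have h1 := hE u (ex_intro _ a h) 0%N.
  have h2 := hB _ _ (L12_trunc 0 h) (msq_trunc 0 h).
  apply: msqW (msq_ext _ (msqD h1 h2)) => [|x]; last by rewrite subrK.
   rewrite [leRHS]mulrDl; apply: lerD; last by rewrite mulrA.
  rewrite -mulrA ler_wpM2l // ler_wpM2l //.
  have h3 := msq_trunc_rem 0 h; rewrite -lee_fin; apply: le_trans h3.2.
  by rewrite /tail /Rintegral fineK // (integrable_fin_num _ (msq_integrable h3)).
- move=> c u v a b hu hv.
  have huv := msqD (msqZ c hu) hv.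
  have ku := hE u (ex_intro _ a hu); have kv := hE v (ex_intro _ b hv).
  have kuv := hE _ (ex_intro _ _ huv).
  suff H : {ae mu, forall x, E (fun z => c * u z + v z) x - (c * E u x + E v x) = 0}.
    by apply: filterS H => x /eqP; rewrite subr_eq0 => /eqP.
  apply: (@msq_cvg0 _ _ _ _ _ (fun n => 2 * (C * tail n (fun z => c * u z + v z)) +
    2 * (2 * (c ^+ 2 * (C * tail n u)) + 2 * (C * tail n v)))).
    rewrite -(addr0 (0 : R)); apply: cvgD; first exact: cE huv _.
    rewrite -(mulr0 (2 : R)); apply: cvgM; first exact: cvg_cst.
    rewrite -(addr0 (0 : R)); apply: cvgD; last exact: cE hv _.
    rewrite (_ : (fun n => _) = (fun n => (2 * c ^+ 2) * (C * tail n u))); first exact: cE hu _.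
    by apply/funext => n; rewrite !mulrA.
  move=> n; apply: (msq_ext _ (msqB (kuv n) (msqD (msqZ c (ku n)) (kv n)))) => x.
  have -> : trunc n (fun z => c * u z + v z) = (fun z => c * trunc n u z + trunc n v z).
    by apply/funext => z; exact: truncD.
  by rewrite lB; [ring|exact: L12_trunc hu|exact: L12_trunc hv].
move=> u Lu; have [mu0 _ su] := Lu.
have h := integrable_msq mu0 su; have ku := hE u (ex_intro _ _ h).
suff H : {ae mu, forall x, E u x - B u x = 0}.
  by apply: filterS H => x /eqP; rewrite subr_eq0 => /eqP.
apply: (@msq_cvg0 _ _ _ _ _ (fun n => 2 * (C * tail n u) + 2 * (C * tail n u))).
  by rewrite -(addr0 (0 : R)); apply: cvgD; exact: cE h _.
move=> n; have Ln := L12_trunc n h.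
have hr : msq mu (fun x => B u x - B (trunc n u) x) (C * tail n u).
  rewrite (_ : (fun x => _) = B (fun z => -1 * trunc n u z + u z)); last first.
    by apply/funext => x; exact: subB.
  apply: hB; first exact: L12_lin.
  by apply: (msq_ext _ (msq_tail n h)) => x; rewrite mulN1r addrC.
by apply: (msq_ext _ (msqB (ku n) hr)) => x; ring.
Qed.

(** [E] acts on functions, not on classes; boundedness sends the null function [u - v] to a null
    function. *)
Lemma L2_op_ae E u v a b : L2_op E -> msq mu u a -> msq mu v b ->
  {ae mu, forall x, u x = v x} -> {ae mu, forall x, E u x = E v x}.
Proof.
move=> [[C C0 bE] lE] hu hv uv.
pose w := fun x => -1 * v x + u x.
have mw : measurable_fun setT w by exact: (msqD (msqZ (-1) hv) hu).1.
have hw : msq mu w 0.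
  have h0 : msq mu (fun=> 0 : R) 0.
    split; first exact: measurable_cst.
    by rewrite integral0_eq // => x _; rewrite expr0n.
  by apply: msq_ae h0 => //; apply: filterS uv => x e; rewrite /w e mulN1r addNr.
have Ew : {ae mu, forall x, E w x = 0}.
  apply: msq_eq0 => e e0; apply: msqW (bE _ _ hw); rewrite mulr0; exact: ltW.
have H := lE (-1) v u b a hv hu.
apply: filterS2 Ew H => x e1 e2; move: e1; rewrite /w e2 mulN1r addrC => /eqP.
by rewrite subr_eq0 => /eqP.
Qed.

End extension.

(** * Functions of rapid decay *)

Section decay.
Context {R : realType} {d : nat}.
Local Notation mu := (lebesgue_rV R d).
Local Notation leb := (@lebesgue_measure R).
Implicit Types (u v G : 'rV[R]_d -> R) (x : 'rV[R]_d).

(** Decay in the sup norm, stated coordinate by coordinate because integration by parts yields it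
    so. *)
Definition decays (N : nat) u (C : R) := forall x,
  `|u x| <= C /\ forall j, `|x ord0 j| ^+ N * `|u x| <= C.

Lemma decays_ge0 N u C : decays N u C -> 0 <= C.
Proof. by move=> h; have [h0 _] := h 0; exact: le_trans h0. Qed.

(* A dyadic decomposition into cubes of radius [2 ^ k]. *)
Lemma integrable_decays u C : measurable_fun setT u -> decays d.+1 u C ->
  mu.-integrable setT (EFin \o u).
Proof.
move=> mu0 hu; have C0 := decays_ge0 hu.
pose Q k : set 'rV[R]_d := cube (const_mx (- (2 ^ k)%:R)) (2 ^ k).*2%:R.
(* If [Q k] is the least cube containing x and [k > 0], some coordinate exceeds half its radius,
   which gives [|u x| <= c k]. Against the volume [(2 * 2 ^ k) ^ d] this leaves a geometric series
   of ratio 1/2. *)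
pose c k : R := C * 2 ^+ d.+1 * (2^-1 ^+ k) ^+ d.+1.
have c0 k : 0 <= c k by rewrite !mulr_ge0 ?exprn_ge0.
have mQ k : measurable (Q k) by exact: measurable_cube.
have mk k : measurable_fun setT (fun x => (c k * \1_(Q k) x)%:E).
  by apply/measurable_EFinP; apply: measurable_funM => //; exact: measurable_indic.
have k0 k x : setT x -> (0 <= (c k * \1_(Q k) x)%:E)%E.
  by move=> _; rewrite lee_fin mulr_ge0.
pose F x := (\sum_(0 <= k <oo) (c k * \1_(Q k) x)%:E)%E.
have mF : measurable_fun setT F.
  apply: (@ge0_emeasurable_sum _ _ _ _ (fun k x => (c k * \1_(Q k) x)%:E) predT) => [k x _ _|k _]; last exact: mk.
  exact: k0.
have uF x : (`|u x|%:E <= F x)%E.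
  have [k hk] : exists k, Q k x /\ `|u x| <= c k.
    have [h0 hj] := hu x.
    have [i hi] : exists i, Q i x.
      have : (\bigcup_k cube (const_mx (- k%:R) : 'rV[R]_d) (k.*2)%:R) x by rewrite cubes_cover.
      move=> [k _ /in_cube_centered hk]; exists k; apply/in_cube_centered => j.
      by apply: le_trans (hk j) _; rewrite ler_nat ltnW // ltn_expl.
    have [[|m] hm mmin] := ex_minnP (ex_intro (fun i => `[< Q i x >]) i (asboolT hi)).
      exists 0%N; split; first exact/asboolP.
      by apply: le_trans h0 _; rewrite /c expr0 expr1n mulr1 ler_peMr // exprn_ege1 // ler1n.
    exists m.+1; split; first exact/asboolP.
    have [j hj2] : exists j, (2 ^ m)%:R < `|x ord0 j|.
      apply: contrapT => nj; have : `[< Q m x >].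
        apply/asboolP; apply/in_cube_centered => j; rewrite leNgt; apply/negP => l.
        by apply: nj; exists j.
      by move/mmin; rewrite ltnn.
    have p0 : (0 : R) < (2 ^ m)%:R by rewrite ltr0n expn_gt0.
    have := hj j; rewrite mulrC -ler_pdivlMr ?exprn_gt0 //; last exact: lt_trans hj2.
    move/le_trans; apply; rewrite /c -mulrA -exprMn.
    have -> : 2 * 2^-1 ^+ m.+1 = ((2 ^ m)%:R)^-1 :> R.
      by rewrite exprS mulrA divff ?mul1r ?exprVn ?natrX.
    rewrite exprVn ler_wpM2l // lef_pV2 ?posrE ?exprn_gt0 //; last exact: lt_trans hj2.
    by rewrite lerXn2r ?nnegrE ?(ltW p0) // ltW.
  have [Qx ux] := hk.
  apply: (@le_trans _ _ (\sum_(0 <= i < k.+1) (c i * \1_(Q i) x)%:E)%E).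
    rewrite big_nat_recr //= indicE mem_set // mulr1 -[leLHS]add0e.
    by apply: leeD; [apply: sume_ge0 => l _; exact: k0|rewrite lee_fin].
  by apply: nneseries_lim_ge => l _ _; exact: k0.
have F0 x : (0 <= F x)%E by apply: nneseries_ge0 => k _ _; exact: k0.
apply/integrableP; split; first exact/measurable_EFinP.
apply: (@le_lt_trans _ _ (\int[mu]_x F x)%E).
  apply: ge0_le_integral => //.
  - by apply: measurableT_comp => //; exact/measurable_EFinP.
  by move=> x _; exact: uF.
rewrite /F integral_nneseries //.
pose K : R := C * 2 ^+ d.+1 * 2 ^+ d.
have K0 : 0 <= K by rewrite !mulr_ge0 ?exprn_ge0.
have cg : series (geometric K 2^-1) @ \oo --> (K / (1 - 2^-1) : R).
  by apply: cvg_geometric_series; rewrite ger0_norm // invf_lt1 // ltr1n.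
suff -> : (\sum_(0 <= k <oo) (\int[mu]_x (c k * \1_(Q k) x)%:E))%E = (K / (1 - 2^-1) : R)%:E.
  by rewrite ltry.
apply: cvg_lim => //.
rewrite (_ : (fun n => _) = EFin \o series (geometric K 2^-1)).
  by apply: cvg_EFin => //; exact: nearW.
apply/funext => n; rewrite /= /series /= -sumEFin; apply: eq_bigr => k _.
rewrite (eq_integral (fun x => (c k)%:E * (\1_(Q k) x)%:E)%E) // ge0_integralZl //; last first.
- by rewrite lee_fin.
- by apply/measurable_EFinP; exact: measurable_indic.
rewrite integral_indic // setIT lebesgue_cube ?ler0n // -EFinM; congr EFin.
have p0 : (2 : R) ^+ k != 0 by rewrite expf_neq0.
have q0 : ((2 : R) ^+ k) ^+ d != 0 by rewrite expf_neq0.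
rewrite /geometric /= /c /K -mul2n natrM natrX (exprMn _ 2) exprVn.
rewrite (_ : ((2 : R) ^+ k)^-1 ^+ d.+1 = (2 ^+ k)^-1 * ((2 ^+ k) ^+ d)^-1).
  by field; rewrite p0 q0.
by rewrite exprS exprVn.
Qed.

Lemma L12_decays u C : measurable_fun setT u -> decays d.+1 u C -> L12 u.
Proof.
move=> mu0 hu; have iu := integrable_decays mu0 hu; split => //.
have i2 := integrable_scale C measurableT (integrable_norm iu).
apply: (integrable_le measurableT _ i2) => [|x _]; first exact: measurable_funX.
by rewrite /= normrX expr2 ler_wpM2r //; have [] := hu x.
Qed.

(** On the cube of radius m a line integral is a difference of boundary values, at most
    [2 * C / m ^ d.+1], while the cross-section has volume [(2 * m) ^ d.-1]; the product tends to
    0. *)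
Lemma integral_partial0 G (j : 'I_d) C K : C_infty G -> decays d.+1 G C ->
  (forall x, `|partial j G x| <= K) -> mu.-integrable setT (EFin \o partial j G) ->
  \int[mu]_x partial j G x = 0.
Proof.
move=> CG hG hK iG; set F := partial j G.
have C0 := decays_ge0 hG.
have CF : C_infty F := C_infty_partial j CG.
have mF : measurable_fun setT F by apply: continuous_measurable_rV; exact: C_infty_cont.
have lim1 : (fun n => \int[mu]_x trunc n.+1 F x) @ \oo --> \int[mu]_x F x.
  apply: (@dominated_Rintegral _ _ _ _ _ _ (fun x => `|F x|)).
  - by move=> n; exact: measurable_trunc.
  - move=> x; apply: cvg_near_cst.
    have : (\bigcup_k cube (const_mx (- k%:R) : 'rV[R]_d) (k.*2)%:R) x by rewrite cubes_cover.
    move=> [k _ hk]; exists k => // n /= kn.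
    suff hn : cube (const_mx (- n.+1%:R)) (n.+1.*2)%:R x by rewrite /trunc indicE mem_set // mulr1.
    move/in_cube_centered in hk; apply/in_cube_centered => i.
    by apply: le_trans (hk i) _; rewrite ler_nat ltnW.
  - exact: integrable_norm.
  by move=> n x; exact: trunc_le.
pose L : R := 2 * C * 2 ^+ d.-1.
have lim0 : (fun n => \int[mu]_x trunc n.+1 F x) @ \oo --> (0 : R).
  have bnd n : `|\int[mu]_x trunc n.+1 F x| <= L * n.+1%:R^-1.
    set m := n.+1; have m0 : (0 : R) < m%:R by rewrite ltr0n.
    have s0 : (0 : R) <= (m.*2)%:R by exact: ler0n.
    have -> : \int[mu]_x trunc m F x = \int[mu]_(x in cube (const_mx (- m%:R)) (m.*2)%:R) F x.
      by rewrite [RHS]Rintegral_mkcond patch_indic.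
    have hKc z : cube (const_mx (- m%:R)) (m.*2)%:R z -> `|F z| <= K by move=> _; exact: hK.
    have := @cube_slice_bound R d F (const_mx (- m%:R)) (m.*2)%:R j _ (2 * C / m%:R ^+ d.+1) s0 mF hKc.
    have iF := integrable_cube s0 mF hKc.
    rewrite -EFin_normr_Rintegral //; last exact: measurable_cube.
    rewrite lee_fin => hb; apply: le_trans (hb _) _; last first.
      have -> : (m.*2)%:R ^+ d.-1 = 2 ^+ d.-1 * m%:R ^+ d.-1 :> R.
        by rewrite -mul2n natrM exprMn.
      rewrite /L.
      have -> : m%:R ^+ d.+1 = m%:R ^+ d.-1 * m%:R * m%:R :> R.
        by rewrite -!exprSr (ltn_predK (ltn_ord j)).
      have -> : 2 * C / (m%:R ^+ d.-1 * m%:R * m%:R) * (2 ^+ d.-1 * m%:R ^+ d.-1) =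
         2 * C * 2 ^+ d.-1 * m%:R^-1 * m%:R^-1 :> R.
        by field; rewrite expf_neq0 gt_eqF.
      rewrite ler_piMr ?invf_le1 ?ler1n // mulr_ge0 ?invr_ge0 ?(ltW m0) //.
      by rewrite !mulr_ge0 ?exprn_ge0.
    move=> z _; rewrite mxE.
    have em : - m%:R + (m.*2)%:R = m%:R :> R by rewrite -addnn natrD addKr.
    rewrite em.
    have dG t : is_derive t (1 : R) (fun s => G (upd z j s)) (F (upd z j t)).
      by apply: is_derive_slice; exact: C_infty_derivable.
    have cF t : {for t, continuous (fun s => F (upd z j s))}.
      apply: (@is_derive_cont _ _ (partial j F (upd z j t))).
      by apply: is_derive_slice; exact: C_infty_derivable.
    have icF := continuous_itv_integrable (a := - m%:R) (b := m%:R) (fun t _ => cF t).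
    rewrite -EFin_normr_Rintegral // lee_fin (Rintegral_derive _ (fun t _ => dG t) (fun t _ => cF t)); last first.
      by rewrite -subr_gt0 opprK addr_gt0.
    have G1 (t : R) : `|t| = m%:R -> `|G (upd z j t)| <= C / m%:R ^+ d.+1.
      move=> et; have [_ /(_ j)] := hG (upd z j t).
      by rewrite updE eqxx et mulrC -ler_pdivlMr // exprn_gt0.
    apply: le_trans (ler_normB _ _) _; rewrite -mulrA mulr_natl mulr2n.
    by apply: lerD; apply: G1; rewrite ?normrN ger0_norm // ltW.
  have L1 : 0 < L + 1 by rewrite ltr_wpDl // !mulr_ge0 ?exprn_ge0.
  apply/cvgrPdist_le => e e0; near=> n.
  rewrite sub0r normrN; apply: le_trans (bnd n) _.
  apply: (@le_trans _ _ ((L + 1) * n.+1%:R^-1)).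
    by rewrite ler_wpM2r ?invr_ge0 ?ler0n // lerDl.
  rewrite mulrC -ler_pdivlMr //; apply: ltW.
  near: n; exact: (near_infty_natSinv_lt (PosNum (divr_gt0 e0 L1))).
exact: (cvg_unique _ lim1 lim0).
Unshelve. all: by end_near. Qed.

End decay.

(** * The Fourier transform as an operator of the same kind *)

Section fourier_decay.
Context {R : realType} {d : nat}.
Local Notation mu := (lebesgue_rV R d).
Implicit Types (u v : 'rV[R]_d -> R) (x xi : 'rV[R]_d) (tau : R).

Lemma partial_affine n (f : 'rV[R]_n -> R) (z : 'rV[R]_n) i (c0 c : R) :
  (forall s, f (upd z i s) = c0 + c * s) ->
  derivable f z (delta_mx ord0 i) /\ partial i f z = c.
Proof.
move=> e; apply: slice_is_derive; rewrite (_ : (fun s => _) = (fun s => c0 + c * s)); last exact/funext.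
have h : is_derive (z ord0 i) (1 : R) (fun s => c0 + c * s) (0 + c *: 1).
  apply: is_deriveD.
by rewrite add0r [c *: 1]mulr1 in h.
Qed.

Lemma coord_affine n (k i : 'I_n) (z : 'rV[R]_n) :
  derivable (fun w : 'rV[R]_n => w ord0 k) z (delta_mx ord0 i) /\
  partial i (fun w : 'rV[R]_n => w ord0 k) z = (k == i)%:R.
Proof.
apply: (partial_affine (c0 := (k != i)%:R * z ord0 k)) => s; rewrite updE.
by case: eqP => _; rewrite ?mul0r ?mul1r ?add0r ?addr0.
Qed.

Lemma partial_coord n (k i : 'I_n) :
  partial i (fun w : 'rV[R]_n => w ord0 k) = (fun=> (k == i)%:R).
Proof. by apply/funext => z; have [] := coord_affine k i z. Qed.

Lemma C_infty_coord n (k : 'I_n) : C_infty (fun w : 'rV[R]_n => w ord0 k).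
Proof.
apply/C_inftyP; split; first exact: coord_continuous.
by move=> i; split=> [z|]; [have [] := coord_affine k i z|rewrite partial_coord; exact: C_infty_cst].
Qed.

(** A quadratic phase: its pure derivatives grow, its mixed ones are constant, and its mixed Hessian
    is minus the identity. *)
Definition dual_phase (w : 'rV[R]_(d + d)) : R :=
  - \sum_(k < d) w ord0 (lshift d k) * w ord0 (rshift d k).

Lemma dual_phase_row xi (z : 'rV[R]_d) : dual_phase (row_mx xi z) = - dot z xi.
Proof. by congr (- _); apply: eq_bigr => k _; rewrite row_mxEl row_mxEr mulrC. Qed.

Lemma C_infty_dual_phase : C_infty dual_phase.
Proof.
rewrite (_ : dual_phase = fun w => -1 * \sum_(k < d) w ord0 (lshift d k) * w ord0 (rshift d k)); last first.
  by apply/funext => w; rewrite mulN1r.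
apply: C_inftyZ; apply: C_infty_sum => k; apply: C_inftyM; exact: C_infty_coord.
Qed.

Let dual_phase_upd (i : 'I_d) (w w' : 'rV[R]_(d + d)) :
  (forall k, k != i -> w' ord0 (lshift d k) = w ord0 (lshift d k)) ->
  (forall k, k != i -> w' ord0 (rshift d k) = w ord0 (rshift d k)) ->
  dual_phase w' = - (\sum_(k < d | k != i) w ord0 (lshift d k) * w ord0 (rshift d k))
    - w' ord0 (lshift d i) * w' ord0 (rshift d i).
Proof.
move=> e1 e2; rewrite /dual_phase (bigD1 i) //= opprD addrC; congr (- _ + _).
by apply: eq_bigr => k ki; rewrite e1 // e2.
Qed.

Lemma partial_dual_phase_l (i : 'I_d) :
  partial (lshift d i) dual_phase = (fun w => -1 * w ord0 (rshift d i)).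
Proof.
apply/funext => w; rewrite mulN1r.
apply: (partial_affine (c0 := - \sum_(k < d | k != i) w ord0 (lshift d k) * w ord0 (rshift d k)) _).2 => s.
rewrite (@dual_phase_upd i w); last 2 first.
- by move=> k ki; rewrite updE (inj_eq (@lshift_inj _ _)) (negbTE ki).
- by move=> k ki; rewrite updE eq_rlshift.
by rewrite !updE eqxx eq_rlshift mulNr mulrC.
Qed.

Lemma partial_dual_phase_r (i : 'I_d) :
  partial (rshift d i) dual_phase = (fun w => -1 * w ord0 (lshift d i)).
Proof.
apply/funext => w; rewrite mulN1r.
apply: (partial_affine (c0 := - \sum_(k < d | k != i) w ord0 (lshift d k) * w ord0 (rshift d k)) _).2 => s.
rewrite (@dual_phase_upd i w); last 2 first.
- by move=> k ki; rewrite updE eq_lrshift.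
- by move=> k ki; rewrite updE (inj_eq (@rshift_inj _ _)) (negbTE ki).
by rewrite !updE eqxx eq_lrshift mulNr.
Qed.

Let partial_coordZ n (i k : 'I_n) :
  partial i (fun w : 'rV[R]_n => -1 * w ord0 k) = (fun=> - (k == i)%:R).
Proof.
rewrite partialZ ?partial_coord => [|z]; last by have [] := coord_affine k i z.
by apply/funext => w; rewrite mulN1r.
Qed.

Lemma mixed_phase_dual_phase : mixed_phase dual_phase.
Proof.
have C0 := C_infty_dual_phase; split=> // S /andP[/hasP[k kS kx] /hasP[l lS lx]].
have kl : k != l by apply: contraNneq lx => <-.
(* With one x-letter and one xi-letter in front, the remaining derivatives act on a constant. *)
have p : perm_eq S (k :: l :: rem l (rem k S)).
  apply: perm_trans (perm_to_rem kS) _; rewrite perm_cons; apply: perm_to_rem.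
  by move: lS; rewrite (perm_mem (perm_to_rem kS)) in_cons eq_sym (negbTE kl).
rewrite (iterp_perm C0 p) /=.
have hk : k = lshift d (Ordinal kx) by apply: val_inj.
rewrite hk partial_dual_phase_l partial_coordZ.
case: (rem _ _) => [|i s]; first by exists 1 => z /=; rewrite normrN; case: eqP; rewrite ?normr0 ?normr1.
by exists 0 => z; rewrite iterp_cst // normr0.
Qed.

Lemma det_hess_dual_phase x xi : `|\det (hess_x_xi dual_phase x xi)| = 1.
Proof.
have -> : hess_x_xi dual_phase x xi = (-1)%:M.
  apply/matrixP => i j; rewrite !mxE partial_dual_phase_r partial_coordZ (inj_eq (@lshift_inj _ _)).
  by rewrite eq_sym; case: eqP => _; rewrite ?mulr0n ?mulr1n ?oppr0.
by rewrite det_scalar normrX normrN1 expr1n.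
Qed.

Lemma bounded_smooth_cst (c : R) : bounded_smooth (fun _ : 'rV[R]_(d + d) => c).
Proof.
split=> [|[|i s]]; first exact: C_infty_cst; first by exists `|c|.
by exists 0 => z; rewrite iterp_cst // normr0.
Qed.

Definition rapidly_decreasing u := C_infty u /\
  forall S N, exists C, decays N (iterp S u) C.

Lemma rapidly_decreasing_partial i u : rapidly_decreasing u -> rapidly_decreasing (partial i u).
Proof. by move=> [Cu hu]; split=> [|S]; [exact: C_infty_partial|exact: (hu (i :: S))]. Qed.

Lemma measurable_C_infty u : C_infty u -> measurable_fun setT u.
Proof. by move=> Cu; apply: continuous_measurable_rV; exact: C_infty_cont. Qed.

Lemma L12_rapidly_decreasing u : rapidly_decreasing u -> L12 u.
Proof.
move=> [Cu hu]; have [C hC] := hu [::] d.+1.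
by apply: (L12_decays _ hC); exact: measurable_C_infty.
Qed.

Lemma rapidly_decreasing_schwartz (f : 'rV[R]_d -> R[i]) : schwartz f ->
  rapidly_decreasing (fun x => complex.Re (f x)) /\ rapidly_decreasing (fun x => complex.Im (f x)).
Proof.
move=> [[C1 C2] hf].
have sq (p q : R) : `|p| <= Num.sqrt (p ^+ 2 + q ^+ 2) /\ `|q| <= Num.sqrt (p ^+ 2 + q ^+ 2).
  by rewrite -!sqrtr_sqr !ler_wsqrtr // ?lerDl ?lerDr sqr_ge0.
have key (al : multi_index d) S : exists C, forall x,
    `|monomial al x| * `|iterp S (fun x => complex.Re (f x)) x| <= C /\
    `|monomial al x| * `|iterp S (fun x => complex.Im (f x)) x| <= C.
  have [C hC] := hf al (fun i => count_mem i S); exists C => x.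
  rewrite (iterp_partials _ C1) (iterp_partials _ C2) -!normrM.
  have := hC x; rewrite /Cmod /= !mul0r subr0 addr0 => H.
  by split; apply: le_trans H; [exact: (sq _ _).1|exact: (sq _ _).2].
(* Powers of a single coordinate suffice for [decays]. *)
pose al N j : multi_index d := fun i => (N * (i == j))%N.
have mon N j (x : 'rV[R]_d) : monomial (al N j) x = x ord0 j ^+ N.
  rewrite /monomial (bigD1 j) //= /al eqxx muln1 big1 ?mulr1 // => i /negbTE ->.
  by rewrite muln0 expr0.
have H S N : exists C, decays N (iterp S (fun x => complex.Re (f x))) C /\
    decays N (iterp S (fun x => complex.Im (f x))) C.
  have [C0 h0] := key (fun=> 0%N) S.
  have [||C1' C1'0 h1] := @fin_bound R 'I_d (fun j C => forall x : 'rV[R]_d,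
    `|monomial (al N j) x| * `|iterp S (fun x => complex.Re (f x)) x| <= C /\
    `|monomial (al N j) x| * `|iterp S (fun x => complex.Im (f x)) x| <= C).
  - by move=> i C C' CC hC x; have [a1 a2] := hC x; split; apply: le_trans CC.
  - by move=> j; exact: key.
  exists (`|C0| + C1').
  by split=> x; (split=> [|j]; [have := h0 x; rewrite /monomial big1 // normr1 !mul1r => -[a1 a2];
     apply: (le_trans _ (lerD (ler_norm C0) C1'0)); rewrite addr0 |
    have := h1 j x; rewrite mon normrX => -[a1 a2]; apply: (le_trans _ (lerD (normr_ge0 C0) (lexx C1')));
     rewrite add0r]).
by split; (split=> // S N; have [C [h1 h2]] := H S N; exists C).
Qed.

Definition dual_fio tau u := fio dual_phase (fun=> 1) tau u.

Lemma dual_fio_integrable tau u xi : L12 u ->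
  mu.-integrable setT (EFin \o (fun z => u z * cos (dual_phase (row_mx xi z) + tau))).
Proof.
move=> [mu0 iu _]; apply: integrable_cosM => //; apply: measurable_funD; last exact: measurable_cst.
by apply: measurable_C_infty; apply: C_infty_rowr; exact: C_infty_dual_phase.
Qed.

Lemma dual_fioE tau u xi :
  dual_fio tau u xi = \int[mu]_z (u z * cos (dual_phase (row_mx xi z) + tau)).
Proof. by apply: eq_Rintegral => z _; rewrite mulr1 mulrC. Qed.

Lemma dual_fio_bound tau u xi : L12 u -> `|dual_fio tau u xi| <= \int[mu]_z `|u z|.
Proof.
move=> Lu; have [mu0 iu _] := Lu; have ic := dual_fio_integrable tau xi Lu.
rewrite dual_fioE; apply: le_trans (le_normr_Rintegral _ ic) _ => //.
apply: le_Rintegral => //; [exact: integrable_norm|exact: integrable_norm|].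
move=> z _; rewrite normrM ler_piMr //.
by rewrite ler_norml cos_geN1 cos_le1.
Qed.

(* Integration by parts: [xi_j] times the transform is the transform of the
   derivative, the factor [i] being a shift of the phase. *)
Lemma dual_fio_partial tau u xi (j : 'I_d) : rapidly_decreasing u ->
  xi ord0 j * dual_fio tau u xi = dual_fio (tau - pi / 2) (partial j u) xi.
Proof.
move=> hu; have Lu := L12_rapidly_decreasing hu.
have hv := rapidly_decreasing_partial j hu; have Lv := L12_rapidly_decreasing hv.
have [Cu bu] := hu; have [C hC] := bu [::] d.+1; have [C' hC'] := bu [:: j] d.+1.
pose th z := dual_phase (row_mx xi z).
have Cth : C_infty th by apply: C_infty_rowr; exact: C_infty_dual_phase.
pose G z := cos (th z + (tau - pi / 2)) * u z.
have Ccos t : C_infty (fun z => cos (th z + t)) by exact: C_infty_cos.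
have CG : C_infty G by apply: C_inftyM.
have pth : partial j th = (fun=> - xi ord0 j).
  apply/funext => z; rewrite /th.
  have [_ ->] := partial_subst (fun z i t => row_mx_updr xi z i t)
    (C_infty_derivable (rshift d j) (row_mx xi z) C_infty_dual_phase).
  by rewrite partial_dual_phase_r row_mxEl mulN1r.
have pG : partial j G = (fun z => - xi ord0 j * (u z * cos (th z + tau)) +
    partial j u z * cos (th z + (tau - pi / 2))).
  rewrite /G (partialM (fun z => C_infty_derivable j z (Ccos _)) (fun z => C_infty_derivable j z Cu)).
  rewrite (partial_cos _ (fun z => C_infty_derivable j z Cth)) pth; apply/funext => z.
  by rewrite subrK; ring.
have cos1 (t : R) : `|cos t| <= 1 by rewrite ler_norml cos_geN1 cos_le1.
have i1 := dual_fio_integrable tau xi Lu.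
have i2 := dual_fio_integrable (tau - pi / 2) xi Lv.
have i1' := integrable_scale (- xi ord0 j) measurableT i1.
have iG : mu.-integrable setT (EFin \o partial j G) by rewrite pG; exact: integrable_add.
have dG : decays d.+1 G C.
  move=> z; have [a0 a1] := hC z.
  have le : `|G z| <= `|u z| by rewrite /G normrM ler_piMl.
  by split=> [|k]; [exact: le_trans a0|apply: le_trans (a1 k); rewrite ler_wpM2l // exprn_ge0].
have bG z : `|partial j G z| <= `|xi ord0 j| * C + C'.
  have [a0 _] := hC z; have [b0 _] := hC' z.
  rewrite pG; apply: le_trans (ler_normD _ _) _; apply: lerD.
    rewrite normrM normrN ler_wpM2l // normrM; apply: le_trans a0.
    by rewrite ler_piMr.
  by rewrite normrM; apply: le_trans b0; rewrite ler_piMr.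
have := integral_partial0 CG dG bG iG.
rewrite pG RintegralD // RintegralZl // !dual_fioE mulNr => /eqP.
by rewrite addrC subr_eq0 => /eqP ->.
Qed.

(** A by-product of [fio_bound], which obtains the function as a limit of measurable step
    operators. *)
Lemma measurable_dual_fio tau u : L12 u -> measurable_fun setT (dual_fio tau u).
Proof.
move=> Lu.
have [|C _ h] := fio_bound mixed_phase_dual_phase (bounded_smooth_cst 1) (ltr01 : 0 < 1 :> R).
  by move=> x xi; rewrite det_hess_dual_phase.
by have [] := h tau u Lu.
Qed.

(** Each factor [xi_j] is traded for a derivative of [u]; the trade shifts the phase, so the bounds
    are proved uniformly in the shift. *)
Lemma L12_dual_fio tau u : rapidly_decreasing u -> L12 (dual_fio tau u).
Proof.
move=> hu.
have key (j : 'I_d) N : forall v, rapidly_decreasing v -> exists C, forall t xi, `|xi ord0 j| ^+ N * `|dual_fio t v xi| <= C.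
  elim: N => [|N IH] v hv.
    exists (\int[mu]_z `|v z|) => t xi; rewrite expr0 mul1r.
    by apply: dual_fio_bound; exact: L12_rapidly_decreasing.
  have [C hC] := IH _ (rapidly_decreasing_partial j hv); exists C => t xi.
  by rewrite exprSr -mulrA -normrM dual_fio_partial.
have [||C C0 hC] := @fin_bound R 'I_d (fun j C => forall xi, `|xi ord0 j| ^+ d.+1 * `|dual_fio tau u xi| <= C).
- by move=> j C C' CC h xi; apply: le_trans CC.
- by move=> j; have [C hC] := key j d.+1 u hu; exists C => xi.
have Lu := L12_rapidly_decreasing hu.
have I0 : 0 <= \int[mu]_z `|u z| by exact: Rintegral_ge0.
apply: (L12_decays (C := \int[mu]_z `|u z| + C)); first exact: measurable_dual_fio.
move=> xi; split=> [|j].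
  by apply: le_trans (dual_fio_bound tau xi Lu) _; rewrite lerDl.
by apply: le_trans (hC j xi) _; rewrite lerDr.
Qed.

End fourier_decay.

(** * Complex operators assembled from real ones *)

Section L2_operators.
Context {R : realType} {d : nat}.
Local Notation mu := (lebesgue_rV R d).
Local Notation fR := ('rV[R]_d -> R).
Local Notation fC := ('rV[R]_d -> R[i]).
Implicit Types (u v w : fR) (f g : fC) (B E P Q : fR -> fR) (a b c : R).

Definition L2_ext B := exists2 E, L2_op E & forall u, L12 u -> {ae mu, forall x, E u x = B u x}.

Lemma L2_op_lin P Q b c : L2_op P -> L2_op Q -> L2_op (fun u x => b * P u x + c * Q u x).
Proof.
move=> [[C C0 hP] lP] [[C' C'0 hQ] lQ]; split.
  exists (2 * (b ^+ 2 * C) + 2 * (c ^+ 2 * C')) => [|u a hu].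
    by rewrite addr_ge0 // mulr_ge0 // mulr_ge0 // sqr_ge0.
  by apply: msqW (msqD (msqZ b (hP _ _ hu)) (msqZ c (hQ _ _ hu))); rewrite le_eqVlt; apply/orP; left; apply/eqP; ring.
move=> k u v a a' hu hv.
by apply: filterS2 (lP k u v a a' hu hv) (lQ k u v a a' hu hv) => x -> ->; ring.
Qed.

Lemma L2_ext_lin B B' b c : L2_ext B -> L2_ext B' -> L2_ext (fun u x => b * B u x + c * B' u x).
Proof.
move=> [E hE eE] [E' hE' eE']; exists (fun u x => b * E u x + c * E' u x); first exact: L2_op_lin.
by move=> u Lu; apply: filterS2 (eE u Lu) (eE' u Lu) => x -> ->.
Qed.

Section fio_extension.
Variables (phi sym : 'rV[R]_(d + d) -> R).
Hypotheses (hphi : mixed_phase phi) (hsym : bounded_smooth sym).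

Lemma fio_integrable tau u x : L12 u ->
  mu.-integrable setT (EFin \o (fun z => cos (phi (row_mx x z) + tau) * sym (row_mx x z) * u z)).
Proof.
move=> [mu0 iu _]; have [Csym /(_ [::])[C hC]] := hsym.
have ik := integrable_scale C measurableT (integrable_norm iu).
apply: (integrable_le measurableT _ ik) => [|z _].
  apply: measurable_funM => //; apply: measurable_C_infty.
  apply: C_inftyM; last exact: C_infty_rowr.
  by apply: C_infty_cos; apply: C_infty_rowr; exact: hphi.1.
rewrite /= normrM ler_wpM2r // normrM -[leRHS]mul1r; apply: ler_pM => //.
  by rewrite ler_norml cos_geN1 cos_le1.
Qed.

Lemma fio_L2_ext c tau : 0 < c -> (forall x xi, c <= `|\det (hess_x_xi phi x xi)|) ->
  L2_ext (fio phi sym tau).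
Proof.
move=> c0 hdet; have [C C0 hC] := fio_bound hphi hsym c0 hdet.
apply: (@L2_op_extension _ _ _ C); split => // [u a Lu hu|k u v Lu Lv x].
  have [m h] := hC tau u Lu; split => //; apply: le_trans h _.
  rewrite lee_fin ler_wpM2l // -lee_fin; apply: le_trans hu.2.
  by rewrite /Rintegral fineK // (integrable_fin_num _ (msq_integrable hu)).
have iu := fio_integrable tau x Lu; have iv := fio_integrable tau x Lv.
rewrite /fio -(RintegralZl _ measurableT iu) // -RintegralD //; last exact: integrable_scale.
by apply: eq_Rintegral => z _; ring.
Qed.

End fio_extension.

Definition csq f a := [/\ measurable_fun setT (fun x => complex.Re (f x)),
  measurable_fun setT (fun x => complex.Im (f x)) &
  (\int[mu]_x ((Cmod (f x)) ^+ 2)%:E <= a%:E)%E].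

Let Cmod_sqr (z : R[i]) : Cmod z ^+ 2 = complex.Re z ^+ 2 + complex.Im z ^+ 2.
Proof. by case: z => p q; rewrite /Cmod /= sqr_sqrtr // addr_ge0 ?sqr_ge0. Qed.

Let Cmod_ge0 (z : R[i]) : 0 <= Cmod z.
Proof. by case: z => p q; rewrite sqrtr_ge0. Qed.

Let measurable_Cmod2 f : measurable_fun setT (fun x => complex.Re (f x)) ->
  measurable_fun setT (fun x => complex.Im (f x)) ->
  measurable_fun setT (fun x => ((Cmod (f x)) ^+ 2)%:E).
Proof.
move=> m1 m2; apply/measurable_EFinP; rewrite (_ : (fun x => _) =
  (fun x => complex.Re (f x) ^+ 2 + complex.Im (f x) ^+ 2)).
  by apply: measurable_funD; exact: measurable_funX.
by apply/funext => x; exact: Cmod_sqr.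
Qed.

Lemma csq_msq f a : csq f a ->
  msq mu (fun x => complex.Re (f x)) a /\ msq mu (fun x => complex.Im (f x)) a.
Proof.
move=> [m1 m2 h]; split; (split=> //; apply: le_trans h; apply: ge0_le_integral => //;
  [by move=> x _; rewrite lee_fin sqr_ge0|exact: measurable_sqr_EFin|exact: measurable_Cmod2|]).
  by move=> x _; rewrite lee_fin Cmod_sqr lerDl sqr_ge0.
by move=> x _; rewrite lee_fin Cmod_sqr lerDr sqr_ge0.
Qed.

Lemma msq_csq f a b : msq mu (fun x => complex.Re (f x)) a ->
  msq mu (fun x => complex.Im (f x)) b -> csq f (a + b).
Proof.
move=> [m1 h1] [m2 h2]; split => //.
rewrite (eq_integral (fun x => (complex.Re (f x) ^+ 2)%:E + (complex.Im (f x) ^+ 2)%:E)%E); last first.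
  by move=> x _; rewrite Cmod_sqr EFinD.
rewrite ge0_integralD //; first by rewrite [leRHS]EFinD; exact: leeD.
- by move=> x _; rewrite lee_fin sqr_ge0.
- exact: measurable_sqr_EFin.
- by move=> x _; rewrite lee_fin sqr_ge0.
- exact: measurable_sqr_EFin.
Qed.

Lemma L2normE f : L2norm f = ((\int[mu]_x ((Cmod (f x)) ^+ 2)%:E) `^ 2^-1)%E.
Proof.
rewrite /L2norm unlock /=; congr (_ `^ _)%E; apply: eq_integral => x _.
by rewrite ger0_norm // powR_mulrn.
Qed.

Lemma csq_inL2 f a : csq f a -> inL2 f.
Proof.
move=> [m1 m2 h]; split => //; rewrite L2normE; apply: poweR_lty.
by apply: le_lt_trans h _; exact: ltry.
Qed.

Lemma inL2_csq f : inL2 f -> exists2 a, csq f a & (\int[mu]_x ((Cmod (f x)) ^+ 2)%:E)%E = a%:E.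
Proof.
move=> [m1 m2]; rewrite L2normE => h.
have I0 : (0 <= \int[mu]_x ((Cmod (f x)) ^+ 2)%:E)%E.
  by apply: integral_ge0 => x _; rewrite lee_fin sqr_ge0.
have Ify : (\int[mu]_x ((Cmod (f x)) ^+ 2)%:E < +oo)%E.
  have n0 : (2^-1 : R) != 0 by rewrite invr_neq0.
  by rewrite ltey; apply/eqP => e; move: h; rewrite e poweRyr // ltxx.
have e : (\int[mu]_x ((Cmod (f x)) ^+ 2)%:E = (fine (\int[mu]_x ((Cmod (f x)) ^+ 2)%:E))%:E)%E.
  by rewrite fineK // ge0_fin_numE.
by exists (fine (\int[mu]_x ((Cmod (f x)) ^+ 2)%:E)%E) => //; split => //; rewrite -e.
Qed.

(** The action of P + i Q, for real operators P and Q, on complex-valued functions. *)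
Definition cplx_op P Q f : fC := fun x =>
  ((P (fun y => complex.Re (f y)) x - Q (fun y => complex.Im (f y)) x)
  +i* (Q (fun y => complex.Re (f y)) x + P (fun y => complex.Im (f y)) x))%C.

Lemma csq_lin (k : R[i]) f g a b : csq f a -> csq g b -> exists c, csq (fun x => k * f x + g x) c.
Proof.
case: k => k1 k2 /csq_msq[h1 h2] /csq_msq[h3 h4]; eexists; apply: msq_csq.
  apply: (msq_ext _ (msqD (msqZ k1 h1) (msqD (msqZ (- k2) h2) h3))) => x /=.
  by case: (f x) (g x) => [p q] [p' q'] /=; ring.
apply: (msq_ext _ (msqD (msqZ k1 h2) (msqD (msqZ k2 h1) h4))) => x /=.
by case: (f x) (g x) => [p q] [p' q'] /=; ring.
Qed.

Lemma L2_op_lin3 E b c u v w a1 a2 a3 : L2_op E -> msq mu u a1 -> msq mu v a2 -> msq mu w a3 ->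
  {ae mu, forall x, E (fun z => b * u z + (c * v z + w z)) x = b * E u x + (c * E v x + E w x)}.
Proof.
move=> [_ lE] hu hv hw.
apply: filterS2 (lE b _ _ _ _ hu (msqD (msqZ c hv) hw)) (lE c _ _ _ _ hv hw) => x -> ->.
by [].
Qed.

Lemma bounded_linear_cplx_op P Q : L2_op P -> L2_op Q -> bounded_linear_L2 (cplx_op P Q).
Proof.
move=> hP hQ; have [[C C0 bP] lP] := hP; have [[C' C'0 bQ] lQ] := hQ.
pose K := 2 * C + 2 * C' + (2 * C' + 2 * C).
have K0 : 0 <= K by rewrite !addr_ge0 // mulr_ge0.
have bT f a : csq f a -> csq (cplx_op P Q f) (K * a).
  move=> /csq_msq[h1 h2]; have := msq_csq (f := cplx_op P Q f)
    (msqB (bP _ _ h1) (bQ _ _ h2)) (msqD (bQ _ _ h1) (bP _ _ h2)).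
  by rewrite !mulrA -!mulrDl.
split.
- by move=> f /inL2_csq[a h _]; exact: csq_inL2 (bT _ _ h).
- move=> f g /inL2_csq[a /csq_msq[h1 h2] _] /inL2_csq[b /csq_msq[h3 h4] _] fg.
  have e1 : {ae mu, forall x, complex.Re (f x) = complex.Re (g x)}.
    by apply: filterS fg => x /(_ I) ->.
  have e2 : {ae mu, forall x, complex.Im (f x) = complex.Im (g x)}.
    by apply: filterS fg => x /(_ I) ->.
  have eR : {ae mu, forall x, complex.Re (cplx_op P Q f x) = complex.Re (cplx_op P Q g x)}.
    by apply: filterS2 (L2_op_ae hP h1 h3 e1) (L2_op_ae hQ h2 h4 e2) => x /= -> ->.
  have eI : {ae mu, forall x, complex.Im (cplx_op P Q f x) = complex.Im (cplx_op P Q g x)}.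
    by apply: filterS2 (L2_op_ae hQ h1 h3 e1) (L2_op_ae hP h2 h4 e2) => x /= -> ->.
  by apply: filterS2 eR eI => x /eqP e1' /eqP e2' _; apply/eqP; rewrite eq_complex e1' e2'.
- move=> [k1 k2] f g /inL2_csq[a /csq_msq[h1 h2] _] /inL2_csq[b /csq_msq[h3 h4] _].
  have eR : (fun y => complex.Re ((k1 +i* k2)%C * f y + g y)) =
    (fun y => k1 * complex.Re (f y) + (- k2 * complex.Im (f y) + complex.Re (g y))).
    by apply/funext => y; case: (f y) (g y) => [p q] [p' q'] /=; ring.
  have eI : (fun y => complex.Im ((k1 +i* k2)%C * f y + g y)) =
    (fun y => k1 * complex.Im (f y) + (k2 * complex.Re (f y) + complex.Im (g y))).
    by apply/funext => y; case: (f y) (g y) => [p q] [p' q'] /=; ring.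
  have aR : {ae mu, forall x, complex.Re (cplx_op P Q (fun y => (k1 +i* k2)%C * f y + g y) x) =
      complex.Re ((k1 +i* k2)%C * cplx_op P Q f x + cplx_op P Q g x)}.
    apply: filterS2 (L2_op_lin3 k1 (- k2) hP h1 h2 h3) (L2_op_lin3 k1 k2 hQ h2 h1 h4) => x a1 a2.
    by rewrite /cplx_op eR eI /= a1 a2; ring.
  have aI : {ae mu, forall x, complex.Im (cplx_op P Q (fun y => (k1 +i* k2)%C * f y + g y) x) =
      complex.Im ((k1 +i* k2)%C * cplx_op P Q f x + cplx_op P Q g x)}.
    apply: filterS2 (L2_op_lin3 k1 (- k2) hQ h1 h2 h3) (L2_op_lin3 k1 k2 hP h2 h1 h4) => x a1 a2.
    by rewrite /cplx_op eR eI /= a1 a2; ring.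
  by apply: filterS2 aR aI => x /eqP a1 /eqP a2 _; apply/eqP; rewrite eq_complex a1 a2.
exists (K `^ 2^-1); first exact: powR_ge0.
move=> f /inL2_csq[a h e]; have [_ _ hT] := bT f a h.
have a0 : 0 <= a by rewrite -lee_fin -e; apply: integral_ge0 => x _; rewrite lee_fin sqr_ge0.
rewrite !L2normE e -poweR_EFin -poweRM ?lee_fin // -EFinM.
apply: gt0_ler_poweR => //; rewrite ?in_itv /= ?leey ?andbT ?lee_fin ?mulr_ge0 //.
by apply: integral_ge0 => x _; rewrite lee_fin sqr_ge0.
Qed.

Lemma bounded_linear_comp (S T : fC -> fC) : bounded_linear_L2 S -> bounded_linear_L2 T ->
  bounded_linear_L2 (fun f => S (T f)).
Proof.
move=> [S1 S2 S3 [C C0 S4]] [T1 T2 T3 [C' C'0 T4]]; split.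
- by move=> f hf; apply: S1; exact: T1.
- by move=> f g hf hg fg; apply: S2; [exact: T1|exact: T1|exact: T2].
- move=> c f g hf hg.
  have [a ha _] := inL2_csq hf; have [b hb _] := inL2_csq hg.
  have [a' ha' _] := inL2_csq (T1 f hf); have [b' hb' _] := inL2_csq (T1 g hg).
  have [k hk] := csq_lin c ha hb; have [k' hk'] := csq_lin c ha' hb'.
  have A := S2 _ _ (T1 _ (csq_inL2 hk)) (csq_inL2 hk') (T3 c f g hf hg).
  by apply: filterS2 A (S3 c _ _ (T1 f hf) (T1 g hg)) => x e1 e2 _; rewrite e1 // e2.
exists (C * C'); first exact: mulr_ge0.
move=> f hf; apply: le_trans (S4 _ (T1 f hf)) _.
by rewrite EFinM -muleA; apply: lee_wpmul2l; [rewrite lee_fin|exact: T4].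
Qed.

Lemma cplx_op_ext P Q B B' f : (forall u, L12 u -> {ae mu, forall x, P u x = B u x}) ->
  (forall u, L12 u -> {ae mu, forall x, Q u x = B' u x}) ->
  L12 (fun x => complex.Re (f x)) -> L12 (fun x => complex.Im (f x)) ->
  cplx_op P Q f = cplx_op B B' f %[ae mu].
Proof.
move=> hP hQ h1 h2.
have eR : {ae mu, forall x, complex.Re (cplx_op P Q f x) = complex.Re (cplx_op B B' f x)}.
  by apply: filterS2 (hP _ h1) (hQ _ h2) => x /= -> ->.
have eI : {ae mu, forall x, complex.Im (cplx_op P Q f x) = complex.Im (cplx_op B B' f x)}.
  by apply: filterS2 (hQ _ h1) (hP _ h2) => x /= -> ->.
by apply: filterS2 eR eI => x /eqP e1' /eqP e2' _; apply/eqP; rewrite eq_complex e1' e2'.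
Qed.

Lemma csq_L12 f : L12 (fun x => complex.Re (f x)) -> L12 (fun x => complex.Im (f x)) ->
  exists a, csq f a.
Proof.
by move=> [m1 _ s1] [m2 _ s2]; eexists; apply: msq_csq; exact: integrable_msq.
Qed.

Local Notation c0 := (((2 : R) * pi) `^ (- (d%:R / 2))).

(** The cosine of the exponential is the shift 0, its sine the shift [- (pi / 2)]. *)
Lemma fourier_cplx_op f : L12 (fun x => complex.Re (f x)) -> L12 (fun x => complex.Im (f x)) ->
  fourier f = cplx_op (fun u x => c0 * dual_fio 0 u x) (fun u x => c0 * dual_fio (- (pi / 2)) u x) f.
Proof.
move=> h1 h2; apply/funext => xi.
have I t u (hu : L12 u) := dual_fio_integrable t xi hu.
have eR : \int[mu]_x complex.Re (f x * expi (- dot x xi)) =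
    dual_fio 0 (fun x => complex.Re (f x)) xi - dual_fio (- (pi / 2)) (fun x => complex.Im (f x)) xi.
  rewrite !dual_fioE -RintegralB //; [|exact: I|exact: I].
  apply: eq_Rintegral => x _; rewrite dual_phase_row addr0 cosBpihalf.
  by case: (f x) => p q /=.
have eI : \int[mu]_x complex.Im (f x * expi (- dot x xi)) =
    dual_fio (- (pi / 2)) (fun x => complex.Re (f x)) xi + dual_fio 0 (fun x => complex.Im (f x)) xi.
  rewrite !dual_fioE -RintegralD //; [|exact: I|exact: I].
  apply: eq_Rintegral => x _; rewrite dual_phase_row addr0 cosBpihalf.
  by case: (f x) => p q /=.
rewrite /fourier /integralC eR eI /cplx_op; apply/eqP; rewrite eq_complex /=.
by apply/andP; split; apply/eqP; ring.
Qed.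

(** Four real operators: the real and the imaginary part of the amplitude, each with cosine and
    sine. *)
Lemma Op_cplx_op phi (sym : 'rV[R]_(d + d) -> R[i]) f : mixed_phase phi ->
  bounded_smooth (fun z => complex.Re (sym z)) -> bounded_smooth (fun z => complex.Im (sym z)) ->
  L12 (fun x => complex.Re (fourier f x)) -> L12 (fun x => complex.Im (fourier f x)) ->
  let F s t := fio phi (fun z => s (sym z)) t in
  Op phi sym f = cplx_op
    (fun u x => c0 * F (@complex.Re R) 0 u x + - c0 * F (@complex.Im R) (- (pi / 2)) u x)
    (fun u x => c0 * F (@complex.Re R) (- (pi / 2)) u x + c0 * F (@complex.Im R) 0 u x)
    (fourier f).
Proof.
move=> hphi hs1 hs2 h1 h2 F; apply/funext => x.
have I1 t u (hu : L12 u) := fio_integrable hphi hs1 t x hu.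
have I2 t u (hu : L12 u) := fio_integrable hphi hs2 t x hu.
pose G xi := expi (phi (row_mx x xi)) * sym (row_mx x xi) * fourier f xi.
pose u xi := complex.Re (fourier f xi); pose v xi := complex.Im (fourier f xi).
have eR : \int[mu]_xi complex.Re (G xi) = F (@complex.Re R) 0 u x - F (@complex.Im R) (- (pi / 2)) u x
    - (F (@complex.Re R) (- (pi / 2)) v x + F (@complex.Im R) 0 v x).
  rewrite -RintegralB //; [|exact: I1|exact: I2].
  rewrite -RintegralD //; [|exact: I1|exact: I2].
  rewrite -RintegralB //; last 2 first.
  - have := integrable_add measurableT (I1 0 u h1) (integrable_scale (-1) measurableT (I2 (- (pi / 2)) u h1)).
    by apply: eq_integrable => // z _ /=; rewrite mulN1r.
  - by apply: integrable_add => //; [exact: I1|exact: I2].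
  apply: eq_Rintegral => xi _; rewrite /G /u /v addr0 cosBpihalf.
  by case: (fourier f xi) (sym _) => [p q] [s t] /=; ring.
have eI : \int[mu]_xi complex.Im (G xi) = F (@complex.Re R) (- (pi / 2)) u x + F (@complex.Im R) 0 u x
    + (F (@complex.Re R) 0 v x - F (@complex.Im R) (- (pi / 2)) v x).
  rewrite -RintegralD //; [|exact: I1|exact: I2].
  rewrite -RintegralB //; [|exact: I1|exact: I2].
  rewrite -RintegralD //; last 2 first.
  - by apply: integrable_add => //; [exact: I1|exact: I2].
  - have := integrable_add measurableT (I1 0 v h2) (integrable_scale (-1) measurableT (I2 (- (pi / 2)) v h2)).
    by apply: eq_integrable => // z _ /=; rewrite mulN1r.
  apply: eq_Rintegral => xi _; rewrite /G /u /v addr0 cosBpihalf.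
  by case: (fourier f xi) (sym _) => [p q] [s t] /=; ring.
rewrite /Op /integralC eR eI /cplx_op; apply/eqP; rewrite eq_complex /=.
by apply/andP; split; apply/eqP; rewrite -/u -/v; ring.
Qed.

End L2_operators.

Theorem theorem4p1 (R : realType) (d : nat)
    (phi : 'rV[R]_(d + d) -> R) (a : 'rV[R]_(d + d) -> R[i]) (r rho : R)
    (hphi : regular_phase phi)
    (hr : 0 <= r) (hrho : 0 <= rho)
    (ha : SG 0 0 r rho a) :
  extends_to_bounded_L2 (Op phi a).
Proof.
have [hSG _ _ [c c0 hdet]] := hphi; have mphi := mixed_phase_SG hSG.
have [ha1 ha2] := bounded_smooth_SG hr hrho ha.
pose k : R := (2 * pi) `^ (- (d%:R / 2)).
have E0 t : L2_ext (fun (u : 'rV[R]_d -> R) x => k * dual_fio t u x).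
  have hD : L2_ext (@dual_fio R d t).
    apply: (fio_L2_ext mixed_phase_dual_phase (bounded_smooth_cst 1) t (ltr01 : 0 < 1 :> R)) => x xi.
    by rewrite det_hess_dual_phase.
  have [E hE eE] := L2_ext_lin k 0 hD hD; exists E => // u Lu.
  by apply: filterS (eE u Lu) => x ->; rewrite mul0r addr0.
have E1 t := fio_L2_ext mphi ha1 t c0 hdet; have E2 t := fio_L2_ext mphi ha2 t c0 hdet.
have [P0 hP0 eP0] := E0 0; have [Q0 hQ0 eQ0] := E0 (- (pi / 2)).
have [P1 hP1 eP1] := L2_ext_lin k (- k) (E1 0) (E2 (- (pi / 2))).
have [Q1 hQ1 eQ1] := L2_ext_lin k k (E1 (- (pi / 2))) (E2 0).
have bT0 := bounded_linear_cplx_op hP0 hQ0; have bT1 := bounded_linear_cplx_op hP1 hQ1.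
exists (fun f => cplx_op P1 Q1 (cplx_op P0 Q0 f)); first exact: bounded_linear_comp.
move=> f /rapidly_decreasing_schwartz[hu hv].
have Lu := L12_rapidly_decreasing hu; have Lv := L12_rapidly_decreasing hv.
have [a1 ca1] := csq_L12 Lu Lv.
have LF t u : rapidly_decreasing u -> L12 (dual_fio t u : 'rV[R]_d -> R) by exact: L12_dual_fio.
have eF := fourier_cplx_op Lu Lv.
have LR : L12 (fun x => complex.Re (fourier f x)).
  rewrite eF (_ : (fun x => _) = (fun x => - k * dual_fio (- (pi / 2)) (fun y => complex.Im (f y)) x +
     k * dual_fio 0 (fun y => complex.Re (f y)) x)).
    by apply: L12_lin; [exact: LF|apply: L12Z; exact: LF].
  by apply/funext => x; rewrite /= mulNr addrC.
have LI : L12 (fun x => complex.Im (fourier f x)).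
  rewrite eF; apply: L12_lin; first exact: LF.
  by apply: L12Z; exact: LF.
(* The inner extension is the Fourier transform only almost everywhere. The outer one respects such
   equalities and, as [fourier f] is integrable and square integrable, coincides there with the
   integral defining [Op]. *)
have e0 : cplx_op P0 Q0 f = fourier f %[ae lebesgue_rV R d].
  by rewrite eF; exact: cplx_op_ext.
have [a2 ca2] := csq_L12 LR LI.
have [b1 b2 _ _] := bT0; have [_ d2 _ _] := bT1.
have A := d2 _ _ (b1 _ (csq_inL2 ca1)) (csq_inL2 ca2) e0.
have B := cplx_op_ext eP1 eQ1 LR LI.
rewrite (Op_cplx_op mphi ha1 ha2 LR LI).
by apply: filterS2 A B => x h1 h2 _; rewrite h1 // h2.
Qed.
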